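(* Let $p\in[1,\infty)$ and let $q\in(1,\infty]$ satisfy $p^{-1}+q^{-1}=1$. Let $E$ be a real Banach space, assumed to be reflexive if $p\in(1,\infty)$. Let $F\colon I\times E\multimap E$ be a set-valued map such that: (F1) for every $(t,x)\in I\times E$ the set $F(t,x)$ is nonempty, closed and convex; (F2) for every $x\in E$ the map $F(\cdot,x)$ has a strongly measurable selection; (F3) for a.a. $t\in I$ the map $F(t,\cdot)$ is upper hemicontinuous; (F4) there is $c\in L^p(I,\mathbb{R})$ such that $\sup\{|y|\colon y\in F(t,x)\}\leqslant c(t)(1+|x|)$ for a.a. $t\in I$ and all $x\in E$; (F5) there is $\eta\in L^p(I,\mathbb{R})$ such that for all bounded subsets $\Omega\subset E$ and for a.a. $t\in I$, $\chi(F(t,\Omega))\leqslant\eta(t)\chi(\Omega)$. Let $k\colon\triangle\to\mathcal{L}(E)$ be such that: (k1) for every $s\in I$ the function $k(\cdot,s)\colon[s,T]\to\mathcal{L}(E)$ is differentiable; (k2) for all $t\in I$ the function $k(t,\cdot)\colon[0,t]\to\mathcal{L}(E)$ is continuous; (k3) the function $t\mapsto k(t,t)\in\mathcal{L}(E)$ is continuous on $I$ and the operator $k(t,t)$ is invertible for all $t\in I$; (k4) there exists $\mu\in L^q(I,\mathbb{R})$ such that $\left\|\frac{\partial}{\partial t}k(t,s)\right\|_{\mathcal{L}}\leqslant\mu(s)$ for every $(t,s)\in\triangle$. Then for every $h\in C(I,E)$ the set $S_F^p(h)$ of all solutions of the integral inclusion $$x(t)\in h(t)+\int_0^tk(t,s)F(s,x(s))\,ds,\quad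 t\in I,$$ is an $R_\delta$-set in the space $C(I,E)$.
   Context: $I=[0,T]$, $\triangle=\{(t,s)\in I\times I\colon 0\leqslant s\leqslant t\leqslant T\}$. $E$ has norm $|\cdot|$; $\mathcal{L}(E)$ is the space of bounded linear endomorphisms of $E$ with operator norm $\|\cdot\|_{\mathcal{L}}$; $E^*$ is the normed dual. $C(I,E)$ carries the maximum norm; $L^p(I,E)$ is the space of Bochner $p$-integrable maps. A set-valued map $F\colon X\multimap E$ assigns to each point a nonempty subset of $E$. A set-valued map $G\colon E\multimap E$ is upper hemicontinuous if for each $e^*\in E^*$ the function $x\mapsto\sup_{y\in G(x)}\langle e^*,y\rangle\in\mathbb{R}\cup\{+\infty\}$ is upper semicontinuous. $\chi$ is the Hausdorff measure of noncompactness: $\chi(\Omega)=\inf\{\varepsilon>0\colon\Omega\text{ admits a finite covering by balls of radius }\varepsilon\}$; $F(t,\Omega)=\bigcup_{x\in\Omega}F(t,x)$. A solution of the integral inclusion is a function $x\in C(I,E)$ such that $x(t)=h(t)+\int_0^tk(t,s)w(s)\,ds$ for all $t\in I$, for some $w\in L^p(I,E)$ with $w(t)\in F(t,x(t))$ for a.a. $t\in I$. A nonempty compact (metric) space $X$ is an $R_\delta$-set if there is a decreasing sequence $(X_n)_{n\geqslant1}$ of contractible compacta containing $X$ as a closed subspace such that $X=\bigcap_{n\geqslant1}X_n$. *)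

(* Defs.v *)
From HB Require Import structures.
From mathcomp Require Import all_boot all_order all_algebra.
From mathcomp Require Import all_classical all_reals all_analysis.

Set Implicit Arguments.
Unset Strict Implicit.
Unset Printing Implicit Defensive.

Import Order.TTheory GRing.Theory Num.Theory.
Import numFieldNormedType.Exports.

Local Open Scope classical_set_scope.
Local Open Scope ring_scope.

Section sup_image.
Context {R : realType} {U : Type}.
Implicit Types (A : set U) (g : U -> R).

Lemma sup_image_le A g M : 0 <= M -> (forall a, A a -> g a <= M) ->
  sup (g @` A) <= M.
Proof.
move=> M0 gM; have [->|/set0P A0] := eqVneq A set0.
  by rewrite image_set0 sup0.
apply: ge_sup; first exact: image_nonempty.
by move=> _ [a Aa <-]; exact: gM.
Qed.

Lemma le_sup_image A g M a : (forall b, A b -> g b <= M) -> A a ->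
  g a <= sup (g @` A).
Proof.
move=> gM Aa; apply: ub_le_sup; last by exists a.
by exists M => _ [b Ab <-]; exact: gM.
Qed.

Lemma sup_image_ge0 A g : (forall a, 0 <= g a) -> 0 <= sup (g @` A).
Proof.
move=> g0; have [|/sup_out ->//] := pselect (has_sup (g @` A)).
move=> [[_ [a Aa _]] ub].
by rewrite (le_trans (g0 a))// ub_le_sup//; exists a.
Qed.

End sup_image.

Section bounded_operators.
Context {R : realType} (V W : normedModType R).

Definition bounded_linear : {pred V -> W} :=
  mem [set f : V -> W |
    linear f /\ exists M : R, forall x, `|f x| <= M * `|x|].

Record boundedOp := BoundedOp {
  boundedOp_fun :> V -> W;
  boundedOp_in : boundedOp_fun \in bounded_linear }.

HB.instance Definition _ := [isSub for boundedOp_fun].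
HB.instance Definition _ := [Choice of boundedOp by <:].

Let bounded_linear_submod : submod_closed bounded_linear.
Proof.
split.
  rewrite inE; split; last by exists 0 => x; rewrite normr0 mul0r.
  by move=> a x y /=; rewrite scaler0 addr0.
move=> a f g; rewrite !inE => -[lf [M fM]] [lg [N gN]]; split.
  move=> b x y; rewrite /= [LHS]/GRing.add/= [RHS]/GRing.add/=.
  by move: (lf b x y) (lg b x y); rewrite !fctE => -> ->; rewrite !scalerDr !scalerA (mulrC a) addrACA.
exists (`|a| * M + N) => x; rewrite !fctE mulrDl.
rewrite (le_trans (ler_normD _ _))// lerD// normrZ -mulrA ler_wpM2l//.
Qed.

HB.instance Definition _ :=
  GRing.isSubmodClosed.Build R (V -> W) bounded_linear bounded_linear_submod.
HB.instance Definition _ := [SubChoice_isSubLmodule of boundedOp by <:].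

Definition op_norm (f : boundedOp) : R :=
  sup [set `|f x| | x in [set x | `|x| <= 1]].

Let op_bounded (f : boundedOp) :
  exists M, forall x, `|x| <= 1 -> `|f x| <= M.
Proof.
have := boundedOp_in f; rewrite inE => -[_ [M fM]]; exists `|M| => x x1.
rewrite (le_trans (fM x))// (le_trans (ler_norm _))// normrM normr_id.
by rewrite ler_piMr.
Qed.

Let op_norm_ub (f : boundedOp) x : `|x| <= 1 -> `|f x| <= op_norm f.
Proof.
move=> x1; have [M fM] := op_bounded f.
exact: (@le_sup_image _ _ [set x | `|x| <= 1] (fun x => `|f x|) M).
Qed.

Let op_norm_ge0 f : 0 <= op_norm f.
Proof. exact: (@sup_image_ge0 _ _ _ (fun x => `|f x|)). Qed.

Let ler_op_normD f g : op_norm (f + g) <= op_norm f + op_norm g.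
Proof.
apply: sup_image_le; first exact: addr_ge0.
by move=> x x1; rewrite (le_trans (ler_normD _ _))// lerD// op_norm_ub.
Qed.

Let ler_op_normZ (l : R) f : op_norm (l *: f) <= `|l| * op_norm f.
Proof.
apply: sup_image_le; first exact: mulr_ge0.
by move=> x x1; rewrite normrZ ler_wpM2l// op_norm_ub.
Qed.

Let op_normZ (l : R) f : op_norm (l *: f) = `|l| * op_norm f.
Proof.
apply/eqP; rewrite eq_le ler_op_normZ/=.
have [->|l0] := eqVneq l 0; first by rewrite normr0 mul0r.
by rewrite -ler_pdivlMl ?normr_gt0// -normfV (le_trans _ (ler_op_normZ _ _))//
  scalerA mulVf// scale1r.
Qed.

Let op_norm0_eq0 f : op_norm f = 0 -> f = 0.
Proof.
move=> f0; apply/val_inj/funext => x /=.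
have := boundedOp_in f; rewrite inE => -[lf _].
have [->|x0] := eqVneq x 0.
  by have := lf (- 1) 0 0; rewrite !scaleN1r !addNr.
have fZ a : f (a *: x) = a *: f x.
  have := lf a x 0; rewrite addr0 => ->.
  by have := lf (- 1) 0 0; rewrite !scaleN1r !addNr => ->; rewrite addr0.
have : `|f (`|x|^-1 *: x)| <= 0.
  by rewrite -f0 op_norm_ub// normrZ normfV normr_id mulVf// normr_eq0.
rewrite normr_le0 fZ scaler_eq0 invr_eq0 normr_eq0 (negbTE x0)/=.
by move/eqP.
Qed.

HB.instance Definition _ := @Lmodule_isNormed.Build R boundedOp
  op_norm ler_op_normD op_normZ op_norm0_eq0.

End bounded_operators.

Section dual.
Context {R : realType}.
Implicit Types E : normedModType R.

Definition dual E := boundedOp E R^o.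

(* Surjectivity of the canonical embedding [x |-> (e |-> e x)] of E into its
   bidual. *)
Definition reflexive_space E :=
  forall Phi : dual (dual E), exists x : E, forall e : dual E, Phi e = e x.

Definition invertible_op E (A : boundedOp E E) :=
  exists B : boundedOp E E, cancel A B /\ cancel B A.

Definition upper_semicontinuous {X : topologicalType} (f : X -> \bar R) :=
  forall x (a : R), (f x < a%:E)%E -> \forall y \near x, (f y < a%:E)%E.

Definition upper_hemicontinuous E (G : E -> set E) :=
  forall e : dual E,
    upper_semicontinuous (fun x => ereal_sup [set (e y)%:E | y in G x]).

Definition hausdorff_mnc E (A : set E) : \bar R :=
  ereal_inf [set r%:E | r in [set r : R | 0 < r /\
    exists2 C : set E, finite_set C & A `<=` \bigcup_(x in C) ball x r]].

(* One-sided at an endpoint of an interval A. If t is isolated in A (A = [T, T]),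
   every l qualifies, so that l is only determined at limit points of A. *)
Definition has_derivative_within E (A : set R) (f : R -> E) (t : R) (l : E) :=
  (r - t)^-1 *: (f r - f t) @[r --> within A (t^')] --> l.

End dual.

Section continuous_functions.
Context {R : realType} (T : R) (E : normedModType R).

Definition continuous_on_itv : {pred set_type `[0, T]%classic -> E} :=
  mem [set f | continuous f].

Record contItv := ContItv {
  contItv_fun :> set_type `[0, T]%classic -> E;
  contItv_in : contItv_fun \in continuous_on_itv }.

HB.instance Definition _ := [isSub for contItv_fun].
HB.instance Definition _ := [Choice of contItv by <:].

Let continuous_on_itv_submod : submod_closed continuous_on_itv.
Proof.
split; first by rewrite inE => t; exact: cst_continuous.
move=> a f g; rewrite !inE => cf cg t.
apply: (@continuousD _ _ _ (fun t => a *: f t) g); last exact: cg.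
by apply: continuousZr; exact: cf.
Qed.

HB.instance Definition _ := GRing.isSubmodClosed.Build R
  (set_type `[0, T]%classic -> E) continuous_on_itv continuous_on_itv_submod.
HB.instance Definition _ := [SubChoice_isSubLmodule of contItv by <:].

Definition max_norm (x : contItv) : R := sup (range (fun t => `|x t|)).

Let contItv_bounded (x : contItv) : exists M, forall t, `|x t| <= M.
Proof.
have := contItv_in x; rewrite inE /=.
move=> /(@subspace_valL_continuousP' _ _ _ 0) cx.
have := continuous_compact cx (@segment_compact _ 0 T).
move=> /compact_bounded [M [_ xM]]; exists (M + 1) => t.
apply: (xM (M + 1)); first by rewrite ltrDl.
exists (val t); first exact: set_valP.
exact: (congr1 (@^~ t) (valLK 0 (contItv_fun x))).
Qed.

Let max_norm_ub (x : contItv) t : `|x t| <= max_norm x.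
Proof.
have [M xM] := contItv_bounded x.
exact: (@le_sup_image _ _ setT (fun t => `|x t|) M).
Qed.

Let max_norm_ge0 x : 0 <= max_norm x.
Proof. exact: (@sup_image_ge0 _ _ _ (fun t => `|x t|)). Qed.

Let ler_max_normD x y : max_norm (x + y) <= max_norm x + max_norm y.
Proof.
apply: sup_image_le; first exact: addr_ge0.
by move=> t _; rewrite (le_trans (ler_normD _ _))// lerD// max_norm_ub.
Qed.

Let ler_max_normZ (l : R) x : max_norm (l *: x) <= `|l| * max_norm x.
Proof.
apply: sup_image_le; first exact: mulr_ge0.
by move=> t _; rewrite normrZ ler_wpM2l// max_norm_ub.
Qed.

Let max_normZ (l : R) x : max_norm (l *: x) = `|l| * max_norm x.
Proof.
apply/eqP; rewrite eq_le ler_max_normZ/=.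
have [->|l0] := eqVneq l 0; first by rewrite normr0 mul0r.
by rewrite -ler_pdivlMl ?normr_gt0// -normfV (le_trans _ (ler_max_normZ _ _))//
  scalerA mulVf// scale1r.
Qed.

Let max_norm0_eq0 x : max_norm x = 0 -> x = 0.
Proof.
move=> x0; apply/val_inj/funext => t /=; apply/eqP.
by rewrite -normr_le0 -x0 max_norm_ub.
Qed.

HB.instance Definition _ := @Lmodule_isNormed.Build R contItv
  max_norm ler_max_normD max_normZ max_norm0_eq0.

End continuous_functions.

Section bochner.
Context {R : realType} {E : normedModType R}.
Implicit Types (D : set R) (f s : R -> E).

Let mu := @lebesgue_measure R.

Definition simple_function s :=
  finite_set (range s) /\ forall v, measurable (s @^-1` [set v]).

(* Since the limit is only required a.e., this is Lebesgue (and not Borel)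
   strong measurability, although the level sets of the approximating simple
   functions are Borel sets. *)
Definition strongly_measurable D f :=
  exists s_ : nat -> R -> E, (forall n, simple_function (s_ n)) /\
    {ae mu, forall t, D t -> s_ n t @[n --> \oo] --> f t}.

(* Membership in L^p(D, E), for 1 <= p <= +oo. *)
Definition in_Lp D (p : \bar R) f :=
  strongly_measurable D f /\
  (Lnorm mu p ((fun t => `|f t|%:E) \_ D) < +oo)%E.

(* To be used with D measurable of finite measure. *)
Definition simple_integral D s : E :=
  \sum_(v \in range s) fine (mu (D `&` s @^-1` [set v])) *: v.

(* f is Bochner integrable on D, a measurable set of finite measure, with
   integral v. *)
Definition has_bochner_integral D f (v : E) :=
  exists s_ : nat -> R -> E, [/\ forall n, simple_function (s_ n),
    {ae mu, forall t, D t -> s_ n t @[n --> \oo] --> f t},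
    (\int[mu]_(t in D) `|f t - s_ n t|%:E)%E @[n --> \oo] --> 0%E &
    simple_integral D (s_ n) @[n --> \oo] --> v].

End bochner.

Section Rdelta.
Context {R : realType}.

Definition contractible {Y : topologicalType} (A : set Y) :=
  exists (y0 : Y) (H : R * Y -> Y),
    [/\ A y0, {within `[0, 1] `*` A, continuous H},
        forall t y, `[0, 1]%classic t -> A y -> A (H (t, y)),
        forall y, A y -> H (0, y) = y &
        forall y, A y -> H (1, y) = y0].

(* The spaces of the decreasing sequence are abstract compact metric spaces, not
   subspaces of X: they all live in the first one, hence in a common metric
   space Y, and they contain a homeomorphic copy [i @` A] of A. *)
Definition Rdelta_set {X : topologicalType} (A : set X) :=
  [/\ A !=set0, compact A &
  exists (Y : metricType R) (i : X -> Y) (j : Y -> X) (K : nat -> set Y),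
    [/\ {within A, continuous i}, {within i @` A, continuous j} &
        forall x, A x -> j (i x) = x] /\
    [/\ forall n, compact (K n) /\ contractible (K n),
        forall n, K n.+1 `<=` K n,
        closed (i @` A) &
        \bigcap_n K n = i @` A]].

End Rdelta.
Arguments contractible R {Y} A.
Arguments Rdelta_set R {X} A.

Definition solution_set {R : realType} {T : R} {E : normedModType R}
    (p : R) (F : R -> E -> set E) (k : R -> R -> boundedOp E E)
    (h : contItv T E) : set (contItv T E) :=
  [set x | exists w : R -> E, [/\ in_Lp `[0, T] p%:E w,
    {ae @lebesgue_measure R, forall t (tI : t \in `[0, T]%classic),
      F t (x (exist _ t tI)) (w t)} &
    forall t : set_type `[0, T]%classic,
      has_bochner_integral `[0, val t] (fun s => k (val t) s (w s))
        (x t - h t)]].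

(* Main.v *)
Require Import Defs.
From HB Require Import structures.
From mathcomp Require Import all_boot all_order all_algebra.
From mathcomp Require Import all_classical all_reals all_analysis.
Import Order.TTheory GRing.Theory Num.Theory.
Import numFieldNormedType.Exports.
From mathcomp Require Import measurable_realfun ess_sup_inf ring lra.
Set Implicit Arguments.
Unset Strict Implicit.
Unset Printing Implicit Defensive.
Local Open Scope classical_set_scope.
Local Open Scope ring_scope.

(* All estimates are made with weights omega such that
   \int_0^t g omega <= omega t / 2, which turn linear integral inequalities into
   halving steps. The smallest closed convex set X of curves that contains h and
   the solutions and is stable under x |-> h + \int k w, for w with values in
   the closed convex hull of F(s, X(s)), is contained in the closed convex hull
   of the curves so obtained; hence a bound m omega(t) on the measure of
   noncompactness of X(t) implies the bound (m / 2) omega(t), and X is compact by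
   the Arzela-Ascoli theorem.

   K_n is the set of the curves x = h + \int k w with w(s) in the closed convex
   hull of the values of F(s, .) at the points of X(s) at distance at most
   1 / (n + 1) from x(s). Densities of convergent sequences have convex
   combinations that converge almost everywhere, because the values F(s, X(s))
   are totally bounded: so K_n is compact. A density is determined by its curve,
   because k(s, s) is invertible and k is Lipschitz in its first argument: so the
   intersection of the K_n is the set of solutions, by upper hemicontinuity.

   K_n is contracted by following x up to time (1 - tau) T, and afterwards the
   curve y whose density is a convex combination of selections of F along a
   finite net of X, with coefficients depending on y(s - d) for a small delay d.
   The delay makes y exist and be unique, one interval of length d at a time, and
   a closed graph with values in a compact set gives continuity. *)

(** * Separation of convex sets *)

(** The difficulty is that [E] is not assumed separable and that exceptional null sets depend on the
    point or on the bounded set to which a hypothesis is applied. Noncompactness is therefore tested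
    along separated sequences, which together with the integral estimate costs a factor 4 in the
    weight for [eta], and [F5] is only applied to countably many sets, which equicontinuity makes
    sufficient. Densities are replaced by everywhere limits of simple functions, and the kernel by
    one that vanishes outside the triangle and on a null set, so that bounds hold at every time.

    By [F5] the image of a compact set is totally bounded. Convex combinations of densities thus
    converge in norm a.e., and closed convex constraints pass to the limit pointwise.

    Uniqueness of densities acts again in the contraction: the density of x up to time a is
    determined by x up to time a, so that the continuation beyond a depends on the curve alone and
    limits of continuations are continuations. Uniqueness for the delayed equation takes the place
    of locally Lipschitz approximations of F. *)

Section hahn_banach.
Context {R : realType} (V : lmodType R).
Implicit Types (p q : V -> R) (x y : V).

Definition sublinear p :=
  (forall x y, p (x + y) <= p x + p y) /\
  (forall (a : R) x, 0 <= a -> p (a *: x) = a * p x).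

Lemma sublinear_ge p x : sublinear p -> - p (- x) <= p x.
Proof.
move=> [pD pZ]; have := pD x (- x).
rewrite subrr; have := pZ 0 0 (lexx 0); rewrite scale0r mul0r => ->; lra.
Qed.

(** The infimum of [q (x + l x0) - l q x0] over [l >= 0] lies below [q] and is still sublinear. A
    minimal [q] coincides with it, so that [q (- x0) <= - q x0]: this is how minimality yields
    oddness, hence linearity. *)
Lemma sublinear_infl q x0 : sublinear q ->
  exists q', [/\ sublinear q', forall x, q' x <= q x & q' (- x0) <= - q x0].
Proof.
move=> sq; have [qD qZ] := sq.
pose S x : set R := [set q (x + l *: x0) - l * q x0 | l in [set l : R | 0 <= l]].
have S0 x : S x !=set0 by exists (q (x + 0 *: x0) - 0 * q x0), 0 => //=.
have Slb x : lbound (S x) (- q (- x)).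
  move=> _ [l l0 <-]; have := qD (x + l *: x0) (- x).
  by rewrite addrAC subrr add0r qZ//=; lra.
have Sinf x : has_inf (S x) by split; [exact: S0 | exists (- q (- x))].
have Sle x (l : R) : 0 <= l -> inf (S x) <= q (x + l *: x0) - l * q x0.
  by move=> l0; apply: ge_inf; [exact: (Sinf x).2 | exists l].
exists (fun x => inf (S x)); split; [split|..].
- move=> x y; rewrite -lerBlDr; apply: lb_le_inf => // _ [l /= l0 <-].
  rewrite lerBlDr -lerBlDl; apply: lb_le_inf => // _ [m /= m0 <-].
  rewrite lerBlDl (le_trans (Sle _ _ (addr_ge0 l0 m0)))//.
  have -> : x + y + (l + m) *: x0 = (x + l *: x0) + (y + m *: x0).
    by rewrite scalerDl addrACA.
  by have := qD (x + l *: x0) (y + m *: x0); lra.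
- move=> a x; rewrite le_eqVlt => /predU1P[<-|a0].
    rewrite scale0r mul0r; apply/eqP; rewrite eq_le; apply/andP; split.
      have := Sle 0 0 (lexx 0); rewrite scale0r mul0r subr0 addr0.
      by have := qZ 0 0 (lexx 0); rewrite scale0r mul0r => ->.
    apply: lb_le_inf => // _ [l /= l0 <-].
    by rewrite add0r qZ// subrr.
  apply/eqP; rewrite eq_le; apply/andP; split.
    rewrite -ler_pdivrMl//; apply: lb_le_inf => // _ [l /= l0 <-].
    have al0 : 0 <= a * l by rewrite mulr_ge0// ltW.
    rewrite ler_pdivrMl// (le_trans (Sle _ _ al0))//.
    by rewrite -scalerA -scalerDr (qZ _ _ (ltW a0)) mulrBr mulrA.
  apply: lb_le_inf => // _ [l /= l0 <-].
  have a'0 : 0 <= a^-1 by rewrite invr_ge0 ltW.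
  have al0 : 0 <= a^-1 * l by rewrite mulr_ge0.
  rewrite -ler_pdivlMl// (le_trans (Sle _ _ al0))//.
  have -> : x + (a^-1 * l) *: x0 = a^-1 *: (a *: x + l *: x0).
    by rewrite scalerDr !scalerA mulVf ?gt_eqF// scale1r.
  by rewrite (qZ _ _ a'0) mulrBr mulrA.
- move=> x; have := Sle x 0 (lexx 0).
  by rewrite scale0r addr0 mul0r subr0.
- have := Sle (- x0) 1 ler01.
  rewrite scale1r addNr mul1r.
  by have := qZ 0 0 (lexx 0); rewrite scale0r mul0r => ->; rewrite sub0r.
Qed.

(* Minimal sublinear functionals are linear. *)
Lemma hahn_banach p : sublinear p ->
  exists g : V -> R, linear (g : V -> R^o) /\ forall x, g x <= p x.
Proof.
move=> sp.
pose below q := sublinear q /\ forall x, q x <= p x.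
pose T := {q | below q}.
pose r (a b : T) := `[< forall x, sval b x <= sval a x >].
have [||| |[q [sq qp]] qmin] := @Zorn T r.
- by move=> a; apply/asboolP.
- by move=> a b c /asboolP ab /asboolP bc; apply/asboolP => x; exact: le_trans (bc x) (ab x).
- move=> [a sa] [b sb] /asboolP ab /asboolP ba; apply/eq_exist/funext => x /=.
  by apply/eqP; rewrite eq_le (ab x) (ba x).
(* A chain is bounded below by its pointwise infimum, which is finite because a sublinear functional
   below [p] is at least [- p (- x)] at [x]. *)
- move=> A Atot; have [->|/set0P[a0 Aa0]] := eqVneq A set0.
    by exists (exist below p (conj sp (fun x => lexx (p x)))).
  pose S x := [set sval a x | a in A].
  have S0 x : S x !=set0 by exists (sval a0 x), a0.
  have Slb x : lbound (S x) (- p (- x)).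
    move=> _ [[a [sa ap]] _ <-] /=.
    by rewrite (le_trans _ (sublinear_ge x sa))// lerN2.
  have Sle x a : A a -> inf (S x) <= sval a x.
    by move=> Aa; apply: ge_inf; [exists (- p (- x)) | exists a].
  have qP : sublinear (fun x => inf (S x)) /\ forall x, inf (S x) <= p x.
    split; last by move=> x; apply: le_trans (Sle x _ Aa0) _; case: (svalP a0).
    split.
      move=> x y; rewrite -lerBlDr; apply: lb_le_inf => // _ [a Aa <-].
      rewrite lerBlDr -lerBlDl; apply: lb_le_inf => // _ [b Ab <-].
      rewrite lerBlDl.
      have [c Ac [ca cb]] : exists2 c, A c & (forall x, sval c x <= sval a x) /\ forall x, sval c x <= sval b x.
        by have [/asboolP ab|/asboolP ba] := Atot _ _ Aa Ab; [exists b|exists a] => //; split.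
      apply: le_trans (Sle _ _ Ac) _; have [[cD _] _] := svalP c.
      by apply: le_trans (cD _ _) _; rewrite lerD// ?(ca _) ?(cb _).
    move=> a x; rewrite le_eqVlt => /predU1P[<-|a_gt0].
      rewrite scale0r mul0r.
      suff -> : S 0 = [set 0] by rewrite inf1.
      apply/seteqP; split => [_ [b Ab <-]|_ ->]/=.
        have [[_ bZ] _] := svalP b.
        by have := bZ 0 0 (lexx 0); rewrite scale0r mul0r.
      exists a0 => //; have [[_ bZ] _] := svalP a0.
      by have := bZ 0 0 (lexx 0); rewrite scale0r mul0r.
    apply/eqP; rewrite eq_le; apply/andP; split.
      rewrite -ler_pdivrMl//; apply: lb_le_inf => // _ [b Ab <-].
      rewrite ler_pdivrMl// (le_trans (Sle _ _ Ab))//.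
      by have [[_ bZ] _] := svalP b; rewrite (bZ _ _ (ltW a_gt0)).
    apply: lb_le_inf => // _ [b Ab <-].
    have [[_ bZ] _] := svalP b; rewrite (bZ _ _ (ltW a_gt0)).
    by rewrite ler_pM2l// Sle.
  by exists (exist below _ qP) => a Aa; apply/asboolP => x /=; exact: Sle.
have qminE q' : sublinear q' -> (forall x, q' x <= q x) -> q' = q.
  move=> sq' q'q.
  have q'P : sublinear q' /\ forall x, q' x <= p x.
    by split=> // x; exact: le_trans (q'q x) (qp x).
  by have := qmin (exist below q' q'P) (asboolT q'q) => -[].
have qN x : q (- x) = - q x.
  apply/eqP; rewrite eq_le; apply/andP; split; last first.
    by have := sublinear_ge x sq; lra.
  have [q' [sq' q'q q'x]] := sublinear_infl x sq.
  by rewrite (qminE _ sq' q'q) in q'x.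
have [qD qZ] := sq.
have qDe x y : q (x + y) = q x + q y.
  apply/eqP; rewrite eq_le qD/=.
  by have := qD (x + y) (- y); rewrite addrK qN; lra.
have qZe a x : q (a *: x) = a * q x.
  have [a0|/ltW a0] := leP 0 a; first exact: qZ.
  rewrite -[in LHS](opprK a) scaleNr qN qZ ?oppr_ge0//.
  by rewrite mulNr opprK.
by exists q; split=> // a x y; rewrite qDe qZe.
Qed.

Definition cvx (A : set V) := forall a x y, 0 <= a -> a <= 1 ->
  A x -> A y -> A (a *: x + (1 - a) *: y).

(** Convexity for weights that do not sum to one; if both vanish, any point of [A] serves as [z]. *)
Lemma cvx_cone (A : set V) a b x y : cvx A -> 0 <= a -> 0 <= b -> A x -> A y ->
  exists2 z, A z & a *: x + b *: y = (a + b) *: z.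
Proof.
move=> cA a0 b0 Ax Ay; have [ab0|ab_neq0] := eqVneq (a + b) 0.
  have [-> ->] : a = 0 /\ b = 0 by lra.
  by exists x => //; rewrite addr0 !scale0r addr0.
have ab_gt0 : 0 < a + b by rewrite lt_neqAle eq_sym ab_neq0 addr_ge0.
exists ((a / (a + b)) *: x + (1 - a / (a + b)) *: y).
  apply: cA => //; first by rewrite divr_ge0// ltW.
  by rewrite ler_pdivrMr// mul1r lerDl.
rewrite scalerDr !scalerA; congr (_ *: _ + _ *: _); by field.
Qed.

End hahn_banach.

Section separation.
Context {R : realType} (E : normedModType R).
Implicit Types (e : dual E) (x y : E).

Lemma bounded_linearP {V W : normedModType R} (f : boundedOp V W) :
  linear f /\ exists M : R, forall x : V, `|f x| <= M * `|x|.
Proof. by have := boundedOp_in f; rewrite inE. Qed.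

(** Hahn-Banach is applied to the infimum of [|x - l c| - l d] over [l >= 0] and [c] in [C]. The
    choice [l = 0] bounds it by the norm, and [l = 1] bounds its value at [c] by [- d]; convexity of
    [C] makes it subadditive. The functional so obtained is the opposite of the required one. *)
Lemma dual_separation (C : set E) (d : R) : cvx C -> C !=set0 -> 0 <= d ->
  (forall c, C c -> d <= `|c|) ->
  exists e, (forall x, `|e x| <= `|x|) /\ forall c, C c -> d <= e c.
Proof.
move=> cC [c0 Cc0] d0 Cd.
pose S x := [set u : R | exists l c, [/\ 0 <= l, C c & u = `|x - l *: c| - l * d]].
have S0 x : S x !=set0 by exists (`|x - 0 *: c0| - 0 * d), 0, c0.
have Slb x : lbound (S x) (- `|x|).
  move=> _ [l [c [l0 Cc ->]]].
  have : `|l *: c| <= `|x - l *: c| + `|x|.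
    by rewrite -(normrN (x - _)) opprB (le_trans _ (ler_normD _ _))// subrK.
  rewrite normrZ (ger0_norm l0).
  by have := ler_wpM2l l0 (Cd _ Cc); lra.
have Sle x (l : R) c : 0 <= l -> C c -> inf (S x) <= `|x - l *: c| - l * d.
  by move=> l0 Cc; apply: ge_inf; [exists (- `|x|) | exists l, c].
have sp : sublinear (fun x => inf (S x)).
  split.
    move=> x y; rewrite -lerBlDr; apply: lb_le_inf => // _ [l [c [l0 Cc ->]]].
    rewrite lerBlDr -lerBlDl; apply: lb_le_inf => // _ [m [c' [m0 Cc' ->]]].
    rewrite lerBlDl.
    have [c'' Cc'' cE] := cvx_cone cC l0 m0 Cc Cc'.
    apply: (le_trans (Sle _ _ _ (addr_ge0 l0 m0) Cc'')).
    rewrite -cE opprD addrACA.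
    by have := ler_normD (x - l *: c) (y - m *: c'); lra.
  have N a x : 0 < a -> inf (S (a *: x)) <= a * inf (S x).
    move=> a0; rewrite -ler_pdivrMl//; apply: lb_le_inf => // _ [l [c [l0 Cc ->]]].
    have al0 : 0 <= a * l by rewrite mulr_ge0// ltW.
    rewrite ler_pdivrMl// (le_trans (Sle _ _ _ al0 Cc))//.
    by rewrite -scalerA -scalerBr normrZ gtr0_norm// mulrBr mulrA.
  move=> a x; rewrite le_eqVlt => /predU1P[<-|a0].
    rewrite scale0r mul0r; apply/eqP; rewrite eq_le; apply/andP; split.
      have := Sle 0 0 c0 (lexx 0) Cc0.
      by rewrite scale0r mul0r subr0 subr0 normr0.
    by apply: lb_le_inf => // u /Slb; rewrite normr0 oppr0.
  apply/eqP; rewrite eq_le N//=.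
  have a'0 : 0 < a^-1 by rewrite invr_gt0.
  have := N a^-1 (a *: x) a'0.
  by rewrite scalerA mulVf ?gt_eqF// scale1r ler_pdivlMl.
have [g [lg gp]] := hahn_banach sp.
have gN x : g x <= `|x|.
  apply: (le_trans (gp x)); have := Sle x 0 c0 (lexx 0) Cc0.
  by rewrite scale0r mul0r !subr0.
have g0 : g 0 = 0.
  by have := lg (- 1) 0 0; rewrite !scaleN1r !addNr.
have gopp x : g (- x) = - g x.
  by have := lg (- 1) x 0; rewrite !scaleN1r !addr0 g0 addr0.
have gb x : `|g x| <= `|x|.
  by rewrite ler_norml gN andbT lerNl -gopp (le_trans (gN _))// normrN.
have bN : (fun x => - g x : R^o) \in @bounded_linear R E R^o.
  rewrite inE; split.
    move=> a x y; rewrite lg opprD; congr (_ + _).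
    by rewrite /GRing.scale/= mulrN.
  by exists 1 => x; rewrite normrN mul1r.
exists (BoundedOp bN); split => [x|c Cc]/=; first by rewrite normrN.
rewrite lerNr (le_trans (gp _))// (le_trans (Sle c 1 c ler01 Cc))//.
by rewrite scale1r subrr normr0 mul1r sub0r.
Qed.

(** The singleton of [x] is convex and lies at distance [|x|] from 0, so that separation gives
    [e x >= |x|]. *)
Lemma dual_norming x : exists e, (forall y, `|e y| <= `|y|) /\ e x = `|x|.
Proof.
have [||||e [eb ex]] := @dual_separation [set x] `|x| => //.
- move=> a _ _ a0 a1 -> -> /=.
  by rewrite -scalerDl addrC subrK scale1r.
- by exists x.
- by move=> _ ->.
exists e; split=> //; apply/eqP; rewrite eq_le ex// andbT.
by rewrite (le_trans (ler_norm _)).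
Qed.

Lemma dual_ext x y : (forall e, e x = e y) -> x = y.
Proof.
move=> exy; have [e [_ ee]] := dual_norming (x - y).
apply/eqP; rewrite -subr_eq0 -normr_eq0 -ee.
have [le _] := bounded_linearP e.
have := le (- 1) y x; rewrite scaleN1r (addrC (- y)) => ->.
by rewrite exy scaleN1r addNr.
Qed.

End separation.

(** * Limits of simple functions *)

Section almost_everywhere.
Context {R : realType}.
Implicit Types P Q S : R -> Prop.

#[global] Instance ae_lebesgue_filter : Filter (nbhs (almost_everywhere (@lebesgue_measure R))).
Proof. exact: ae_filter_ringOfSetsType. Qed.

Lemma ae_mono P Q : (forall t, P t -> Q t) ->
  {ae @lebesgue_measure R, forall t, P t} -> {ae @lebesgue_measure R, forall t, Q t}.
Proof. by move=> PQ; apply: filterS. Qed.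

Lemma ae_mono2 P Q S : (forall t, P t -> Q t -> S t) ->
  {ae @lebesgue_measure R, forall t, P t} -> {ae @lebesgue_measure R, forall t, Q t} ->
  {ae @lebesgue_measure R, forall t, S t}.
Proof. by move=> PQS; apply: filterS2. Qed.

Lemma ae_nat (P : nat -> R -> Prop) :
  (forall n, {ae @lebesgue_measure R, forall t, P n t}) ->
  {ae @lebesgue_measure R, forall t, forall n, P n t}.
Proof. by move=> H; apply: ae_foralln. Qed.

End almost_everywhere.

Section simple_functions.
Context {R : realType}.
Implicit Types (E V W : normedModType R).

Lemma simple_comp_measurable E (s : R -> E) {d} {Y : measurableType d} (phi : E -> Y) :
  simple_function s -> measurable_fun setT (phi \o s).
Proof.
move=> [fs ms] _ B mB; rewrite setTI.
have -> : (phi \o s) @^-1` B =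
    \bigcup_(v in range s `&` phi @^-1` B) (s @^-1` [set v]).
  apply/seteqP; split => [t Bt|t [v [_ Bv] /= sv]]; last by rewrite /= sv.
  by exists (s t) => //; split => //; exists t.
apply: fin_bigcup_measurable; first exact: finite_setIl.
by move=> v _; exact: ms.
Qed.

Lemma simple_map2 E V W (op : E -> V -> W) s s' :
  simple_function s -> simple_function s' ->
  simple_function (fun t => op (s t) (s' t)).
Proof.
move=> [fs ms] [fs' ms']; split.
  apply: (@sub_finite_set _ _ ((fun z => op z.1 z.2) @` (range s `*` range s'))).
    by move=> _ [t _ <-]; exists (s t, s' t) => //; split; exists t.
  exact/finite_image/finite_setX.
move=> w; have -> : (fun t => op (s t) (s' t)) @^-1` [set w] =
    \bigcup_(z in (range s `*` range s') `&` [set z | op z.1 z.2 = w])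
      (s @^-1` [set z.1] `&` s' @^-1` [set z.2]).
  apply/seteqP; split => [t tw|t [[a b] [_ <-] [/= <- <-]]//].
  by exists (s t, s' t) => //; split => //; split; exists t.
apply: fin_bigcup_measurable; first exact/finite_setIl/finite_setX.
by move=> z _; exact: measurableI.
Qed.

Lemma simple_if E (A : set R) (s : R -> E) (v : E) : measurable A ->
  simple_function s -> simple_function (fun t => if t \in A then s t else v).
Proof.
move=> mA [fs ms]; split.
  apply: (@sub_finite_set _ _ (range s `|` [set v])).
    by move=> _ [t _ <-]; case: ifP => _; [left; exists t|right].
  by rewrite finite_setU; split.
move=> w; have -> : (fun t => if t \in A then s t else v) @^-1` [set w] =
    (A `&` s @^-1` [set w]) `|` (~` A `&` [set t | v = w]).
  apply/seteqP; split => [t /=|t /= [[At]|[At]]].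
  - by case: ifPn => [/set_mem At|/negP At] sw; [left|right; split => // At'; apply: At; rewrite inE].
  - by rewrite (mem_set At).
  - by rewrite memNset.
apply: measurableU; first exact: measurableI.
apply: measurableI; first exact: measurableC.
by have [vw|vw] := pselect (v = w); [rewrite (_ : mkset _ = setT)|rewrite (_ : mkset _ = set0)] => //;
  apply/seteqP; split.
Qed.

(** Strong measurability without an exceptional set. The notion is stable under algebraic operations
    and pointwise limits, makes distances measurable on the whole line, and every function strongly
    measurable on a measurable set agrees a.e. on it with a function of this kind. *)
Definition nice E (f : R -> E) := exists s_ : nat -> R -> E,
  (forall n, simple_function (s_ n)) /\ forall t, s_ n t @[n --> \oo] --> f t.

Lemma nice_comp_measurable E (f : R -> E) (phi : E -> R) :
  nice f -> continuous phi -> measurable_fun setT (phi \o f).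
Proof.
move=> [s_ [ss sf]] cphi.
apply: (measurable_fun_cvg (h := fun n => phi \o s_ n)) => //.
  by move=> n; exact: simple_comp_measurable.
by move=> t _; apply: continuous_cvg => //; exact: cphi.
Qed.

Lemma nice_norm_measurable E (f : R -> E) : nice f ->
  measurable_fun setT (fun t => `|f t|).
Proof. by move=> nf; apply: nice_comp_measurable => // x; exact: norm_continuous. Qed.

Lemma nice_dist_measurable E (f : R -> E) z : nice f ->
  measurable_fun setT (fun t => `|f t - z|).
Proof.
move=> nf; apply: (nice_comp_measurable (phi := fun y => `|y - z|)) => // y.
apply: (@continuous_comp _ _ _ (fun y => y - z) Num.norm).
  by apply: continuousB; [exact: cvg_id|exact: cvg_cst].
exact: norm_continuous.
Qed.

Lemma nice_map2 E V W (op : E -> V -> W) f g :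
  continuous (fun z : E * V => op z.1 z.2) -> nice f -> nice g ->
  nice (fun t => op (f t) (g t)).
Proof.
move=> cop [s [ss sf]] [r [rr rf]].
exists (fun n t => op (s n t) (r n t)); split => [n|t]; first exact: simple_map2.
apply: (@continuous_cvg _ _ _ _ _ (fun n => (s n t, r n t)) (fun z : E * V => op z.1 z.2) (f t, g t)).
  exact: cop.
exact: cvg_pair.
Qed.

Lemma niceD E (f g : R -> E) : nice f -> nice g -> nice (fun t => f t + g t).
Proof. by apply: nice_map2; exact: add_continuous. Qed.

Lemma niceM E (f : R -> R^o) (g : R -> E) : nice f -> nice g ->
  nice (fun t => f t *: g t).
Proof. by apply: (@nice_map2 (R^o) E); exact: scale_continuous. Qed.

Lemma nice_cst E (v : E) : nice (fun=> v).
Proof.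
exists (fun _ _ => v); split => [_|t]; last exact: cvg_cst.
split; first by apply: sub_finite_set (finite_set1 v) => _ [t _ <-].
by move=> w; have [->|vw] := eqVneq v w;
  [rewrite (_ : _ @^-1` _ = setT)|rewrite (_ : _ @^-1` _ = set0)] => //;
  apply/seteqP; split => // t /=; move/eqP: vw => vw /vw.
Qed.

Lemma niceZ E a (f : R -> E) : nice f -> nice (fun t => a *: f t).
Proof. by move=> nf; apply: (@niceM E (fun=> a)) => //; exact: nice_cst. Qed.

Lemma niceB E (f g : R -> E) : nice f -> nice g -> nice (fun t => f t - g t).
Proof.
move=> nf ng; rewrite (_ : (fun t => _) = (fun t => f t + (-1) *: g t)).
  by apply: niceD => //; exact: niceZ.
by apply/funext => t; rewrite scaleN1r.
Qed.

Lemma nice_if E (A : set R) (f g : R -> E) : measurable A -> nice f -> nice g ->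
  nice (fun t => if t \in A then f t else g t).
Proof.
move=> mA nf ng.
have N h : nice h -> forall B, measurable B -> nice (fun t => if t \in B then h t else 0 : E).
  move=> [s [ss sh]] B mB; exists (fun n t => if t \in B then s n t else 0).
  split => [n|t]; first exact: simple_if.
  by case: ifP => _; [exact: sh|exact: cvg_cst].
rewrite (_ : (fun t => _) = (fun t => (if t \in A then f t else 0) +
    (if t \in ~` A then g t else 0))).
  by apply: niceD; apply: N => //; exact: measurableC.
apply/funext => t; rewrite in_setC; case: (t \in A) => /=; by rewrite ?addr0 ?add0r.
Qed.

Lemma nice_sum E I (r : seq I) (P : pred I) (f : I -> R -> E) :
  (forall i, P i -> nice (f i)) -> nice (fun t => \sum_(i <- r | P i) f i t).
Proof.
move=> nf; elim: r => [|i r IH].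
  by rewrite (_ : (fun t => _) = fun=> 0); [exact: nice_cst|apply/funext => t; rewrite big_nil].
have [Pi|Pi] := boolP (P i).
  rewrite (_ : (fun t => _) = (fun t => f i t + \sum_(j <- r | P j) f j t)).
    by apply: niceD => //; exact: nf.
  by apply/funext => t; rewrite big_cons Pi.
rewrite (_ : (fun t => _) = (fun t => \sum_(j <- r | P j) f j t))//.
by apply/funext => t; rewrite big_cons (negbTE Pi).
Qed.

(** Index of a point closest to [f t] among [d 0, ..., d k]; the strict comparison keeps the smaller
    index in a tie. Composed with [d] it produces simple approximations of [f]. *)
Fixpoint nearest E (f : R -> E) (d : nat -> E) (k : nat) (t : R) : nat :=
  if k is k'.+1 then
    let i := nearest f d k' t in
    if `|f t - d k| < `|f t - d i| then k else i
  else 0%N.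

Lemma nearest_le E (f : R -> E) d k t : (nearest f d k t <= k)%N.
Proof. by elim: k => //= k IH; case: ifP => // _; exact: leqW. Qed.

Lemma nearest_min E (f : R -> E) d k t i : (i <= k)%N ->
  `|f t - d (nearest f d k t)| <= `|f t - d i|.
Proof.
elim: k => [|k IH] /=; first by rewrite leqn0 => /eqP ->.
rewrite leq_eqVlt => /predU1P[->|ik]; first by case: ltP => //; rewrite lexx.
by case: ltP => [/ltW/le_trans|_]; [apply|]; exact: IH.
Qed.

Lemma nearest_measurable E (f : R -> E) d k i :
  (forall j, measurable_fun setT (fun t => `|f t - d j|)) ->
  measurable [set t | nearest f d k t = i].
Proof.
move=> mf; elim: k i => [|k IH] i /=.
  by have [->|i0] := eqVneq i 0%N; [rewrite (_ : mkset _ = setT)|rewrite (_ : mkset _ = set0)] => //;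
    apply/seteqP; split => // t /= /esym /eqP; rewrite (negbTE i0).
have mL j : measurable [set t | `|f t - d k.+1| < `|f t - d j|].
  have := measurable_fun_ltr (mf k.+1) (mf j).
  by move=> /(_ measurableT [set true]); rewrite setTI; apply.
rewrite (_ : mkset _ = \bigcup_j ([set t | nearest f d k t = j] `&`
  (([set t | `|f t - d k.+1| < `|f t - d j|] `&` [set t | k.+1 = i]) `|`
   (~` [set t | `|f t - d k.+1| < `|f t - d j|] `&` [set t | j = i])))).
  apply: bigcup_measurable => j _; apply: measurableI => //.
  have mP (P : Prop) : measurable [set t : R | P].
    by have [p|p] := pselect P; [rewrite (_ : mkset _ = setT)|rewrite (_ : mkset _ = set0)] => //;
      apply/seteqP; split.
  by apply: measurableU; apply: measurableI => //; exact: measurableC.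
apply/seteqP; split => [t /=|t [j _ /= [<-]]].
  case: ifPn => [lt <-|lt <-]; exists (nearest f d k t) => //; split => //; [left|right] => //.
  by split => //; exact/negP.
by case=> [[-> //]|[/negP/negbTE -> //]].
Qed.

Lemma nearest_simple E V (f : R -> E) d k (g : nat -> V) :
  (forall j, measurable_fun setT (fun t => `|f t - d j|)) ->
  simple_function (fun t => g (nearest f d k t)).
Proof.
move=> mf; split.
  apply: (@sub_finite_set _ _ (g @` `I_k.+1)); last exact: finite_image.
  by move=> _ [t _ <-]; exists (nearest f d k t) => //=; rewrite ltnS nearest_le.
move=> v; rewrite (_ : _ @^-1` _ = \bigcup_(i in [set i | g i = v]) [set t | nearest f d k t = i]).
  by apply: bigcup_measurable => i _; exact: nearest_measurable.
by apply/seteqP; split => [t /= gv|t [i /= gi ti]]; [exists (nearest f d k t)|rewrite /= ti].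
Qed.

(** A form of Pettis' criterion: measurability of countably many distances makes the nearest points
    among [d 0, ..., d k] simple functions, and they converge to [f] as [k] grows. *)
Lemma nice_of_dist E (f : R -> E) (d : nat -> E) :
  (forall j, measurable_fun setT (fun t => `|f t - d j|)) ->
  (forall t e, 0 < e -> exists i, `|f t - d i| < e) -> nice f.
Proof.
move=> mf df; exists (fun k t => d (nearest f d k t)); split => [k|t].
  exact: (nearest_simple k d).
apply/cvgrPdist_lt => e e0; have [i fi] := df t _ e0.
near=> k; apply: le_lt_trans fi; apply: nearest_min.
by near: k; exact: nbhs_infty_ge.
Unshelve. all: by end_near. Qed.

Lemma countable_enum E (C : set E) : countable C ->
  exists d : nat -> E, d 0%N = 0 /\ forall y, C y -> exists i, d i = y.
Proof.
move=> /countable_injP[g ginj].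
exists (fun i => if i is j.+1 then xget 0 [set y | C y /\ g y = j] else 0).
split=> // y Cy; exists (g y).+1.
case: xgetP => [z _ [Cz gz]|/(_ y)]; last by case.
by apply: ginj; rewrite ?inE.
Qed.

(** The approximating simple functions take countably many values in all, so that one sequence [d]
    serves every [f n]. Because [d 0 = 0], a nearest point is never farther from [f n t] than 0 is,
    which dominates the approximation errors. *)
Lemma nice_dense E (f : nat -> R -> E) : (forall n, nice (f n)) ->
  exists d : nat -> E, d 0%N = 0 /\
    forall n t e, 0 < e -> exists i, `|f n t - d i| < e.
Proof.
move=> nf; have [s sP] := choice nf.
have [|d [d0 dP]] := @countable_enum E (\bigcup_n \bigcup_k range (s n k)).
  apply: bigcup_countable => // n _; apply: bigcup_countable => // k _.
  by apply: finite_set_countable; have [/(_ k)[]] := sP n.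
exists d; split => // n t e e0; have [_ /(_ t)/cvgrPdist_lt/(_ e e0)[k _ /(_ k)]] := sP n.
move=> /(_ (leqnn _))/= ske; have [|i di] := dP (s n k t).
  by exists n => //; exists k => //; exists t.
by exists i; rewrite di.
Qed.

Lemma nice_lim E (f_ : nat -> R -> E) f : (forall n, nice (f_ n)) ->
  (forall t, f_ n t @[n --> \oo] --> f t) -> nice f.
Proof.
move=> nf ff; have [d [_ dP]] := nice_dense nf.
apply: (nice_of_dist (d := d)) => [j|t e e0].
  apply: (measurable_fun_cvg (h := fun n t => `|f_ n t - d j|)) => //.
    by move=> n; exact: nice_dist_measurable.
  by move=> t _; apply: cvg_norm; apply: cvgB => //; exact: cvg_cst.
have e2 : 0 < e / 2 by rewrite divr_gt0.
have /cvgrPdist_lt/(_ _ e2)[n _ /(_ n (leqnn _))/= fn] := ff t.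
have [i fi] := dP n t _ e2; exists i.
rewrite (splitr e) -(subrK (f_ n t) (f t)) -addrA.
by rewrite (le_lt_trans (ler_normD _ _))// ltrD.
Qed.

Lemma measurable_nice (f : R -> R) : measurable_fun setT f -> nice (f : R -> R^o).
Proof.
move=> mf; pose d i : R^o := if unpickle i is Some q then ratr q else 0.
apply: (nice_of_dist (d := d)) => [j|t e e0].
  apply: measurableT_comp => //; apply: measurable_funB => //.
have [|q] := @rat_in_itvoo R (f t) (f t + e); first by rewrite ltrDl.
rewrite in_itv/= => /andP[fq qf]; exists (pickle q).
rewrite /d pickleK distrC ger0_norm ?subr_ge0 ?ltW//.
by rewrite ltrBlDl.
Qed.

Lemma continuous_nice E (f : R -> E) : continuous f -> nice f.
Proof.
move=> cf; pose d i : E := if unpickle i is Some q then f (ratr q) else 0.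
apply: (nice_of_dist (d := d)) => [j|t e e0].
  apply: continuous_measurable_fun => t.
  apply: (@continuous_comp _ _ _ (fun t => f t - d j) Num.norm).
    by apply: continuousB; [exact: cf|exact: cvg_cst].
  exact: norm_continuous.
have /cvgrPdist_lt/(_ e e0)/nbhs_ballP[r /= r0 rP] := cf t.
have [|q] := @rat_in_itvoo R t (t + r); first by rewrite ltrDl.
rewrite in_itv/= => /andP[fq qf]; exists (pickle q).
rewrite /d pickleK; apply: rP; rewrite /ball/= distrC ger0_norm ?subr_ge0 ?ltW//.
by rewrite ltrBlDl.
Qed.

Lemma simple_nice E (s : R -> E) : simple_function s -> nice s.
Proof. by move=> ss; exists (fun=> s); split => // t; exact: cvg_cst. Qed.

Lemma strongly_measurable_nice E D (f : R -> E) : measurable D ->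
  strongly_measurable D f ->
  exists2 g, nice g & {ae @lebesgue_measure R, forall t, D t -> g t = f t}.
Proof.
move=> mD [s [ss]] [N [mN N0 NP]].
have mA : measurable (D `\` N) by exact: measurableD.
exists (fun t => if t \in D `\` N then f t else 0).
  exists (fun n t => if t \in D `\` N then s n t else 0).
  split => [n|t]; first exact: simple_if.
  case: ifPn => [/set_mem[Dt Nt]|_]; last exact: cvg_cst.
  by apply: contrapT => H; apply: Nt; apply: NP => /(_ Dt).
exists N; split => // t /= H; apply: contrapT => Nt; apply: H => Dt.
by rewrite mem_set.
Qed.

Lemma nice_strongly_measurable E D (f g : R -> E) : nice g ->
  {ae @lebesgue_measure R, forall t, D t -> g t = f t} -> strongly_measurable D f.
Proof.
move=> [s [ss sg]] gf; exists s; split => //.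
by move: gf; apply: ae_mono => t gf Dt; rewrite -gf.
Qed.

End simple_functions.

(** * Integrals of real functions *)

From mathcomp Require Import finmap.

Notation leb := (@lebesgue_measure _).
Notation intg D f := (leb.-integrable D (EFin \o f)).

Section nonmeasurable.
Context {R : realType}.
Local Open Scope ereal_scope.
Implicit Types (D : set R) (f g : R -> \bar R).
Import HBNNSimple.

(* The integral of a nonnegative function is a supremum over simple functions,
   so that no measurability is needed here. *)
Lemma ge0_le_integral_nonmeasurable f g : (forall t, 0 <= f t) ->
  (forall t, f t <= g t) -> \int[leb]_t f t <= \int[leb]_t g t.
Proof.
move=> f0 fg; rewrite !ge0_integralTE//; last first.
  by move=> t; exact: le_trans (f0 t) (fg t).
apply: ereal_sup_le => _ [h hf <-]; exists h => // t; exact: le_trans (hf t) (fg t).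
Qed.

(** The functions are arbitrary, as they will be norms of integrands known only up to null sets. A
    simple function below [f], once set to zero on the null set, lies below [g] and keeps its
    integral. *)
Lemma ge0_integral_ae_le D f g : (forall t, D t -> 0 <= f t) ->
  (forall t, D t -> 0 <= g t) ->
  {ae @lebesgue_measure R, forall t, D t -> f t = g t} ->
  \int[leb]_(t in D) f t <= \int[leb]_(t in D) g t.
Proof.
move=> f0 g0 [N [mN N0 NP]]; have -> := @ge0_integralE _ _ _ (@lebesgue_measure R) D f f0.
apply: ub_ereal_sup => _ [h hf <-].
rewrite -integralT_nnsfun.
have mh : measurable_fun setT (EFin \o h) by exact/measurable_EFinP.
rewrite (@ge0_negligible_integral _ _ _ _ setT N)//; last first.
  by move=> t _; rewrite lee_fin.
rewrite integral_mkcond [leRHS]integral_mkcond.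
apply: ge0_le_integral_nonmeasurable => t.
  by rewrite patchE; case: ifP => // _; rewrite lee_fin.
rewrite patchE; case: ifPn => [/set_mem[_ Nt]|_]; last first.
  by rewrite patchE; case: ifPn => // /set_mem; exact: g0.
apply: (le_trans (hf t)); rewrite !patchE; case: ifPn => // /set_mem Dt.
suff -> : f t = g t by [].
by apply: contrapT => fg; apply: Nt; apply: NP => /(_ Dt).
Qed.

Lemma ge0_integral_ae_eq D f g : (forall t, D t -> 0 <= f t) ->
  (forall t, D t -> 0 <= g t) ->
  {ae @lebesgue_measure R, forall t, D t -> f t = g t} ->
  \int[leb]_(t in D) f t = \int[leb]_(t in D) g t.
Proof.
move=> f0 g0 fg; apply/eqP; rewrite eq_le !ge0_integral_ae_le//.
by move: fg; apply: ae_mono => t fg Dt; rewrite fg.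
Qed.

End nonmeasurable.

Section scalar_integrals.
Context {R : realType} (D : set R).
Hypotheses (mD : measurable D) (fD : (leb D < +oo)%E).
Implicit Types f g : R -> R.

Lemma intg_cst c : intg D (fun=> c : R).
Proof.
apply: measurable_bounded_integrable => //.
by exists `|c|; split => // M cM t Dt; exact: ltW.
Qed.

Lemma intg_le f g : measurable_fun D f -> intg D g ->
  (forall t, D t -> `|f t| <= g t) -> intg D f.
Proof.
move=> mf ig fg; apply: le_integrable ig => //; first exact/measurable_EFinP.
by move=> t Dt; rewrite /= lee_fin (le_trans (fg _ Dt))// ler_norm.
Qed.

Lemma intg_norm f : intg D f -> intg D (fun t => `|f t|).
Proof. exact: integrable_norm. Qed.

Lemma intgD f g : intg D f -> intg D g -> intg D (fun t => f t + g t).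
Proof. by move=> nf ng; have := @integrableD _ _ _ (@lebesgue_measure R) _ mD _ _ nf ng. Qed.

Lemma intgB f g : intg D f -> intg D g -> intg D (fun t => f t - g t).
Proof. by move=> nf ng; have := @integrableB _ _ _ (@lebesgue_measure R) _ mD _ _ nf ng. Qed.

Lemma intgZ c f : intg D f -> intg D (fun t => c * f t).
Proof. by move=> nf; have := @integrableZl _ _ _ (@lebesgue_measure R) _ mD c _ nf. Qed.

Lemma intg_meas f : intg D f -> measurable_fun D f.
Proof. by move=> /integrableP[/measurable_EFinP]. Qed.

Lemma rintD f g : intg D f -> intg D g -> \int[leb]_(t in D) (f t + g t) =
  \int[leb]_(t in D) f t + \int[leb]_(t in D) g t.
Proof. exact: RintegralD. Qed.

Lemma rintZ c f : intg D f -> \int[leb]_(t in D) (c * f t) = c * \int[leb]_(t in D) f t.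
Proof. exact: RintegralZl. Qed.

Lemma le_rint f g : intg D f -> intg D g -> (forall t, D t -> f t <= g t) ->
  \int[leb]_(t in D) f t <= \int[leb]_(t in D) g t.
Proof. exact: le_Rintegral. Qed.

Lemma rint_sum I (r : seq I) (f : I -> R -> R) :
  (forall i, intg D (f i)) ->
  intg D (fun t => \sum_(i <- r) f i t) /\
  \int[leb]_(t in D) (\sum_(i <- r) f i t) = \sum_(i <- r) \int[leb]_(t in D) f i t.
Proof.
move=> fi; elim: r => [|i r [IH1 IH2]].
  rewrite big_nil; under eq_Rintegral do rewrite big_nil.
  rewrite Rintegral_cst// mul0r; split => //.
  by have := intg_cst 0; congr (leb.-integrable _ _); apply/funext => t /=; rewrite big_nil.
under eq_Rintegral do rewrite big_cons.
rewrite RintegralD// IH2 big_cons; split => //.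
have := intgD (fi i) IH1.
by congr (leb.-integrable _ _); apply/funext => t /=; rewrite big_cons.
Qed.

Lemma rint_ae_le f g : intg D f -> intg D g ->
  {ae @lebesgue_measure R, forall t, D t -> f t <= g t} ->
  \int[leb]_(t in D) f t <= \int[leb]_(t in D) g t.
Proof.
move=> nf ng fg.
have [mf mg] := (intg_meas nf, intg_meas ng).
(* The minimum equals [f] a.e. and is at most [g] everywhere. *)
have -> : \int[leb]_(t in D) f t = \int[leb]_(t in D) (Num.min (f t) (g t)).
  rewrite /Rintegral; congr fine; apply: ae_eq_integral => //.
  - exact/measurable_EFinP.
  - by apply/measurable_EFinP; exact: measurable_minr.
  by move: fg; apply: ae_mono => t fg Dt; rewrite min_l// fg.
apply: le_Rintegral => //; last by move=> t _; rewrite ge_min lexx orbT.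
apply: intg_le (intgD (intg_norm nf) (intg_norm ng)) _ => //.
  exact: measurable_minr.
by move=> t _; rewrite /Num.min; case: ifP => _; rewrite ?lerDl ?lerDr.
Qed.

Lemma rint_ae_eq f g : intg D f -> intg D g ->
  {ae @lebesgue_measure R, forall t, D t -> f t = g t} ->
  \int[leb]_(t in D) f t = \int[leb]_(t in D) g t.
Proof.
move=> nf ng fg; apply/eqP; rewrite eq_le !rint_ae_le//.
  by move: fg; apply: ae_mono => t fg Dt; rewrite fg.
by move: fg; apply: ae_mono => t fg Dt; rewrite fg.
Qed.

Lemma intg_ae f g : measurable_fun D f -> intg D g ->
  {ae @lebesgue_measure R, forall t, D t -> `|f t| <= g t} -> intg D f.
Proof.
move=> mf ng fg; have mg := intg_meas ng; apply/integrableP.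
split; first exact/measurable_EFinP.
have /integrableP[_ ] := ng; apply: le_lt_trans.
apply: ae_ge0_le_integral => //.
- by apply: measurableT_comp => //; exact/measurable_EFinP.
- by apply: measurableT_comp => //; exact/measurable_EFinP.
- move: fg; apply: ae_mono => t fg Dt /=.
  by rewrite lee_fin (le_trans (fg Dt))// ler_norm.
Qed.

Lemma rint_dct (f_ : nat -> R -> R) f g : (forall n, measurable_fun D (f_ n)) ->
  measurable_fun D f -> intg D g ->
  {ae @lebesgue_measure R, forall t, D t -> f_ n t @[n --> \oo] --> f t} ->
  {ae @lebesgue_measure R, forall t, D t -> forall n, `|f_ n t| <= g t} ->
  intg D f /\ (\int[leb]_(t in D) f_ n t) @[n --> \oo] --> \int[leb]_(t in D) f t.
Proof.
move=> mf_ mf ig ff fg.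
have [||||| if_ _ cv] := @dominated_convergence _ _ _ (@lebesgue_measure R) D mD
  (fun n => EFin \o f_ n) (EFin \o f) (EFin \o g).
- by move=> n; apply/measurable_EFinP; exact: mf_.
- by apply/measurable_EFinP; exact: mf.
- by move: ff; apply: ae_mono => t ff Dt; apply: cvg_EFin; [exact: nearW|exact: ff].
- exact: ig.
- by move: fg; apply: ae_mono => t fg n Dt; rewrite lee_fin fg.
split => //; apply: fine_cvg.
rewrite (_ : (Rintegral _ _ _)%:E = \int[leb]_(t in D) (f t)%:E)%E//.
by rewrite /Rintegral fineK//; exact: integrable_fin_num.
Qed.

Lemma rint_dct0 (f_ : nat -> R -> R) g : (forall n, measurable_fun D (f_ n)) ->
  intg D g ->
  {ae @lebesgue_measure R, forall t, D t -> f_ n t @[n --> \oo] --> (0 : R)} ->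
  {ae @lebesgue_measure R, forall t, D t -> forall n, `|f_ n t| <= g t} ->
  (\int[leb]_(t in D) f_ n t) @[n --> \oo] --> (0 : R).
Proof.
move=> mf ig f0 fg; have [_] := @rint_dct f_ (fun=> 0) g mf (measurable_cst _) ig f0 fg.
by rewrite Rintegral_cst// mul0r.
Qed.

Lemma rint_EFin f : intg D f ->
  (\int[leb]_(t in D) (f t)%:E)%E = (\int[leb]_(t in D) f t)%:E.
Proof. by move=> nf; rewrite /Rintegral fineK//; exact: integrable_fin_num. Qed.

End scalar_integrals.

Section bochner_integral.
Context {R : realType} {E : normedModType R} (D : set R).
Hypotheses (mD : measurable D) (fD : (leb D < +oo)%E).
Implicit Types (f g s : R -> E) (e : dual E).

Lemma dual_linear e : linear e.
Proof. by have [] := bounded_linearP e. Qed.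

Lemma dualD e x y : e (x + y) = e x + e y.
Proof. by have := dual_linear e 1 x y; rewrite !scale1r. Qed.

Lemma dual0 e : e 0 = 0.
Proof. by have /eqP := dualD e 0 0; rewrite addr0 addrC -subr_eq subrr => /eqP <-. Qed.

Lemma dualZ e a x : e (a *: x) = a * e x.
Proof. by have := dual_linear e a x 0; rewrite !addr0 dual0 addr0. Qed.

Lemma dualB e x y : e (x - y) = e x - e y.
Proof. by rewrite -scaleN1r dualD dualZ mulN1r. Qed.

Lemma dual_le e : exists2 M : R, 0 < M & forall x, `|e x| <= M * `|x|.
Proof.
have [_ [M eM]] := bounded_linearP e; exists (`|M| + 1) => [|x].
  by rewrite ltr_pwDr.
rewrite (le_trans (eM x))// ler_wpM2r// (le_trans (ler_norm _))// lerDl//.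
Qed.

Lemma dual_continuous e : continuous (e : E -> R).
Proof.
move=> x; have [M M0 eM] := dual_le e.
apply/cvgrPdist_lt => d d0; near=> y.
rewrite -dualB (le_lt_trans (eM _))// -ltr_pdivlMl// mulrC.
near: y; apply: (@cvgr_dist_lt _ _ _ _ _ id) => //; rewrite divr_gt0//.
Unshelve. all: by end_near. Qed.

Lemma dual_sum e I (r : seq I) (F : I -> E) :
  e (\sum_(i <- r) F i) = \sum_(i <- r) e (F i).
Proof.
by elim: r => [|i r IH]; rewrite ?big_nil ?dual0// !big_cons dualD IH.
Qed.

Lemma simple_bounded s : simple_function s -> exists M, forall t, `|s t| <= M.
Proof.
move=> [fs _]; exists (\sum_(v <- fset_set (range s)) `|v|) => t.
have st : s t \in fset_set (range s) by rewrite in_fset_set//; apply: mem_set; exists t.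
rewrite (big_fsetD1 (s t) st)/=.
by rewrite lerDl sumr_ge0.
Qed.

Lemma simple_intg_norm s : simple_function s -> intg D (fun t => `|s t|).
Proof.
move=> ss; have [M sM] := simple_bounded ss.
apply: (intg_le mD) (intg_cst mD fD M) _.
  by apply: measurable_funS (nice_norm_measurable (simple_nice ss)).
by move=> t _; rewrite normr_id.
Qed.

Lemma dual_measurable e f : nice f -> measurable_fun setT (e \o f : R -> R).
Proof. by move=> nf; apply: nice_comp_measurable => //; exact: dual_continuous. Qed.

Lemma dual_intg e f : nice f -> intg D (fun t => `|f t|) -> intg D (e \o f : R -> R).
Proof.
move=> nf fi; have [M M0 eM] := dual_le e.
apply: (intg_le mD) (intgZ mD M fi) _; last by move=> t _; exact: eM.
by apply: measurable_funS (dual_measurable e nf).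
Qed.

Lemma dual_simple_integral e s : simple_function s ->
  e (simple_integral D s) = \int[leb]_(t in D) e (s t).
Proof.
move=> [fs ms]; rewrite /simple_integral fsbig_finite// dual_sum.
have H v : intg D (fun t => \1_(s @^-1` [set v]) t : R).
  apply: (intg_le mD) (intg_cst mD fD 1) _.
    by apply: measurable_indic; exact: ms.
  by move=> t _; rewrite indicE ger0_norm// lern1 leq_b1.
transitivity (\int[leb]_(t in D) (\sum_(v <- fset_set (range s)) e v * \1_(s @^-1` [set v]) t)).
  rewrite (rint_sum mD fD _ _).2; last by move=> v; exact: intgZ.
  apply: eq_bigr => v _; rewrite RintegralZl// dualZ mulrC; congr (_ * _).
  by rewrite /Rintegral integral_indic; [rewrite setIC|exact: mD|exact: ms].
apply: eq_Rintegral => t _.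
have st : s t \in fset_set (range s) by rewrite in_fset_set//; apply: mem_set; exists t.
rewrite (big_fsetD1 (s t) st)/=.
rewrite indicE mem_set//= mulr1 big_seq big1 ?addr0// => v.
rewrite !inE => /andP[/eqP vs _].
by rewrite indicE memNset ?mulr0//= => /esym.
Qed.

(** A norming functional reduces the estimate to scalar integrals, so that sums over two unrelated
    partitions are never compared directly. *)
Lemma simple_integral_dist s s' : simple_function s -> simple_function s' ->
  `|simple_integral D s - simple_integral D s'| <= \int[leb]_(t in D) `|s t - s' t|.
Proof.
move=> ss ss'; have sB := simple_map2 (fun x y => x - y) ss ss'.
have [e [e1 <-]] := dual_norming (simple_integral D s - simple_integral D s').
rewrite dualB !dual_simple_integral// -RintegralB//; last 2 first.
- by apply: dual_intg; [exact: simple_nice|exact: simple_intg_norm].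
- by apply: dual_intg; [exact: simple_nice|exact: simple_intg_norm].
apply: le_Rintegral => //.
- by apply: intgB => //; apply: dual_intg; (exact: simple_nice || exact: simple_intg_norm).
- exact: simple_intg_norm.
- by move=> t _; rewrite -dualB (le_trans (ler_norm _)).
Qed.

End bochner_integral.

(** * The Bochner integral *)

Lemma cvg_dist0 {R : realType} {V : normedModType R} (u : nat -> V) l :
  u n @[n --> \oo] --> l -> `|l - u n| @[n --> \oo] --> (0 : R).
Proof.
move=> /cvgrPdist_lt ul; apply/cvgrPdist_lt => e /ul; apply: filterS => n.
by rewrite sub0r normrN normr_id.
Qed.

Section measurable_comparison.
Context {R : realType}.
Implicit Types f g : R -> R.

Lemma measurable_set_le f g : measurable_fun setT f -> measurable_fun setT g ->
  measurable [set t | f t <= g t].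
Proof.
move=> mf mg; have := measurable_fun_ler mf mg.
by move=> /(_ measurableT [set true]); rewrite setTI; apply.
Qed.

Lemma measurable_set_lt f g : measurable_fun setT f -> measurable_fun setT g ->
  measurable [set t | f t < g t].
Proof.
move=> mf mg; have := measurable_fun_ltr mf mg.
by move=> /(_ measurableT [set true]); rewrite setTI; apply.
Qed.

Lemma rint_norm_le (D : set R) f : measurable D -> intg D f ->
  `|\int[leb]_(t in D) f t| <= \int[leb]_(t in D) `|f t|.
Proof. by move=> mD fi; exact: le_normr_Rintegral. Qed.

End measurable_comparison.

Section bochner_characterization.
Context {R : realType} {E : completeNormedModType R} (D : set R).
Hypotheses (mD : measurable D) (fD : (leb D < +oo)%E).
Implicit Types (f g s : R -> E) (e : dual E) (v : E).

Lemma nice_norm_measurableD f : nice f -> measurable_fun D (fun t => `|f t|).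
Proof. by move=> nf; apply: measurable_funS (nice_norm_measurable nf). Qed.

(** Functionals commute with integrals of simple functions and with limits in L^1. A Bochner
    integral is thereby determined by scalar integrals. *)
Lemma has_bochner_dual f g v : nice g ->
  {ae @lebesgue_measure R, forall t, D t -> g t = f t} ->
  has_bochner_integral D f v ->
  intg D (fun t => `|g t|) /\ forall e, e v = \int[leb]_(t in D) e (g t).
Proof.
move=> ng gf [s [ss _ itf sv]].
have {}itf : (\int[leb]_(t in D) `|g t - s n t|%:E)%E @[n --> \oo] --> 0%E.
  apply: cvg_trans itf; apply: near_eq_cvg; near=> n.
  apply: ge0_integral_ae_eq => [t _|t _|]; rewrite ?lee_fin//.
  by move: gf; apply: ae_mono => t gf Dt; rewrite gf.
have ngs n : nice (fun t => g t - s n t) by apply: niceB => //; exact: simple_nice.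
have [[N _ fin] itc] := (fine_cvgP _ _).1 itf.
have igs n : (N <= n)%N -> intg D (fun t => `|g t - s n t|).
  move=> Nn; apply/integrableP; split.
    by apply/measurable_EFinP; exact: nice_norm_measurableD.
  under eq_integral do rewrite /= normr_id.
  by rewrite ltey_eq; have /= -> := fin n Nn.
have ig : intg D (fun t => `|g t|).
  apply: (intg_le mD) (intgD mD (igs N (leqnn N)) (simple_intg_norm mD fD (ss N))) _.
    exact: nice_norm_measurableD.
  by move=> t _; rewrite normr_id -{1}(subrK (s N t) (g t)) ler_normD.
split => // e; apply: (@cvg_unique R (@Rhausdorff R) ((e : E -> R) (simple_integral D (s n)) @[n --> \oo])).
  apply: (@continuous_cvg _ _ _ _ _ _ (e : E -> R)) => //; exact: dual_continuous.
apply/cvgrPdist_le => d d0.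
have [M M0 eM] := dual_le e.
move/cvgrPdist_le : itc => /(_ (d / M)); rewrite divr_gt0// => /(_ isT) itc.
near=> n.
have Nn : (N <= n)%N by near: n; exact: nbhs_infty_ge.
have is_ := simple_intg_norm mD fD (ss n).
rewrite dual_simple_integral// -RintegralB//; last 2 first.
- exact: dual_intg.
- by apply: dual_intg => //; exact: simple_nice.
apply: le_trans (rint_norm_le mD _) _.
  by apply: intgB => //; apply: dual_intg => //; exact: simple_nice.
apply: (@le_trans _ _ (\int[leb]_(t in D) (M * `|g t - s n t|))).
  apply: le_Rintegral => //.
  - by apply: intg_norm; apply: intgB => //; apply: dual_intg => //; exact: simple_nice.
  - exact: intgZ (igs _ Nn).
  - by move=> t _; rewrite -dualB eM.
rewrite RintegralZl//; last exact: igs.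
rewrite -ler_pdivlMl// mulrC.
have : `|0 - (fine \o (fun n => \int[leb]_(t in D) `|g t - s n t|%:E)%E) n| <= d / M by near: n; exact: itc.
by rewrite sub0r normrN /= ger0_norm// fine_ge0// integral_ge0.
Unshelve. all: by end_near. Qed.

Lemma bochner_exists f : nice f -> intg D (fun t => `|f t|) ->
  exists v, has_bochner_integral D f v.
Proof.
move=> nf fi; have [s [ss sf]] := nf.
(* The simple functions are set to zero where they exceed twice the norm of the limit. Pointwise
   convergence persists, and [3 |f|] dominates the errors. *)
pose A n : set R := [set t | `|s n t| <= 2 * `|f t|].
have mA n : measurable (A n).
  apply: measurable_set_le; first exact: nice_norm_measurable (simple_nice (ss n)).
  by apply: measurable_funM => //; exact: nice_norm_measurable.
pose s' n t := if t \in A n then s n t else 0.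
have ss' n : simple_function (s' n) by exact: simple_if.
have s'f t : s' n t @[n --> \oo] --> f t.
  have [f0|f0] := eqVneq (f t) 0.
    rewrite f0 (_ : (fun n => s' n t) = fun=> 0); first exact: cvg_cst.
    apply/funext => n; rewrite /s'; case: ifPn => // /set_mem.
    by rewrite /A/= f0 normr0 mulr0 normr_le0 => /eqP.
  have /cvgrPdist_le/(_ `|f t|) := sf t; rewrite normr_gt0 => /(_ f0) sft.
  apply: cvg_trans (sf t); apply: near_eq_cvg; near=> n.
  rewrite /s' mem_set//= /A/= mulrDl mul1r -lerBlDr (le_trans (lerB_dist _ _))//.
  by rewrite distrC; near: n.
have sb n t : `|f t - s' n t| <= 3 * `|f t|.
  rewrite /s'; case: ifPn => [/set_mem|_].
    by rewrite /A/= => sA; rewrite (le_trans (ler_normB _ _))//; lra.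
  by rewrite subr0 ler_peMl// ler1n.
have nfs n : nice (fun t => f t - s' n t) by apply: niceB => //; exact: simple_nice.
have ifs n : intg D (fun t => `|f t - s' n t|).
  apply: (intg_le mD) (intgZ mD 3 fi) _; first exact: nice_norm_measurableD.
  by move=> t _; rewrite normr_id sb.
have cv : (\int[leb]_(t in D) `|f t - s' n t|) @[n --> \oo] --> (0 : R).
  apply: (rint_dct0 mD _ (intgZ mD 3 fi)).
  - by move=> n; exact: nice_norm_measurableD.
  - by apply: aeW => t _; exact: cvg_dist0.
  - by apply: aeW => t _ n; rewrite normr_id sb.
have isd n m : intg D (fun t => `|s' n t - s' m t|).
  exact: simple_intg_norm (simple_map2 (fun x y => x - y) (ss' n) (ss' m)).
have /cauchy_cvgP cI : cauchy (simple_integral D (s' n) @[n --> \oo]).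
  apply/cauchyP => d d0; have d2 : 0 < d / 2 by rewrite divr_gt0.
  move/cvgrPdist_lt : cv => /(_ _ d2) [N _ HN].
  exists (simple_integral D (s' N)), N => // n /= Nn.
  rewrite -ball_normE/=; apply: le_lt_trans (simple_integral_dist mD fD (ss' N) (ss' n)) _.
  apply: (@le_lt_trans _ _ (\int[leb]_(t in D) (`|f t - s' N t| + `|f t - s' n t|))).
    apply: le_Rintegral => //; first exact: intgD.
    move=> t _; rewrite -(normrN (f t - s' N t)) opprB.
    by rewrite (le_trans _ (ler_normD _ _))// addrA subrK.
  rewrite RintegralD// [ltRHS]splitr ltrD//.
    by have := HN N (leqnn N); rewrite sub0r normrN; apply: le_lt_trans; rewrite ler_norm.
  by have := HN n Nn; rewrite sub0r normrN; apply: le_lt_trans; rewrite ler_norm.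
exists (lim (simple_integral D (s' n) @[n --> \oo])), s'; split => //; first exact: aeW.
have -> : (fun n => \int[leb]_(t in D) `|f t - s' n t|%:E)%E =
  EFin \o (fun n => \int[leb]_(t in D) `|f t - s' n t|).
  by apply/funext => n /=; rewrite rint_EFin.
by apply: cvg_EFin => //; exact: nearW.
Unshelve. all: by end_near. Qed.

(** Characterized by scalar integrals, as the Pettis integral is, so that the rules of calculus
    follow by duality; for nice functions with integrable norm it is the Bochner integral. The
    default value is 0. *)
Definition bint f : E :=
  xget 0 [set v | forall e, e v = \int[leb]_(t in D) e (f t)].

Lemma bintP f : nice f -> intg D (fun t => `|f t|) ->
  forall e, e (bint f) = \int[leb]_(t in D) e (f t).
Proof.
move=> nf fi; rewrite /bint; have [v hv] := bochner_exists nf fi.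
have [|_ ev] := has_bochner_dual nf _ hv; first exact: aeW.
by case: xgetP => [w _ //|/(_ v)].
Qed.

Lemma has_bochnerE f g v : nice g -> intg D (fun t => `|g t|) ->
  {ae @lebesgue_measure R, forall t, D t -> g t = f t} ->
  has_bochner_integral D f v <-> v = bint g.
Proof.
move=> ng gi gf; split=> [hv|->].
  have [_ ev] := has_bochner_dual ng gf hv.
  by apply: dual_ext => e; rewrite ev bintP.
have [v' hv'] := bochner_exists ng gi.
have [|_ ev] := has_bochner_dual ng _ hv'; first exact: aeW.
have <- : v' = bint g by apply: dual_ext => e; rewrite ev bintP.
have [s [ss sg itg sv]] := hv'; exists s; split => //.
  by apply: ae_mono2 gf sg => t gf sg Dt; rewrite -gf//; exact: sg.
apply: cvg_trans itg; apply: near_eq_cvg; near=> n.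
apply: ge0_integral_ae_eq => [t _|t _|]; rewrite ?lee_fin//.
by move: gf; apply: ae_mono => t gf Dt; rewrite gf.
Unshelve. all: by end_near. Qed.

Lemma bint_norm f : nice f -> intg D (fun t => `|f t|) ->
  `|bint f| <= \int[leb]_(t in D) `|f t|.
Proof.
move=> nf fi; have [e [e1 <-]] := dual_norming (bint f).
rewrite bintP//; apply: le_Rintegral => //; first exact: dual_intg.
by move=> t _; rewrite (le_trans (ler_norm _)).
Qed.

Lemma intg_normD f g : nice f -> nice g -> intg D (fun t => `|f t|) ->
  intg D (fun t => `|g t|) -> intg D (fun t => `|f t + g t|).
Proof.
move=> nf ng fi gi; apply: (intg_le mD) (intgD mD fi gi) _.
  by apply: nice_norm_measurableD; exact: niceD.
by move=> t _; rewrite normr_id ler_normD.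
Qed.

Lemma intg_normZ a f : intg D (fun t => `|f t|) -> intg D (fun t => `|a *: f t|).
Proof.
move=> /(intgZ mD `|a|); congr (leb.-integrable _ _).
by apply/funext => t /=; rewrite normrZ.
Qed.

Lemma bintD f g : nice f -> nice g -> intg D (fun t => `|f t|) ->
  intg D (fun t => `|g t|) -> bint (fun t => f t + g t) = bint f + bint g.
Proof.
move=> nf ng fi gi; apply: dual_ext => e.
rewrite dualD !bintP//; [|exact: niceD|exact: intg_normD].
rewrite -RintegralD//; [|exact: dual_intg|exact: dual_intg].
by apply: eq_Rintegral => t _; rewrite dualD.
Qed.

Lemma bintZ a f : nice f -> intg D (fun t => `|f t|) ->
  bint (fun t => a *: f t) = a *: bint f.
Proof.
move=> nf fi; apply: dual_ext => e.
rewrite dualZ !bintP//; [|exact: niceZ|exact: intg_normZ].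
rewrite -RintegralZl//; last exact: dual_intg.
by apply: eq_Rintegral => t _; rewrite dualZ.
Qed.

Lemma bintB f g : nice f -> nice g -> intg D (fun t => `|f t|) ->
  intg D (fun t => `|g t|) -> bint (fun t => f t - g t) = bint f - bint g.
Proof.
move=> nf ng fi gi; rewrite -(scaleN1r (bint g)) -bintZ// -bintD//.
- by congr bint; apply/funext => t; rewrite scaleN1r.
- exact: niceZ.
- exact: intg_normZ.
Qed.

Lemma bint_sum I (r : seq I) (f : I -> R -> E) : (forall i, nice (f i)) ->
  (forall i, intg D (fun t => `|f i t|)) ->
  bint (fun t => \sum_(i <- r) f i t) = \sum_(i <- r) bint (f i).
Proof.
move=> nf fi; apply: dual_ext => e.
have fi' : intg D (fun t => `|\sum_(i <- r) f i t|).
  apply: (intg_le mD) (rint_sum mD fD r fi).1 _.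
    by apply: nice_norm_measurableD; exact: nice_sum.
  by move=> t _; rewrite normr_id ler_norm_sum.
rewrite dual_sum bintP//; last exact: nice_sum.
under eq_bigr do rewrite bintP//.
rewrite -(rint_sum mD fD r _).2; last by move=> i; exact: dual_intg.
by apply: eq_Rintegral => t _; rewrite dual_sum.
Qed.

Lemma bint_ae f g : nice f -> nice g -> intg D (fun t => `|f t|) ->
  {ae @lebesgue_measure R, forall t, D t -> f t = g t} -> bint f = bint g.
Proof.
move=> nf ng fi fg.
have gi : intg D (fun t => `|g t|).
  apply: (intg_ae mD _ fi); first exact: nice_norm_measurableD.
  by move: fg; apply: ae_mono => t fg Dt; rewrite normr_id fg.
apply: dual_ext => e; rewrite !bintP//.
apply: rint_ae_eq => //; [exact: dual_intg|exact: dual_intg|].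
by move: fg; apply: ae_mono => t fg Dt; rewrite fg.
Qed.

Lemma bint_dct (f_ : nat -> R -> E) f (g : R -> R) : (forall n, nice (f_ n)) ->
  nice f -> intg D g ->
  {ae @lebesgue_measure R, forall t, D t -> f_ n t @[n --> \oo] --> f t} ->
  {ae @lebesgue_measure R, forall t, D t -> forall n, `|f_ n t| <= g t} ->
  intg D (fun t => `|f t|) /\ bint (f_ n) @[n --> \oo] --> bint f.
Proof.
move=> nf_ nf ig ff fg.
have fni n : intg D (fun t => `|f_ n t|).
  apply: (intg_ae mD _ ig); first exact: nice_norm_measurableD.
  by move: fg; apply: ae_mono => t fg Dt; rewrite normr_id fg.
have fgb : {ae @lebesgue_measure R, forall t, D t -> `|f t| <= g t}.
  apply: ae_mono2 ff fg => t ff fg Dt.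
  have /cvg_lim <- // : `|f_ n t| @[n --> \oo] --> `|f t| by apply: cvg_norm; exact: ff.
  apply: limr_le; last by apply: nearW => n; exact: fg.
  by apply/cvg_ex; exists `|f t|; apply: cvg_norm; exact: ff.
have fi : intg D (fun t => `|f t|).
  apply: (intg_ae mD _ ig); first exact: nice_norm_measurableD.
  by move: fgb; apply: ae_mono => t fgb Dt; rewrite normr_id fgb.
split => //; apply/cvgrPdist_le => d d0.
have : (\int[leb]_(t in D) `|f t - f_ n t|) @[n --> \oo] --> (0 : R).
  apply: (@rint_dct0 _ _ mD _ (fun t => g t + g t)).
  - by move=> n; apply: nice_norm_measurableD; exact: niceB.
  - exact: intgD.
  - move: ff; apply: ae_mono => t ff Dt; apply: cvg_dist0; exact: ff.
  - apply: ae_mono2 fg fgb => t fg fgb Dt n; rewrite normr_id.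
    by rewrite (le_trans (ler_normB _ _))// lerD// ?fg ?fgb.
move/cvgrPdist_le => /(_ d d0); apply: filterS => n /=.
rewrite sub0r normrN => H; rewrite -bintB//.
have fBi : intg D (fun t => `|f t - f_ n t|).
  have := intg_normD nf (niceZ (-1) (nf_ n)) fi (intg_normZ (-1) (fni n)).
  by congr (leb.-integrable _ _); apply/funext => t /=; rewrite scaleN1r.
apply: le_trans (bint_norm _ fBi) _; first exact: niceB.
by apply: le_trans H; rewrite ler_norm.
Qed.

End bochner_characterization.

(** * Noncompactness of sets of integrals *)

Section covering.
Context {R : realType} {E : normedModType R}.
Implicit Types (A B : set E) (r : R).

(** The measure of noncompactness in relational form: for [r > 0], [cov A r] gives
    [hausdorff_mnc A <= r], and [hausdorff_mnc A < r] gives [cov A r]. The centres may lie outside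
    [A]. *)
Definition cov A r := exists l : seq E,
  forall y, A y -> exists2 c, c \in l & `|y - c| < r.

Lemma cov_subset A B r : A `<=` B -> cov B r -> cov A r.
Proof. by move=> AB [l lB]; exists l => y /AB; exact: lB. Qed.

Lemma cov_near A B r r' : cov B r ->
  (forall y, A y -> exists2 z, B z & `|y - z| <= r') -> cov A (r + r').
Proof.
move=> [l lB] AB; exists l => y /AB[z /lB[c cl zc] yz]; exists c => //.
rewrite -(subrK z y) -addrA (le_lt_trans (ler_normD _ _))//.
by rewrite [ltRHS]addrC ler_ltD.
Qed.

Lemma cov_add A B r r' : cov A r -> cov B r' ->
  cov [set x + y | x in A & y in B] (r + r').
Proof.
move=> [l lA] [m mB]; exists [seq x + y | x <- l, y <- m].
move=> _ [x /lA[c cl xc] [y /mB[c' cm yc'] <-]].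
exists (c + c'); first by apply/allpairsP; exists (c, c').
by rewrite opprD addrACA (le_lt_trans (ler_normD _ _))// ltrD.
Qed.

Lemma cov_segment (v : E) (M r : R) : 0 < r ->
  cov [set l *: v | l in [set l | 0 <= l <= M]] r.
Proof.
move=> r0; pose d := r / (`|v| + 1).
have d0 : 0 < d by rewrite divr_gt0// ltr_wpDl.
exists [seq (d *+ j) *: v | j <- iota 0 (Num.truncn (M / d)).+1].
move=> _ [l /andP[l0 lM] <-]; exists ((d *+ Num.truncn (l / d)) *: v).
  apply/mapP; exists (Num.truncn (l / d)) => //; rewrite mem_iota/= add0n ltnS.
  by apply: le_truncn; rewrite ler_pM2r// invr_gt0.
rewrite -scalerBl normrZ.
have ld0 : 0 <= l / d by rewrite divr_ge0// ltW.
have /andP[t1 t2] := truncn_itv ld0.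
have H1 : `|l - d *+ Num.truncn (l / d)| <= d.
  rewrite -mulr_natl; rewrite ler_distlC; move: t1 t2.
  rewrite ler_pdivlMr// ltr_pdivrMr// -natr1 mulrDl mul1r.
  by move=> t1 t2; rewrite -lerBlDl in t1 *; apply/andP; split; lra.
apply: (@le_lt_trans _ _ (d * `|v|)); first by rewrite ler_wpM2r.
by rewrite /d -mulrA mulrC gtr_pMl// ltr_pdivrMl ?ltr_wpDl// mulr1 ltrDl.
Qed.

(** A convex, totally bounded set with two uses: with [M] the measure of the domain it contains the
    integrals of simple functions with values among the [d i], and with [M = 1] it contains the
    [d i] themselves. *)
Definition zonotope (n : nat) (d : nat -> E) (M : R) : set E :=
  [set \sum_(i < n) l i *: d i | l in [set l : nat -> R | forall i, 0 <= l i <= M]].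

Lemma cov_zonotope n d M r : 0 < r -> cov (zonotope n d M) r.
Proof.
elim: n r => [|n IH] r r0.
  exists [:: 0] => _ [l _ <-]; exists 0; first by rewrite inE.
  by rewrite big_ord0 subrr normr0.
have r2 : 0 < r / 2 by rewrite divr_gt0.
have := cov_add (IH _ r2) (cov_segment (d n) M r2).
rewrite -splitr; apply: cov_subset => _ [l lM <-].
rewrite big_ord_recr/=; exists (\sum_(i < n) l i *: d i); first by exists l.
by exists (l n *: d n) => //; exists (l n) => //; exact: lM.
Qed.

Lemma cvx_zonotope n d M : cvx (zonotope n d M).
Proof.
move=> a _ _ a0 a1 [l lM <-] [m mM <-].
exists (fun i => a * l i + (1 - a) * m i).
  move=> i; have /andP[l0 l1] := lM i; have /andP[m0 m1] := mM i.
  have a1' : 0 <= 1 - a by rewrite subr_ge0.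
  rewrite addr_ge0 ?mulr_ge0//=.
  rewrite (_ : M = a * M + (1 - a) * M); last by ring.
  by apply: lerD; apply: ler_wpM2l.
rewrite !scaler_sumr -big_split/=; apply: eq_bigr => i _.
by rewrite !scalerA -scalerDl.
Qed.

Lemma zonotope_mem (l : seq E) c : c \in l ->
  zonotope (size l) (fun i => l`_i) 1 c.
Proof.
move=> cl; have cs : (index c l < size l)%N by rewrite index_mem.
exists (fun i => (i == index c l)%:R).
  by move=> i; case: (_ == _); rewrite /= ?lexx ?ler01.
rewrite (bigD1 (Ordinal cs))//= eqxx scale1r nth_index// big1 ?addr0// => i.
by rewrite -val_eqE/= => /negbTE ->; rewrite scale0r.
Qed.

End covering.

Section nearest_error.
Context {R : realType} {E : completeNormedModType R} (D : set R).
Hypotheses (mD : measurable D) (fD : (leb D < +oo)%E).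
Variables (z : nat -> R -> E) (g : R -> R).
Hypotheses (nz : forall n, nice (z n)) (zg : forall n t, `|z n t| <= g t)
  (ig : intg D g).

(** [sups _ 0] is the supremum over all [n]. An error bound that is uniform along the sequence is
    inherited by convex combinations. *)
Definition nearest_error (d : nat -> E) (k : nat) (t : R) : R :=
  sups (fun n => `|z n t - d (nearest (z n) d k t)|) 0.

Variable d : nat -> E.
Hypotheses (d0 : d 0%N = 0)
  (dz : forall n t e, 0 < e -> exists i, `|z n t - d i| < e).

Let approx n k t := d (nearest (z n) d k t).
Let phi := nearest_error d.

Lemma approx_simple n k : simple_function (approx n k).
Proof. by apply: nearest_simple => j; exact: nice_dist_measurable. Qed.

Lemma approx_dist_le n k t : `|z n t - approx n k t| <= g t.
Proof. by rewrite (le_trans (nearest_min _ _ _ (leq0n k)))// d0 subr0. Qed.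

Let errors_ub k t : has_ubound (range (fun n => `|z n t - approx n k t|)).
Proof. by exists (g t) => _ [n _ <-]; exact: approx_dist_le. Qed.

Lemma approx_dist n k t : `|z n t - approx n k t| <= phi k t.
Proof.
apply: ub_le_sup; last by exists n.
by apply/has_ubound_sdrop; exact: errors_ub.
Qed.

Lemma nearest_error_ge0 k t : 0 <= phi k t.
Proof. by rewrite (le_trans _ (approx_dist 0 k t)). Qed.

Lemma nearest_error_lub k t r : (forall n, `|z n t - approx n k t| <= r) ->
  phi k t <= r.
Proof.
move=> zr; apply: ge_sup; first by exists (`|z 0%N t - approx 0 k t|), 0%N.
by move=> _ [n _ <-].
Qed.

Lemma nearest_error_le k t : phi k t <= g t.
Proof. by apply: nearest_error_lub => n; exact: approx_dist_le. Qed.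

Lemma nearest_error_measurable k : measurable_fun setT (phi k).
Proof.
apply: measurable_fun_sups => [t _|n]; first exact: errors_ub.
by apply: nice_norm_measurable; apply: niceB => //; apply: simple_nice; exact: approx_simple.
Qed.

Lemma nearest_error_intg k : intg D (phi k).
Proof.
apply: (intg_le mD) ig _; first exact: measurable_funS (nearest_error_measurable k).
by move=> t _; rewrite ger0_norm ?nearest_error_ge0 ?nearest_error_le.
Qed.

(* Points of a ball of radius [r] are within [2 * r] of each other, hence of
   the point of [d] that approximates one of them. *)
Lemma nearest_error_cov t r e : 0 < e -> cov (range (z ^~ t)) r ->
  \forall k \near \oo, phi k t <= 2 * r + e.
Proof.
move=> e0 [l lr].
have [K HK] : exists K, forall n c, c \in l -> `|z n t - c| < r ->
    exists2 i, (i <= K)%N & `|z n t - d i| <= 2 * r + e.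
  elim: l {lr} => [|c l [K HK]]; first by exists 0%N.
  have [[m mc]|none] := pselect (exists m, `|z m t - c| < r).
    have [j zj] := dz m t e0.
    exists (maxn K j) => n c'; rewrite inE => /predU1P[->|cl] nc; last first.
      by have [i iK] := HK n c' cl nc; exists i => //; rewrite leq_max iK.
    exists j; first by rewrite leq_max leqnn orbT.
    have -> : z n t - d j = (z n t - c) + ((c - z m t) + (z m t - d j)).
      by rewrite !subrKA.
    have H1 := ler_normD (z n t - c) ((c - z m t) + (z m t - d j)).
    have H2 := ler_normD (c - z m t) (z m t - d j).
    by rewrite distrC in mc; lra.
  exists K => n c'; rewrite inE => /predU1P[->|cl nc]; last exact: HK cl nc.
  by move=> nc; exfalso; apply: none; exists n.
near=> k; apply: nearest_error_lub => n.
have [c cl nc] := lr (z n t) (ex_intro2 _ _ n I erefl).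
have [i iK zi] := HK n c cl nc.
apply: le_trans (nearest_min _ _ _ _) zi; apply: leq_trans iK _.
by near: k; exact: nbhs_infty_ge.
Unshelve. all: by end_near. Qed.

(** The positive part of the excess of the error over [2 rho] tends to 0 a.e. and is dominated by
    [g + |2 rho|]. The factor 2 arises because the points [d i] are close to the sequence and not to
    the centres of the covering balls. *)
Lemma nearest_error_integral (rho : R -> R) : intg D rho ->
  {ae @lebesgue_measure R, forall t, D t -> forall r, rho t < r -> cov (range (z ^~ t)) r} ->
  forall e, 0 < e -> \forall k \near \oo,
    \int[leb]_(t in D) phi k t <= 2 * \int[leb]_(t in D) rho t + e.
Proof.
move=> irho hrho e e0.
pose psi k t := Num.max (phi k t - 2 * rho t) 0.
have i2 : intg D (fun t => 2 * rho t) by exact: intgZ.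
have mpsi k : measurable_fun D (psi k).
  apply: measurable_maxr => //; apply: measurable_funB.
    exact: measurable_funS (nearest_error_measurable k).
  exact: intg_meas.
have psib k t : `|psi k t| <= g t + `|2 * rho t|.
  rewrite ger0_norm; last by rewrite le_max lexx orbT.
  rewrite /psi ge_max; apply/andP; split.
    by apply: lerD; [exact: nearest_error_le|rewrite -normrN ler_norm].
  by rewrite addr_ge0// (le_trans _ (zg 0 t)).
have ib : intg D (fun t => g t + `|2 * rho t|) by apply: intgD => //; exact: intg_norm.
have cv : (\int[leb]_(t in D) psi k t) @[k --> \oo] --> (0 : R).
  apply: (rint_dct0 mD mpsi ib); last by apply: aeW => t _ k; exact: psib.
  move: hrho; apply: ae_mono => t hrho Dt; apply/cvgrPdist_le => r r0.
  have r4 : 0 < r / 4 by rewrite divr_gt0.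
  have := nearest_error_cov r4 (hrho Dt (rho t + r / 4) _).
  rewrite ltrDl r4 => /(_ isT); apply: filterS => k Hk.
  rewrite sub0r normrN ger0_norm; last by rewrite le_max lexx orbT.
  by rewrite /psi ge_max (ltW r0) andbT; lra.
move/cvgrPdist_le : cv => /(_ e e0); apply: filterS => k.
rewrite sub0r normrN => /(le_trans (ler_norm _)) psie.
have ipsi : intg D (psi k).
  by apply: (intg_le mD (mpsi k) ib) => t _; exact: psib.
rewrite -RintegralZl//.
apply: (@le_trans _ _ (\int[leb]_(t in D) (2 * rho t + psi k t))).
  apply: le_Rintegral => //; [exact: nearest_error_intg|exact: intgD|].
  by move=> t _; rewrite -lerBlDl /psi le_max lexx.
by rewrite RintegralD// lerD2l.
Qed.

Lemma bint_indic (A : set R) (v : E) : measurable A ->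
  bint D (fun t => (\1_A t : R) *: v) = fine (leb (D `&` A)) *: v.
Proof.
move=> mA; have nA : nice (fun t => (\1_A t : R) *: v).
  apply: (@niceM _ _ (\1_A) (fun=> v)); last exact: nice_cst.
  by apply: measurable_nice; exact: measurable_indic.
have i1 : intg D (\1_A : R -> R).
  apply: (intg_le mD) (intg_cst mD fD 1) _.
    exact: measurable_indic.
  by move=> t _; rewrite indicE ger0_norm// lern1 leq_b1.
have iA : intg D (fun t => `|(\1_A t : R) *: v|).
  apply: (intg_le mD) (intgZ mD `|v| i1) _; first exact: nice_norm_measurableD.
  by move=> t _; rewrite normr_id normrZ mulrC ger0_norm.
apply: dual_ext => e; rewrite (bintP mD fD nA iA) dualZ.
under eq_Rintegral do rewrite dualZ.
rewrite RintegralZr//; congr (_ * _).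
by rewrite /Rintegral integral_indic; [rewrite setIC|exact: mD|exact: mA].
Qed.

Let cell n k i := [set t | nearest (z n) d k t = i].

Lemma cell_measurable n k i : measurable (cell n k i).
Proof. by apply: nearest_measurable => j; exact: nice_dist_measurable. Qed.

Lemma approxE n k t : approx n k t = \sum_(i < k.+1) (\1_(cell n k i) t : R) *: d i.
Proof.
have kP : (nearest (z n) d k t < k.+1)%N by rewrite ltnS nearest_le.
rewrite (bigD1 (Ordinal kP))//= indicE mem_set//= scale1r big1 ?addr0// => i ik.
rewrite indicE memNset ?scale0r// /cell/= => ti.
by move/eqP : ik; apply; apply/val_inj.
Qed.

(** The coefficients are measures of cells, hence between 0 and the measure of [D]: the zonotope
    does not depend on [n]. *)
Lemma bint_approx n k :
  zonotope k.+1 d (fine (leb D)) (bint D (approx n k)).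
Proof.
exists (fun i => fine (leb (D `&` cell n k i))) => [i|].
  have mc := measurableI _ _ mD (cell_measurable n k i).
  have le : (leb (D `&` cell n k i) <= leb D)%E.
    by apply: (@le_measure _ _ _ (@lebesgue_measure R)); [exact: mem_set|exact: mem_set|exact: subIsetl].
  rewrite fine_ge0//= fine_le// ge0_fin_numE//.
  exact: le_lt_trans le fD.
have -> : approx n k = fun t => \sum_(i < k.+1) (\1_(cell n k i) t : R) *: d i.
  by apply/funext => t; exact: approxE.
rewrite bint_sum//; first by apply: eq_bigr => i _; rewrite bint_indic//; exact: cell_measurable.
  move=> i; apply: (@niceM _ _ (\1_(cell n k i)) (fun=> d i)); last exact: nice_cst.
  by apply: measurable_nice; apply: measurable_indic; exact: cell_measurable.
move=> i; apply: (intg_le mD) (intg_cst mD fD `|d i|) _.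
  apply: nice_norm_measurableD; apply: (@niceM _ _ (\1_(cell n k i)) (fun=> d i)); last exact: nice_cst.
  by apply: measurable_nice; apply: measurable_indic; exact: cell_measurable.
move=> t _; rewrite normr_id normrZ indicE ger0_norm//.
by rewrite ler_piMl// lern1 leq_b1.
Qed.

Lemma nice_intg n : intg D (fun t => `|z n t|).
Proof.
apply: (intg_le mD) ig _; first exact: nice_norm_measurableD.
by move=> t _; rewrite normr_id.
Qed.

Lemma bint_approx_dist n k :
  `|bint D (z n) - bint D (approx n k)| <= \int[leb]_(t in D) phi k t.
Proof.
have ss := approx_simple n k.
have ia : intg D (fun t => `|approx n k t|) by exact: simple_intg_norm.
have ni := nice_intg n; have na := simple_nice ss.
have iB : intg D (fun t => `|z n t - approx n k t|).
  apply: (intg_le mD) (nearest_error_intg k) _.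
    by apply: nice_norm_measurableD; exact: niceB.
  by move=> t _; rewrite normr_id approx_dist.
rewrite -bintB//; apply: le_trans (bint_norm mD fD _ iB) _; first exact: niceB.
apply: le_Rintegral => //; first exact: nearest_error_intg.
by move=> t _; exact: approx_dist.
Qed.

End nearest_error.

(** For one large [k] the integrals of all the approximations lie in the same totally bounded
    zonotope, at distance at most the integral of the uniform error. The slack [r - 2 \int rho] is
    shared equally between the net of the zonotope and this error. *)
Lemma bint_cov {R : realType} {E : completeNormedModType R} (D : set R)
    (z : nat -> R -> E) (g rho : R -> R) :
  measurable D -> (leb D < +oo)%E ->
  (forall n, nice (z n)) -> (forall n t, `|z n t| <= g t) -> intg D g -> intg D rho ->
  {ae @lebesgue_measure R, forall t, D t -> forall r, rho t < r -> cov (range (z ^~ t)) r} ->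
  forall r, 2 * \int[leb]_(t in D) rho t < r ->
    cov (range (fun n => bint D (z n))) r.
Proof.
move=> mD fD nz zg ig irho hrho r rr.
have [d [d0 dz]] := nice_dense nz.
pose e := (r - 2 * \int[leb]_(t in D) rho t) / 2.
have e0 : 0 < e by rewrite divr_gt0// subr_gt0.
have [k _ /(_ k (leqnn k)) Hk] := nearest_error_integral mD nz zg ig d0 dz irho hrho e0.
have -> : r = e + (2 * \int[leb]_(t in D) rho t + e) by rewrite /e; field.
apply: cov_near (cov_zonotope k.+1 d (fine (leb D)) e0) _ => _ [n _ <-].
exists (bint D (fun t => d (nearest (z n) d k t))).
  exact: (bint_approx mD fD nz).
by apply: le_trans Hk; exact: (bint_approx_dist mD fD nz zg ig d0).
Qed.

(** * Convergence of convex combinations *)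

Section hilbert.
Context {R : realType} (V : lmodType R).

Definition cvx_hull (A : set V) : set V := [set x | forall C, cvx C -> A `<=` C -> C x].

Lemma cvx_cvx_hull A : cvx (cvx_hull A).
Proof. by move=> a x y a0 a1 Ax Ay C cC sAC; apply: (cC) => //; [exact: (Ax C cC sAC)|exact: (Ay C cC sAC)]. Qed.

Lemma sub_cvx_hull A : A `<=` cvx_hull A.
Proof. by move=> x Ax C _; apply. Qed.

Lemma cvx_hull_sub A C : cvx C -> A `<=` C -> cvx_hull A `<=` C.
Proof. by move=> cC sAC x Ax; exact: (Ax C cC sAC). Qed.

(* A sequence that nearly minimizes a countable family of bounded quadratic
   functionals over decreasing convex sets is a Cauchy sequence for each of
   them, by the parallelogram law. *)
Lemma near_minimizers (A : nat -> set V) (Q : nat -> V -> R) (B : R) :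
  (forall n, A n !=set0) -> (forall n, A n.+1 `<=` A n) -> (forall n, cvx (A n)) ->
  (forall j x, 0 <= Q j x) -> (forall j x, A 0%N x -> Q j x <= B) ->
  (forall j x y, A 0%N x -> A 0%N y -> Q j (2^-1 *: (x - y)) +
    Q j (2^-1 *: x + (1 - 2^-1) *: y) <= 2^-1 * Q j x + 2^-1 * Q j y) ->
  exists v : nat -> V, (forall n, A n (v n)) /\
    forall j e, 0 < e -> exists N, forall n m, (N <= n)%N -> (n <= m)%N ->
      Q j (2^-1 *: (v n - v m)) <= e.
Proof.
move=> A0 Adecr cA Q0 QB QP.
have Asub n m : (n <= m)%N -> A m `<=` A n.
  elim: m => [|m IH]; first by rewrite leqn0 => /eqP ->.
  by rewrite leq_eqVlt => /predU1P[->//|/IH]; apply: subset_trans.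
(* With these weights all partial sums of the functionals stay below [B], and their supremum [S]
   satisfies the same midpoint inequality. *)
pose w j : R := 2^-1 ^+ j.+1.
have w0 j : 0 < w j by rewrite exprn_gt0// invr_gt0.
have sumw N : \sum_(j < N) w j = 1 - 2^-1 ^+ N.
  elim: N => [|N IH]; first by rewrite big_ord0 expr0 subrr.
  by rewrite big_ord_recr/= IH /w exprS; field.
pose P N x := \sum_(j < N) w j * Q j x.
have P0 N x : 0 <= P N x by apply: sumr_ge0 => j _; rewrite mulr_ge0// ltW.
have [x0 Ax0] := A0 0%N.
have B0 : 0 <= B := le_trans (Q0 0%N x0) (QB 0%N _ Ax0).
have PB N x : A 0%N x -> P N x <= B.
  move=> Ax; apply: (@le_trans _ _ (\sum_(j < N) w j * B)).
    by apply: ler_sum => j _; rewrite ler_pM2l// QB.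
  rewrite -mulr_suml sumw ler_piMl// gerBl exprn_ge0// invr_ge0//.
have Pmono N M x : (N <= M)%N -> P N x <= P M x.
  move=> NM; rewrite -(subnKC NM); elim: (M - N)%N => [|i IH]; first by rewrite addn0.
  by rewrite addnS /P big_ord_recr/= (le_trans IH)// lerDl mulr_ge0// ltW.
have PP N x y : A 0%N x -> A 0%N y -> P N (2^-1 *: (x - y)) +
    P N (2^-1 *: x + (1 - 2^-1) *: y) <= 2^-1 * P N x + 2^-1 * P N y.
  move=> Ax Ay; rewrite /P -big_split/= !mulr_sumr -big_split/=.
  apply: ler_sum => j _; rewrite -mulrDr.
  by have := ler_wpM2l (ltW (w0 j)) (QP j x y Ax Ay); rewrite mulrDr; lra.
pose S x := sup (range (P ^~ x)).
have PS N x : A 0%N x -> P N x <= S x.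
  by move=> Ax; apply: ub_le_sup; [exists B => _ [M _ <-]; exact: PB|exists N].
have SP x M : (forall N, P N x <= M) -> S x <= M.
  by move=> PM; apply: ge_sup; [exists (P 0%N x), 0%N|move=> _ [N _ <-]].
have midA n x y : A n x -> A n y -> A n (2^-1 *: x + (1 - 2^-1) *: y).
  by move=> Ax Ay; apply: cA => //; rewrite ?invr_ge0 ?invf_le1 ?ler1n.
have SPP N x y : A 0%N x -> A 0%N y ->
    P N (2^-1 *: (x - y)) + S (2^-1 *: x + (1 - 2^-1) *: y) <= 2^-1 * S x + 2^-1 * S y.
  move=> Ax Ay; rewrite -lerBrDl; apply: SP => M.
  have := PP (maxn N M) x y Ax Ay.
  have := Pmono N (maxn N M) (2^-1 *: (x - y)) (leq_maxl _ _).
  have := Pmono M (maxn N M) (2^-1 *: x + (1 - 2^-1) *: y) (leq_maxr _ _).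
  by have := PS (maxn N M) x Ax; have := PS (maxn N M) y Ay; lra.
(* The infima increase, because the sets shrink, and stay below [B]. The midpoint of [v n] and [v m]
   lies in [A n], where [S >= s n]; so the defect in the parallelogram law is controlled by
   [s m - s n] and by the precision [1 / (n + 1)] of the choice of [v n]. *)
pose s n := inf (S @` A n).
have hinf n : has_inf (S @` A n).
  split; first by have [x Ax] := A0 n; exists (S x), x.
  exists 0 => _ [x Ax <-]; apply: le_trans (P0 0%N x) (PS _ _ _).
  exact: Asub Ax.
have sS n x : A n x -> s n <= S x by move=> Ax; apply: ge_inf; [exact: (hinf n).2|exists x].
have smono n m : (n <= m)%N -> s n <= s m.
  move=> nm; apply: lb_le_inf; first exact: (hinf m).1.
  by move=> _ [x Ax <-]; apply: sS; exact: Asub Ax.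
have sB n : s n <= B.
  have [x Ax] := A0 n; apply: le_trans (sS n x Ax) (SP _ _ _) => N.
  by apply: PB; exact: Asub Ax.
have /choice[v vP] n : exists v, A n v /\ S v < s n + n.+1%:R^-1.
  have n0 : 0 < n.+1%:R^-1 :> R by rewrite invr_gt0.
  have [_ [v Av <-] Sv] := inf_adherent n0 (hinf n).
  by exists v.
exists v; split => [n|j e e0]; first by have [] := vP n.
pose e' := w j * e.
have e'0 : 0 < e' by rewrite mulr_gt0.
have hs : has_sup (range s) by split; [exists (s 0%N), 0%N|exists B => _ [n _ <-]].
have [_ [N1 _ <-] sN1] := sup_adherent e'0 hs.
have [N2 N2e] : exists N2, forall n, (N2 <= n)%N -> n.+1%:R^-1 < e' / 2.
  have e'2 : 0 < e' / 2 by rewrite divr_gt0.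
  have [N2 _ HN2] := near_infty_natSinv_lt (PosNum e'2); exists N2 => n N2n.
  by have := HN2 n N2n.
exists (maxn N1 N2) => n m; rewrite geq_max => /andP[N1n N2n] nm.
have [Avn Svn] := vP n; have [Avm Svm] := vP m.
rewrite -(ler_pM2l (w0 j)) -/e'.
apply: (@le_trans _ _ (P j.+1 (2^-1 *: (v n - v m)))).
  by rewrite /P big_ord_recr/= lerDr; exact: P0.
have Avm' : A n (v m) by exact: Asub Avm.
have H1 := SPP j.+1 _ _ (Asub _ _ (leq0n n) _ Avn) (Asub _ _ (leq0n m) _ Avm).
have H2 := sS n _ (midA n _ _ Avn Avm').
have H3 : s m <= sup (range s) by apply: ub_le_sup; [exact: hs.2|exists m].
have H4 := smono _ _ N1n.
have H5 := N2e n N2n; have H6 := N2e m (leq_trans N2n nm).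
move: H1 H2 H3 H4 H5 H6 Svn Svm sN1.
move: (S _) (P _ _) (sup _) (s n) (s m) (s N1) (S _) (S _) (n.+1%:R^-1) (m.+1%:R^-1) => *.
clearbody e'; lra.
Qed.

End hilbert.

Lemma fst_comb {R : realType} {V W : lmodType R} (a b : R) (x y : V * W) :
  (a *: x + b *: y).1 = a *: x.1 + b *: y.1.
Proof. by []. Qed.

Lemma snd_comb {R : realType} {V W : lmodType R} (a b : R) (x y : V * W) :
  (a *: x + b *: y).2 = a *: x.2 + b *: y.2.
Proof. by []. Qed.

Lemma fct_comb {R : realType} {I : Type} {W : lmodType R} (a b : R) (f g : I -> W) i :
  (a *: f + b *: g) i = a *: f i + b *: g i.
Proof. by []. Qed.

Section convex_compactness.
Context {R : realType} {E : completeNormedModType R} (D : set R).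
Hypotheses (mD : measurable D) (fD : (leb D < +oo)%E).
Variables (z : nat -> R -> E) (g : R -> R).
Hypotheses (nz : forall n, nice (z n)) (zg : forall n t, `|z n t| <= g t)
  (ig : intg D g).
Hypothesis tz : {ae @lebesgue_measure R, forall t, D t ->
  forall r, 0 < r -> cov (range (z ^~ t)) r}.

Let V : lmodType R := ((R -> E) * (nat -> nat -> R -> R^o))%type.

(** Pointwise [e |f| <= e^2 + f^2]. This inequality passes from L^2 to L^1 in place of the
    Cauchy-Schwarz inequality. *)
Lemma rint_sqr_le (f : R -> R) (e : R) : measurable_fun D f ->
  (forall t, `|f t| <= 1) -> 0 < e ->
  \int[leb]_(t in D) `|f t| <= e * fine (leb D) + e^-1 * \int[leb]_(t in D) (f t ^+ 2).
Proof.
move=> mf f1 e0.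
have i1 : intg D (fun t => f t ^+ 2).
  apply: (intg_le mD) (intg_cst mD fD 1) _; first exact: measurable_funX.
  by move=> t _; rewrite normrX expr_le1.
have i2 : intg D (fun t => `|f t|).
  apply: (intg_le mD) (intg_cst mD fD 1) _; first exact: measurableT_comp.
  by move=> t _; rewrite normr_id.
rewrite -Rintegral_cst// -RintegralZl// -RintegralD//; last exact: intgZ; last exact: intg_cst.
apply: le_Rintegral => //; first by apply: intgD; [|exact: intg_cst|exact: intgZ].
move=> t _; rewrite -(ler_pM2l e0) mulrDr mulrA mulfV ?gt_eqF// mul1r -(real_normK (num_real (f t))).
by have := sqr_ge0 (e - `|f t|); have := mulr_ge0 (ltW e0) (normr_ge0 (f t)); rewrite !expr2; lra.
Qed.

(** Up to the uniform error, [z m] is a combination of fixed vectors [d i] whose coefficients are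
    indicators of cells. Convex combinations are chosen so that these bounded scalar coefficients
    are Cauchy in L^2 for every [k]; total boundedness makes the error small in L^1, and the
    functions themselves become Cauchy in L^1. *)
Lemma L1_cauchy_convex_tails : exists v : nat -> R -> E,
  (forall n, [/\ nice (v n), forall t, `|v n t| <= g t &
     cvx_hull (V := R -> E) [set z m | m in [set m | (n <= m)%N]] (v n)]) /\
  forall e, 0 < e -> exists N, forall n m, (N <= n)%N -> (n <= m)%N ->
    \int[leb]_(t in D) `|v n t - v m t| <= e.
Proof.
have [d [d0 dz]] := nice_dense nz.
pose phi := nearest_error z d.
pose M := fine (leb D).
have M0 : 0 <= M by rewrite fine_ge0.
pose cell n k i := [set t | nearest (z n) d k t = i].
have mcell n k i : measurable (cell n k i) by exact: (cell_measurable nz).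
(* A function is paired with its coefficients, so that one convex combination acts on both; [G]
   collects the convex constraints shared by the pairs. *)
pose U m : V := (z m, fun k i t => \1_(cell m k i) t : R^o).
pose G : set V := [set x : (R -> E) * (nat -> nat -> R -> R) | [/\ nice x.1, (forall t, `|x.1 t| <= g t),
  (forall k i, measurable_fun setT (x.2 k i : R -> R)),
  (forall k i t, 0 <= x.2 k i t <= (1 : R)) &
  forall k t, `|x.1 t - \sum_(i < k.+1) x.2 k i t *: d i| <= phi k t]].
have comb1 (a b : R) (x y : V) t : (a *: x + b *: y).1 t = a *: x.1 t + b *: y.1 t.
  by rewrite fst_comb fct_comb.
have comb2 (a b : R) (x y : V) k i t :
    (a *: x + b *: y).2 k i t = a * x.2 k i t + b * y.2 k i t.
  by rewrite snd_comb !fct_comb.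
have cG : cvx G.
  move=> a x y a0 a1 [nx xg mx x01 xphi] [ny yg my y01 yphi].
  have a1' : 0 <= 1 - a by rewrite subr_ge0.
  have splita (c : R) : c = a * c + (1 - a) * c by ring.
  have normle (p q : E) c : `|p| <= c -> `|q| <= c -> `|a *: p + (1 - a) *: q| <= c.
    move=> pc qc; rewrite (le_trans (ler_normD _ _))// !normrZ !ger0_norm//.
    by rewrite [leRHS]splita; apply: lerD; exact: ler_wpM2l.
  split => [|t|k i|k i t|k t].
  - have -> : (a *: x + (1 - a) *: y).1 = fun t => a *: x.1 t + (1 - a) *: y.1 t.
      by apply/funext => t; rewrite comb1.
    by apply: niceD; exact: niceZ.
  - by rewrite comb1; exact: normle.
  - have -> : (a *: x + (1 - a) *: y).2 k i = fun t => a * x.2 k i t + (1 - a) * y.2 k i t.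
      by apply/funext => t; rewrite comb2.
    by apply: measurable_funD; apply: measurable_funM.
  - rewrite comb2; have /andP[x0 x1] := x01 k i t; have /andP[y0 y1] := y01 k i t.
    apply/andP; split; first by apply: addr_ge0; exact: mulr_ge0.
    by rewrite [leRHS]splita; apply: lerD; exact: ler_wpM2l.
  - rewrite comb1; under eq_bigr do rewrite comb2.
    rewrite (_ : _ - _ = a *: (x.1 t - \sum_(i < k.+1) x.2 k i t *: d i) +
       (1 - a) *: (y.1 t - \sum_(i < k.+1) y.2 k i t *: d i)); first exact: normle.
    rewrite !scalerBr !scaler_sumr addrACA -opprD -big_split/=; congr (_ - _).
    by apply: eq_bigr => i _; rewrite !scalerA -scalerDl.
have UG m : G (U m).
  split => //=.
  - by move=> k i; exact: measurable_indic.
  - by move=> k i t; rewrite indicE ler0n lern1 leq_b1.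
  - move=> k t; rewrite -(approxE z d m k t).
    exact: (approx_dist zg d0).
pose A n := cvx_hull (U @` [set m | (n <= m)%N]).
have AG n : A n `<=` G by apply: cvx_hull_sub => // _ [m _ <-].
(* The mean of the squared L^2 norms of the [k + 1] coefficients of level [k]; taking the mean gives
   the bound [M] for every [k]. *)
pose Q k (x : (R -> E) * (nat -> nat -> R -> R)) : R :=
  k.+1%:R^-1 * \sum_(i < k.+1) \int[leb]_(t in D) (x.2 k i t ^+ 2).
have QE k (u : V) (f : nat -> R -> R) : (forall i t, u.2 k i t = f i t) ->
    Q k u = k.+1%:R^-1 * \sum_(i < k.+1) \int[leb]_(t in D) (f i t ^+ 2).
  move=> uf; congr (_ * _); apply: eq_bigr => i _; apply: eq_Rintegral => t _.
  by rewrite uf.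
have Gi x k i : G x -> intg D (fun t => x.2 k i t ^+ 2).
  case=> _ _ mx x01 _; apply: (intg_le mD) (intg_cst mD fD 1) _.
    by apply: measurable_funX; exact: measurable_funS (mx k i).
  move=> t _; have /andP[x0 x1] := x01 k i t.
  by rewrite normrX expr_le1// ger0_norm.
have Gd1 x y k i t : G x -> G y -> `|2^-1 * (x.2 k i t - y.2 k i t)| <= 1 :> R.
  case=> _ _ _ /(_ k i t)/andP[x0 x1] _ [_ _ _ /(_ k i t)/andP[y0 y1] _].
  by rewrite ler_norml; apply/andP; split; lra.
have Gdm x y k i : G x -> G y -> measurable_fun D (fun t => 2^-1 * (x.2 k i t - y.2 k i t) : R).
  move=> [_ _ mx _ _] [_ _ my _ _]; apply: measurable_funM => //.
  by apply: measurable_funB; [exact: measurable_funS (mx k i)|exact: measurable_funS (my k i)].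
have Gdi x y k i : G x -> G y -> intg D (fun t => (2^-1 * (x.2 k i t - y.2 k i t)) ^+ 2).
  move=> Gx Gy; apply: (intg_le mD) (intg_cst mD fD 1) _.
    by apply: measurable_funX; exact: Gdm.
  by move=> t _; rewrite normrX expr_le1// Gd1.
have [|||||k x y Ax Ay|v [Av vQ]] := @near_minimizers R V A Q M.
- by move=> n; exists (U n); apply: sub_cvx_hull; exists n => /=.
- move=> n; apply: cvx_hull_sub; first exact: cvx_cvx_hull.
  by move=> _ [m /= nm <-]; apply: sub_cvx_hull; exists m => //=; exact: ltnW.
- by move=> n; exact: cvx_cvx_hull.
- move=> k x; rewrite mulr_ge0 ?invr_ge0// sumr_ge0// => i _.
  by apply: Rintegral_ge0 => t _; exact: sqr_ge0.
- move=> k x /AG Gx; rewrite /Q mulrC ler_pdivrMr//.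
  rewrite (_ : M * _ = \sum_(i < k.+1) M); last first.
    by rewrite sumr_const card_ord mulr_natr.
  apply: ler_sum => i _; rewrite -[M]mul1r -Rintegral_cst//.
  apply: le_Rintegral => //; [exact: Gi|exact: intg_cst|move=> t _].
  by have [_ _ _ /(_ k i t)/andP[x0 x1] _] := Gx; rewrite expr_le1.
- have Gx := AG _ _ Ax; have Gy := AG _ _ Ay.
  have Gm : G (2^-1 *: x + (1 - 2^-1) *: y).
    by apply: cG => //; rewrite ?invr_ge0 ?invf_le1 ?ler1n.
  rewrite (QE k (2^-1 *: (x - y)) (fun i t => 2^-1 * (x.2 k i t - y.2 k i t))); last first.
    by move=> i t; rewrite scalerBr -scaleNr comb2 mulNr mulrBr.
  have k0 : 0 <= k.+1%:R^-1 :> R by rewrite invr_ge0.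
  rewrite /Q -mulrDr (mulrCA 2^-1) (mulrCA 2^-1) -mulrDr; apply: ler_wpM2l => //.
  have H (i : nat) : \int[leb]_(t in D) ((2^-1 * (x.2 k i t - y.2 k i t)) ^+ 2) +
      \int[leb]_(t in D) ((2^-1 *: x + (1 - 2^-1) *: y).2 k i t ^+ 2) <=
      2^-1 * \int[leb]_(t in D) (x.2 k i t ^+ 2) +
      2^-1 * \int[leb]_(t in D) (y.2 k i t ^+ 2); last first.
    by rewrite !mulr_sumr -!big_split; apply: ler_sum => i _; exact: H.
  have iX := Gi x k i Gx; have iY := Gi y k i Gy.
  have iM := Gi _ k i Gm; have iXY := Gdi x y k i Gx Gy.
  rewrite -(rintZ mD 2^-1 iX) -(rintZ mD 2^-1 iY).
  rewrite -(rintD mD iXY iM) -(rintD mD (intgZ mD _ iX) (intgZ mD _ iY)).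
  apply: (le_rint mD (intgD mD iXY iM) (intgD mD (intgZ mD 2^-1 iX) (intgZ mD 2^-1 iY))).
  move=> t _; rewrite comb2 !expr2; lra.
exists (fun n => (v n).1); split => [n|e e0].
  have [nv vg _ _ _] := AG _ _ (Av n); split => //.
  have : A n `<=` [set x : V | cvx_hull (V := R -> E) [set z m | m in [set m | (n <= m)%N]] x.1].
    apply: cvx_hull_sub => [a x y a0 a1 Hx Hy|_ [m nm <-]].
      exact: (cvx_cvx_hull a0 a1 Hx Hy).
    by apply: sub_cvx_hull; exists m.
  exact.
have phie : exists k, \int[leb]_(t in D) phi k t <= e / 4.
  have e4 : 0 < e / 4 by rewrite divr_gt0.
  have [|k _ /(_ k (leqnn k))] := nearest_error_integral mD nz zg ig d0 dz (intg_cst mD fD 0) _ e4.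
    by move: tz; apply: ae_mono => t.
  by rewrite Rintegral_cst// mul0r mulr0 add0r => H; exists k.
have [k phik] := phie.
pose S := \sum_(i < k.+1) `|d i| + 1.
have S0 : 0 < S by rewrite ltr_wpDl// sumr_ge0.
pose K : R := k.+1%:R.
have K0 : 0 < K by rewrite ltr0n.
have M1 : 0 < M + 1 by rewrite ltr_wpDl.
(* The total error is [2 \int phi k + 2 S (c M + delta K / c)]. The first term is at most [e / 2];
   [c] and then [delta] make each of the two others at most [e / 4]. *)
pose c := e / (8 * S * (M + 1)).
have c0 : 0 < c by rewrite divr_gt0// !mulr_gt0.
pose delta := c * e / (8 * S * K).
have S80 : 0 < 8 * S by rewrite mulr_gt0.
have delta0 : 0 < delta := divr_gt0 (mulr_gt0 c0 e0) (mulr_gt0 S80 K0).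
have [N HN] := vQ k delta delta0.
exists N => n m Nn nm; have {HN} := HN n m Nn nm.
have Gn := AG _ _ (Av n); have Gm := AG _ _ (Av m).
set x := v n in Gn *; set y := v m in Gm *.
pose q i t := 2^-1 * (x.2 k i t - y.2 k i t).
have iq i : intg D (fun t => q i t ^+ 2) by exact: Gdi.
have iqn i : intg D (fun t => `|q i t|).
  apply: (intg_le mD) (intg_cst mD fD 1) _; first by apply: measurableT_comp => //; exact: Gdm.
  by move=> t _; rewrite normr_id; exact: Gd1.
rewrite (QE k (2^-1 *: (x - y)) q); last first.
  by move=> i t; rewrite scalerBr -scaleNr comb2 mulNr -mulrBr.
rewrite mulrC ler_pdivrMr// => Hq.
have qi i : (i < k.+1)%N -> \int[leb]_(t in D) `|q i t| <= c * M + c^-1 * (delta * K).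
  move=> ik; apply: le_trans (rint_sqr_le (Gdm _ _ k i Gn Gm) _ c0) _.
    by move=> t; exact: Gd1.
  rewrite lerD2l ler_pM2l ?invr_gt0//; apply: le_trans Hq.
  rewrite (bigD1 (Ordinal ik))//= lerDl sumr_ge0// => j _.
  by apply: Rintegral_ge0 => t _; exact: sqr_ge0.
have [nx xg mx x01 xphi] := Gn; have [ny yg my y01 yphi] := Gm.
have isum : intg D (fun t => \sum_(i < k.+1) (2 * `|d i|) * `|q i t|).
  by apply: (rint_sum mD fD _ _).1 => i; exact: intgZ.
have iphi : intg D (fun t => 2 * phi k t).
  by apply: intgZ => //; exact: nearest_error_intg.
apply: (@le_trans _ _ (\int[leb]_(t in D) (2 * phi k t + \sum_(i < k.+1) (2 * `|d i|) * `|q i t|))).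
  apply: le_rint => //; [|exact: intgD|].
    apply: (intg_le mD) (intgD mD ig ig) _.
      by apply: nice_norm_measurableD; exact: niceB.
    by move=> t _; rewrite normr_id (le_trans (ler_normB _ _))// lerD.
  move=> t _.
  pose sx := \sum_(i < k.+1) x.2 k i t *: d i; pose sy := \sum_(i < k.+1) y.2 k i t *: d i.
  have -> : x.1 t - y.1 t = (x.1 t - sx) + (sy - y.1 t) + (sx - sy).
    by rewrite addrAC !subrKA.
  rewrite (le_trans (ler_normD _ _))//; apply: lerD.
    rewrite (le_trans (ler_normD _ _))// mulrDl mul1r; apply: lerD; first exact: xphi.
    by rewrite distrC; exact: yphi.
  rewrite /sx /sy -sumrB (le_trans (ler_norm_sum _ _ _))//; apply: ler_sum => i _.
  rewrite -scalerBl normrZ mulrAC ler_wpM2r//.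
  have -> : `|q i t| = 2^-1 * `|x.2 k i t - y.2 k i t| by rewrite normrM gtr0_norm ?invr_gt0.
  by rewrite mulrA mulfV ?mul1r ?pnatr_eq0.
rewrite rintD// rintZ//; last exact: nearest_error_intg.
rewrite (rint_sum mD fD _ _).2; last by move=> i; exact: intgZ.
have H2 : \sum_(i < k.+1) \int[leb]_(t in D) (2 * `|d i| * `|q i t|) <=
    2 * S * (c * M + c^-1 * (delta * K)).
  apply: (@le_trans _ _ (\sum_(i < k.+1) 2 * `|d i| * (c * M + c^-1 * (delta * K)))).
    apply: ler_sum => i _; rewrite rintZ// ler_wpM2l ?mulr_ge0//; exact: qi.
  rewrite -mulr_suml -mulr_sumr ler_wpM2r//.
    apply: addr_ge0; first exact: mulr_ge0 (ltW c0) M0.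
    by apply: mulr_ge0 (mulr_ge0 (ltW delta0) (ltW K0)); rewrite invr_ge0 (ltW c0).
  by rewrite ler_pM2l// /S lerDl.
have H3 : 2 * S * (c * M) <= e / 4.
  rewrite (_ : e / 4 = 2 * S * (c * (M + 1))); last by rewrite /c; field; rewrite !gt_eqF.
  by rewrite ler_pM2l ?mulr_gt0// ler_pM2l// lerDl.
have H4 : 2 * S * (c^-1 * (delta * K)) = e / 4.
  by rewrite /delta; field; rewrite !gt_eqF.
by move: H2; rewrite mulrDr H4; move: phik H3; lra.
Qed.

End convex_compactness.

Section L1_cauchy_subsequence.
Context {R : realType} {E : completeNormedModType R} (D : set R).
Hypotheses (mD : measurable D) (fD : (leb D < +oo)%E).

(** The sum of the norms of the increments has integral at most 1, hence is finite a.e., and the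
    telescoping series converges absolutely. *)
Lemma ae_cvg_summable (u : nat -> R -> E) :
  (forall n, nice (u n)) ->
  (forall n, intg D (fun t => `|u n.+1 t - u n t|)) ->
  (forall n, \int[leb]_(t in D) `|u n.+1 t - u n t| <= 2^-1 ^+ n.+1) ->
  {ae @lebesgue_measure R, forall t, D t -> cvg (u n t @[n --> \oo])}.
Proof.
move=> nu iu ue.
pose h n t := (`|u n.+1 t - u n t|)%:E : \bar R.
have mh n : measurable_fun D (h n).
  by apply/measurable_EFinP; apply: nice_norm_measurableD; exact: niceB.
have h0 n t : (0 <= h n t)%E by rewrite lee_fin.
have hfin : ((\int[leb]_(t in D) \sum_(n <oo) h n t) <= 1)%E.
  rewrite integral_nneseries//; apply: lime_le.
    by apply: is_cvg_nneseries => n _ _; exact: integral_ge0.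
  apply: nearW => n.
  rewrite (eq_bigr (fun i => (\int[leb]_(t in D) `|u i.+1 t - u i t|)%:E)); last first.
    by move=> i _; rewrite /h rint_EFin.
  rewrite sumEFin lee_fin.
  apply: (@le_trans _ _ (1 - 2^-1 ^+ n)).
    elim: n => [|n IH]; first by rewrite big_nil expr0 subrr.
    rewrite big_nat_recr//= (le_trans (lerD IH (ue n)))//.
    by rewrite exprS; lra.
  by rewrite gerBl exprn_ge0// invr_ge0.
have ih : leb.-integrable D (fun t => \sum_(n <oo) h n t)%E.
  apply/integrableP; split; first by apply: (@ge0_emeasurable_sum _ _ _ D h xpredT).
  have -> : (\int[leb]_(t in D) `|\sum_(n <oo) h n t| = \int[leb]_(t in D) \sum_(n <oo) h n t)%E.
    by apply: eq_integral => t _; rewrite gee0_abs//; apply: nneseries_ge0 => n _ _; exact: h0.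
  exact: le_lt_trans hfin (ltry _).
have := @integrable_ae _ _ _ (@lebesgue_measure R) D mD _ ih; apply: ae_mono => t /[apply] ft.
have cn : cvg ([normed series (fun n => u n.+1 t - u n t)] n @[n --> \oo]).
  apply/cvg_ex; exists (fine (\sum_(n <oo) h n t)%E).
  have : \sum_(0 <= i < n) h i t @[n --> \oo] --> (\sum_(n <oo) h n t)%E.
    by apply: is_cvg_nneseries => n _ _; exact: h0.
  rewrite -{1}(fineK ft) => /fine_cvg; apply: cvg_trans; apply: near_eq_cvg.
  by apply: nearW => n /=; rewrite sumEFin.
have /cvg_ex[l ul] := normed_cvg cn.
apply/cvg_ex; exists (u 0%N t + l).
have -> : (fun n => u n t) = (fun n => u 0%N t + series (fun n => u n.+1 t - u n t) n).
  by apply/funext => n; rewrite /series/= telescope_sumr// addrC subrK.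
by apply: cvgD => //; exact: cvg_cst.
Qed.

Lemma nice_ae_lim (u : nat -> R -> E) : (forall n, nice (u n)) ->
  {ae @lebesgue_measure R, forall t, D t -> cvg (u n t @[n --> \oo])} ->
  exists2 w, nice w & {ae @lebesgue_measure R, forall t, D t -> u n t @[n --> \oo] --> w t}.
Proof.
move=> nu [N [mN N0 NP]]; have mA : measurable (D `\` N) by exact: measurableD.
pose u' n t := if t \in D `\` N then u n t else 0.
have cu' t : cvg (u' n t @[n --> \oo]).
  have [tA|tA] := boolP (t \in D `\` N); rewrite /u' ?tA ?(negbTE tA); last exact: is_cvg_cst.
  have [Dt Nt] := set_mem tA.
  by apply: contrapT => H; apply: Nt; apply: NP => /(_ Dt).
exists (fun t => lim (u' n t @[n --> \oo])).
  apply: (nice_lim (f_ := u')) => // n; apply: nice_if => //; exact: nice_cst.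
exists N; split => // t /= H; apply: contrapT => Nt; apply: H => Dt.
have := cu' t; rewrite /u'.
have -> : t \in D `\` N by rewrite mem_set.
by [].
Qed.

Lemma L1_cauchy_ae (v : nat -> R -> E) (g : R -> R) : (forall n, nice (v n)) ->
  intg D g -> (forall n t, `|v n t| <= g t) ->
  (forall e, 0 < e -> exists N, forall n m, (N <= n)%N -> (n <= m)%N ->
    \int[leb]_(t in D) `|v n t - v m t| <= e) ->
  exists (phi : nat -> nat) (w : R -> E), [/\ forall n, (n <= phi n)%N, nice w &
    {ae @lebesgue_measure R, forall t, D t -> v (phi n) t @[n --> \oo] --> w t}].
Proof.
move=> nv ig vg vc.
have /choice[N HN] : forall i, exists N, forall n m, (N <= n)%N -> (n <= m)%N ->
    \int[leb]_(t in D) `|v n t - v m t| <= 2^-1 ^+ i.+1.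
  by move=> i; apply: vc; rewrite exprn_gt0// invr_gt0.
(* Cumulating the thresholds makes [phi] nondecreasing with [N i <= phi i]; the summand [i] gives
   [i <= phi i], so that tails remain tails. *)
pose phi i := (\sum_(j < i.+1) N j + i)%N.
have phiS i : (phi i <= phi i.+1)%N.
  by rewrite /phi [in leqRHS]big_ord_recr/= leq_add ?leq_addr.
have iv n m : intg D (fun t => `|v n t - v m t|).
  apply: (intg_le mD) (intgD mD ig ig) _.
    by apply: nice_norm_measurableD; exact: niceB.
  by move=> t _; rewrite normr_id (le_trans (ler_normB _ _))// lerD.
have [||w nw wP] := @nice_ae_lim (fun n => v (phi n)) _ _ => //.
  apply: ae_cvg_summable => // n.
  under eq_Rintegral do rewrite distrC.
  by apply: HN => //; rewrite /phi big_ord_recr/= -addnA addnCA leq_addr.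
by exists phi, w; split => // n; rewrite /phi leq_addl.
Qed.

End L1_cauchy_subsequence.

Lemma cvx_hull_subset {R : realType} (V : lmodType R) (A B : set V) : A `<=` B ->
  cvx_hull A `<=` cvx_hull B.
Proof. by move=> AB; apply: cvx_hull_sub; [exact: cvx_cvx_hull|move=> x /AB; exact: sub_cvx_hull]. Qed.

(* A substitute for weak compactness in L^1 followed by Mazur's lemma. *)
Lemma convex_compactness {R : realType} {E : completeNormedModType R} (D : set R)
    (z : nat -> R -> E) (g : R -> R) :
  measurable D -> (leb D < +oo)%E ->
  (forall n, nice (z n)) -> (forall n t, `|z n t| <= g t) -> intg D g ->
  {ae @lebesgue_measure R, forall t, D t -> forall r, 0 < r -> cov (range (z ^~ t)) r} ->
  exists (v : nat -> R -> E) (w : R -> E), [/\ nice w,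
    forall n, nice (v n) /\ cvx_hull (V := R -> E) [set z m | m in [set m | (n <= m)%N]] (v n),
    forall n t, `|v n t| <= g t &
    {ae @lebesgue_measure R, forall t, D t -> v n t @[n --> \oo] --> w t}].
Proof.
move=> mD fD nz zg ig tz.
have [v [vP vc]] := L1_cauchy_convex_tails mD fD nz zg ig tz.
have [||phi [w [phin nw wP]]] := @L1_cauchy_ae R E D mD v g _ ig _ vc.
- by move=> n; have [] := vP n.
- by move=> n; have [] := vP n.
exists (fun n => v (phi n)), w; split => // n; have [nv vg vh] := vP (phi n) => //.
split => //; apply: cvx_hull_subset vh => _ [m /= nm <-]; exists m => //=.
exact: leq_trans (phin n) nm.
Qed.

(** * Weights and integrability *)

Section domain_change.
Context {R : realType}.
Implicit Types (A D : set R) (f : R -> R).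

Lemma rint_sub A D f : A `<=` D -> (forall t, D t -> ~ A t -> f t = 0) ->
  \int[leb]_(t in A) f t = \int[leb]_(t in D) f t.
Proof.
move=> AD f0; rewrite Rintegral_mkcond [RHS]Rintegral_mkcond.
apply: eq_Rintegral => t _; rewrite !patchE.
have [/set_mem At|tA] := boolP (t \in A); first by rewrite mem_set//; exact: AD.
case: ifPn => // /set_mem Dt; rewrite f0// => At.
by move/negP : tA; apply; exact: mem_set.
Qed.

Lemma rint_subset_le A D f : measurable A -> measurable D -> A `<=` D -> intg D f ->
  (forall t, D t -> 0 <= f t) -> \int[leb]_(t in A) f t <= \int[leb]_(t in D) f t.
Proof.
move=> mA mD AD fi f0; rewrite /Rintegral fine_le//.
- apply: integrable_fin_num => //; exact: integrableS fi.
- exact: integrable_fin_num.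
- apply: ge0_subset_integral => //; first exact: (measurable_int (@lebesgue_measure R) fi).
Qed.

Lemma intg_sub A D f : measurable A -> measurable D -> A `<=` D -> intg D f -> intg A f.
Proof. by move=> mA mD AD; apply: integrableS. Qed.

Lemma leb_itv_lty (a b : R) : (leb `[a, b]%classic < +oo :> \bar R)%E.
Proof. by rewrite lebesgue_measure_itv/=; case: ifP => _; rewrite ?ltry ?lt0y. Qed.

Lemma bint_sub {E : completeNormedModType R} A D (f : R -> E) :
  measurable A -> measurable D -> (leb A < +oo)%E -> (leb D < +oo)%E -> A `<=` D ->
  nice f -> intg D (fun t => `|f t|) ->
  (forall t, D t -> ~ A t -> f t = 0) -> bint A f = bint D f.
Proof.
move=> mA mD fA fD AD nf fi f0; have fiA := intg_sub mA mD AD fi.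
apply: dual_ext => e; rewrite !bintP//.
by apply: rint_sub => // t Dt At; rewrite f0// dual0.
Qed.

End domain_change.

Section weight.
Context {R : realType} (T : R).
Local Notation I := `[0, T]%classic.
Let mI : measurable (I : set R) := measurable_itv _.
Let fI : (leb (I : set R) < +oo)%E := leb_itv_lty 0 T.

Lemma subset_itv0 (t : R) : t <= T -> `[0, t]%classic `<=` (I : set R).
Proof. by move=> tT s /=; rewrite !in_itv/= => /andP[-> /le_trans]; exact. Qed.

Lemma rint_expR (b t : R) : 0 < b -> 0 <= t ->
  b * \int[leb]_(s in `[0, t]) expR (b * s) <= expR (b * t).
Proof.
move=> b0; rewrite le_eqVlt => /predU1P[<-|t0].
  by rewrite set_itv1 Rintegral_set1 mulr0 expR_ge0.
have dF (s : R) : is_derive s (1 : R) (fun x => b^-1 * expR (b * x)) (expR (b * s)).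
  have d1 : is_derive s (1 : R) ( *%R b) b.
    have := @is_deriveZ _ _ _ (@id R) b s 1 1 (is_derive_id _ _).
    by rewrite /GRing.scale/= mulr1.
  have d2 : is_derive s (1 : R) (expR \o ( *%R b)) (expR (b * s) * b).
    exact: is_derive1_comp.
  have := @is_deriveZ _ _ _ (expR \o ( *%R b)) b^-1 s 1 _ d2.
  by rewrite /GRing.scale/= mulrCA mulVf ?mulr1// gt_eqF.
have cF : continuous (fun x => b^-1 * expR (b * x)).
  move=> x; apply: differentiable_continuous.
  by apply/derivable1_diffP; have [] := dF x.
have ce : continuous (fun x => expR (b * x)).
  move=> x; apply: (@continuous_comp _ _ _ (fun x => b * x) expR); last exact: continuous_expR.
  exact: mulrl_continuous.
rewrite /Rintegral (@continuous_FTC2 _ _ (fun x => b^-1 * expR (b * x)))//=.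
- by rewrite mulrBr !mulrA !mulfV ?gt_eqF// !mul1r mulr0 expR0 lerBlDr lerDl.
- exact: continuous_subspaceT.
- split.
  + by move=> x _; have [] := dF x.
  + by apply: cvg_at_right_filter; exact: cF.
  + by apply: cvg_at_left_filter; exact: cF.
- by move=> x _; rewrite derive1E; have := dF x => dFx; exact: derive_val.
Qed.

(* Weights replace Gronwall's inequality: if [u t <= \int_0^t g u] and
   [u <= m omega], then [u <= (m / 2) omega]. *)
Lemma weight_exists (g : R -> R) : measurable_fun setT g -> (forall t, 0 <= g t) ->
  intg I g -> exists omega : R -> R,
  [/\ continuous omega, forall t, 0 <= t -> 1 <= omega t, forall t, t <= T -> omega t <= omega T &
   forall t, 0 <= t <= T ->
     intg `[0, t] (fun s => g s * omega s) /\
     \int[leb]_(s in `[0, t]) (g s * omega s) <= omega t / 2].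
Proof.
move=> mg g0 ig.
pose h n s := Num.max (g s - n%:R) 0.
have mh n : measurable_fun I (h n).
  apply: measurable_maxr => //; apply: measurable_funB => //.
  exact: measurable_funS mg.
have hg n s : `|h n s| <= g s.
  rewrite ger0_norm; last by rewrite le_max lexx orbT.
  by rewrite ge_max g0 andbT gerBl.
have ih n : intg I (h n) by apply: (intg_le mI (mh n) ig) => t _; exact: hg.
have cv : (\int[leb]_(s in I) h n s) @[n --> \oo] --> (0 : R).
  apply: (rint_dct0 mI mh ig); last by apply: aeW => t _ n; exact: hg.
  apply: aeW => s _; apply: cvg_near_cst.
  near=> n; rewrite /h; apply/max_idPr; rewrite subr_le0.
  by near: n; exact: nbhs_infty_ger.
have /cvgrPdist_lt/(_ (4^-1))[] := cv; first by rewrite invr_gt0.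
move=> n _ /(_ n (leqnn n))/=; rewrite sub0r normrN => /(le_lt_trans (ler_norm _)) hn.
(* [g] is at most [n + 1] plus the tail [h n], whose integral is below [1 / 4]. Integrating the
   exponential, the constant part contributes at most [omega t / 4] for this rate; the tail
   contributes at most [omega t / 4] because [omega] increases. *)
pose b : R := 4 * n.+1%:R.
have b0 : 0 < b by rewrite mulr_gt0.
pose omega s := expR (b * s).
have om_mono s t : s <= t -> omega s <= omega t.
  by move=> st; rewrite ler_expR ler_pM2l.
have com : continuous omega.
  move=> x; apply: (@continuous_comp _ _ _ (fun x => b * x) expR); last exact: continuous_expR.
  exact: mulrl_continuous.
exists omega; split => // [t t0|t tT|t /andP[t0 tT]].
- by rewrite -expR0 ler_expR mulr_ge0// ltW.
- exact: om_mono.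
have mt : measurable (`[0, t]%classic : set R) by [].
have tI := subset_itv0 tT.
have ft := leb_itv_lty 0 t.
have mom D : measurable_fun D omega.
  by apply: measurable_funS (continuous_measurable_fun com).
have igt := intg_sub mt mI tI ig.
have iht := intg_sub mt mI tI (ih n).
have i1 : intg `[0, t] (fun s => g s * omega s).
  apply: (intg_le mt) (intgZ mt (omega t) igt) _.
    by apply: measurable_funM => //; exact: measurable_funS mg.
  move=> s /=; rewrite in_itv/= => /andP[s0 st].
  by rewrite ger0_norm ?mulr_ge0 ?expR_ge0// mulrC ler_wpM2r// om_mono.
have i2 : intg `[0, t] omega.
  apply: (intg_le mt (mom _)) (intg_cst mt ft (omega t)) _.
  move=> s /=; rewrite in_itv/= => /andP[s0 st].
  by rewrite ger0_norm ?expR_ge0// om_mono.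
split => //.
apply: (@le_trans _ _ (\int[leb]_(s in `[0, t]) (n.+1%:R * omega s + omega t * h n s))).
  apply: le_rint => //; first by apply: intgD => //; exact: intgZ.
  move=> s /=; rewrite in_itv/= => /andP[s0 st].
  apply: (@le_trans _ _ ((n.+1%:R + h n s) * omega s)).
    rewrite ler_wpM2r ?expR_ge0// -lerBlDl /h le_max.
    by apply/orP; left; rewrite lerB// ler_nat.
  rewrite mulrDl lerD2l mulrC ler_wpM2r ?om_mono//.
  by rewrite le_max lexx orbT.
rewrite rintD//; try exact: intgZ.
rewrite !rintZ//.
have H1 : n.+1%:R * \int[leb]_(s in `[0, t]) omega s <= omega t / 4.
  rewrite ler_pdivlMr// mulrC mulrA; exact: rint_expR.
have H2 : omega t * \int[leb]_(s in `[0, t]) h n s <= omega t * 4^-1.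
  rewrite ler_pM2l ?expR_gt0//; apply: le_trans (ltW hn).
  by apply: rint_subset_le => // s _; rewrite le_max lexx orbT.
by move: H1 H2; lra.
Unshelve. all: by end_near. Qed.

End weight.

(** * Membership in L^p and conjugate exponents *)

Section Lp_membership.
Context {R : realType} (D : set R).
Hypotheses (mD : measurable D) (fD : (leb D < +oo)%E).

Lemma Lnorm_real {E : normedModType R} (f : R -> E) (p : R) : 0 < p ->
  (Lnorm leb p%:E ((fun t => `|f t|%:E) \_ D) < +oo)%E <->
  (\int[leb]_(t in D) (`|f t| `^ p)%:E < +oo)%E.
Proof.
move=> p0; rewrite unlock /Lnorm.
have -> : (\int[leb]_x `|((fun t => `|f t|%:E) \_ D) x| `^ p = \int[leb]_(t in D) (`|f t| `^ p)%:E)%E.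
  rewrite [RHS]integral_mkcond; apply: eq_integral => t _; rewrite !patchE.
  by case: ifPn => _; rewrite ?abse0 ?poweR0r ?gt_eqF//= normr_id.
split; first by apply: lty_poweRy; rewrite invr_neq0// gt_eqF.
exact: poweR_lty.
Qed.

Lemma powR_measurable (c : R -> R) p : measurable_fun D c ->
  measurable_fun D (fun t => c t `^ p).
Proof. by move=> mc; exact: (measurableT_comp (measurable_powR p) mc). Qed.

Lemma in_Lp_real {E : normedModType R} (f : R -> E) (p : R) : 0 < p ->
  in_Lp D p%:E f -> exists2 g : R -> E, nice g /\ intg D (fun t => `|g t| `^ p) &
    {ae @lebesgue_measure R, forall t, D t -> g t = f t}.
Proof.
move=> p0 [sf /(Lnorm_real _ p0) Lf].
have [g ng gf] := strongly_measurable_nice mD sf; exists g => //; split => //.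
apply/integrableP; split.
  apply/measurable_EFinP; apply: powR_measurable.
  by apply: measurable_funS (nice_norm_measurable ng).
apply: le_lt_trans Lf; rewrite le_eqVlt; apply/orP; left; apply/eqP.
apply: ge0_integral_ae_eq => [t _|t _|]; rewrite ?lee_fin ?powR_ge0//.
move: gf; apply: ae_mono => t gf Dt /=.
by rewrite ger0_norm ?powR_ge0// gf.
Qed.

Lemma Lp_in_Lp {E : normedModType R} (f : R -> E) (c : R -> R) (p M : R) : 0 < p ->
  nice f -> measurable_fun setT c -> (forall t, 0 <= c t) -> 0 <= M ->
  intg D (fun t => c t `^ p) ->
  {ae @lebesgue_measure R, forall t, D t -> `|f t| <= M * c t} -> in_Lp D p%:E f.
Proof.
move=> p0 nf mc c0 M0 ic fc; split; first by apply: (nice_strongly_measurable nf); exact: aeW.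
apply/(Lnorm_real _ p0).
have mf : measurable_fun D (fun t => `|f t| `^ p).
  by apply: powR_measurable; apply: measurable_funS (nice_norm_measurable nf).
have /integrableP[_] : intg D (fun t => `|f t| `^ p).
  apply: (intg_ae mD mf (intgZ mD (M `^ p) ic)).
  move: fc; apply: ae_mono => t fc Dt; rewrite ger0_norm ?powR_ge0//.
  by rewrite -powRM// ge0_ler_powR ?nnegrE ?mulr_ge0 ?fc// ltW.
apply: le_lt_trans; rewrite le_eqVlt; apply/orP; left; apply/eqP.
by apply: eq_integral => t _; rewrite /= ger0_norm ?powR_ge0.
Qed.

Lemma Lp_intg (c : R -> R) (p : R) : 1 <= p -> measurable_fun setT c -> (forall t, 0 <= c t) ->
  intg D (fun t => c t `^ p) -> intg D c.
Proof.
move=> p1 mc c0 ic.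
apply: (intg_le mD) (intgD mD (intg_cst mD fD 1) ic) _; first exact: measurable_funS mc.
move=> t _; rewrite ger0_norm//; have [c1|c1] := leP (c t) 1.
  by rewrite (le_trans c1)// lerDl powR_ge0.
rewrite -[leLHS]powRr1// ler_wpDl// ler_powR// ltW//.
Qed.

(** Young's inequality [m c <= m^q / q + c^p / p] dominates the product for finite [q]; for
    [q = +oo] the exponent [p] is 1 and [m] is essentially bounded. [m'] is a measurable and
    nonnegative representative of [|m|]. *)
Lemma conjugate_intg (m : R -> R^o) (p : R) (q : \bar R) : 1 <= p -> (1 < q)%E ->
  ((p%:E)^-1 + q^-1 = 1)%E -> in_Lp D q m ->
  exists m' : R -> R, [/\ measurable_fun setT m', forall t, 0 <= m' t,
    {ae @lebesgue_measure R, forall t, D t -> m' t = `|m t|} &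
    forall c : R -> R, measurable_fun setT c -> (forall t, 0 <= c t) ->
      intg D (fun t => c t `^ p) -> intg D (fun t => m' t * c t)].
Proof.
move=> p1 q1 pq Lm.
have p0 : 0 < p := lt_le_trans ltr01 p1.
have [sm _] := Lm; have [g ng gm] := strongly_measurable_nice mD sm.
have mg : measurable_fun setT (fun t => `|g t|) := nice_norm_measurable ng.
exists (fun t => `|g t|); split => //.
  by move: gm; apply: ae_mono => t gm Dt; rewrite gm.
move=> c mc c0 ic; have ic1 := Lp_intg p1 mc c0 ic.
have mgc : measurable_fun D (fun t => `|g t| * c t).
  by apply: measurable_funM; [exact: measurable_funS mg|exact: measurable_funS mc].
move: pq; rewrite inver gt_eqF//.
case: q q1 Lm => [q| |]// q1 Lm.
  rewrite inver gt_eqF; last by rewrite lte_fin in q1; exact: lt_trans ltr01 q1.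
  rewrite -EFinD => -[pq]; rewrite lte_fin in q1.
  have q0 : 0 < q := lt_trans ltr01 q1.
  have [g' [ng' ig'] g'm] := in_Lp_real q0 Lm.
  apply: (intg_ae mD mgc (intgD mD (intgZ mD q^-1 ig') (intgZ mD p^-1 ic))).
  apply: ae_mono2 gm g'm => t gm g'm Dt.
  rewrite gm// -g'm// ger0_norm ?mulr_ge0// mulrC addrC.
  by rewrite (mulrC p^-1) (mulrC q^-1); exact: conjugate_powR.
rewrite invey adde0 => -[/eqP]; rewrite -invr1 (inj_eq invr_inj) => /eqP pE.
case: Lm => _; rewrite unlock /Lnorm.
case: ifP => [_|]; last first.
  (* The norm with exponent [+oo] is defined by cases on the measure of the whole line. Were that
     measure 0, [D] would be null and integrability on it trivial. *)
  have [muT|muT] := leP (leb (setT : set R)) 0%E; last by [].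
  move=> _ _.
  have D0 : leb D = 0%E.
    apply/eqP; rewrite -measure_le0; apply: le_trans muT.
    by apply: (@le_measure _ _ _ (@lebesgue_measure R)); [exact: mem_set|exact: mem_set|].
  apply: (intg_ae mD mgc (intg_cst mD fD 0)).
  exists D; split => // t /= H; apply: contrapT => Dt; apply: H => /Dt; by [].
move=> Lm; have : exists2 M : R, 0 <= M &
    {ae @lebesgue_measure R, forall t, D t -> `|m t| <= M}.
  have H := @ess_sup_ge _ _ _ (@lebesgue_measure R) (abse \o ((fun t => `|m t|%:E) \_ D)).
  move: Lm H; case: (ess_sup _ _) => [M| |]// _ H.
    exists `|M|; first by [].
    move: H; apply: ae_mono => t /= + Dt; rewrite patchE mem_set//=.
    by rewrite lee_fin normr_id => /le_trans; apply; rewrite ler_norm.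
  exists 0 => //; move: H; apply: ae_mono => t /= + Dt.
  by rewrite patchE mem_set.
move=> [M M0 mM]; apply: (intg_ae mD mgc (intgZ mD M ic1)).
apply: ae_mono2 gm mM => t gm mM Dt.
by rewrite ger0_norm ?mulr_ge0// ler_wpM2r// gm// mM.
Qed.

End Lp_membership.

(** * Volterra operators *)

Section bounded_operators.
Context {R : realType} {V W : normedModType R}.
Implicit Types (A B : boundedOp V W) (x y : V).

Lemma op_le A x : `|A x| <= `|A| * `|x|.
Proof.
have [lA [M AM]] := bounded_linearP A.
have AZ a y : A (a *: y) = a *: A y.
  have A0 : A 0 = 0 by have := lA (- 1) 0 0; rewrite !scaleN1r !addNr.
  by have := lA a y 0; rewrite !addr0 A0 addr0.
have [->|x0] := eqVneq x 0.
  by have := AZ 0 0; rewrite !scale0r => ->; rewrite !normr0 mulr0.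
have nx0 : 0 < `|x| by rewrite normr_gt0.
have -> : `|A x| = `|A (`|x|^-1 *: x)| * `|x|.
  by rewrite AZ normrZ normfV normr_id mulrAC mulVf ?mul1r// gt_eqF.
rewrite ler_wpM2r//.
apply: (@le_sup_image _ _ [set x | `|x| <= 1] (fun x => `|A x|) `|M|).
  move=> y /= y1; rewrite (le_trans (AM y))// (le_trans (ler_norm _))// normrM normr_id.
  by rewrite ler_piMr.
by rewrite /= normrZ normfV normr_id mulVf// gt_eqF.
Qed.

Lemma opD A x y : A (x + y) = A x + A y.
Proof. by have [lA _] := bounded_linearP A; have := lA 1 x y; rewrite !scale1r. Qed.

Lemma op0 A : A 0 = 0.
Proof. by have [lA _] := bounded_linearP A; have := lA (- 1) 0 0; rewrite !scaleN1r !addNr. Qed.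

Lemma opZ A a x : A (a *: x) = a *: A x.
Proof. by have [lA _] := bounded_linearP A; have := lA a x 0; rewrite !addr0 op0 addr0. Qed.

Lemma opB A x y : A (x - y) = A x - A y.
Proof. by rewrite -scaleN1r opD opZ scaleN1r. Qed.

Lemma op_subE A B x : (A - B) x = A x - B x.
Proof. by []. Qed.

Lemma op_zeroE x : (0 : boundedOp V W) x = 0.
Proof. by []. Qed.

Lemma cvg_op (A_ : nat -> boundedOp V W) A (x_ : nat -> V) x :
  A_ n @[n --> \oo] --> A -> x_ n @[n --> \oo] --> x ->
  A_ n (x_ n) @[n --> \oo] --> A x.
Proof.
move=> /cvg_dist0 AA /cvg_dist0 xx.
have H : `|A - A_ n| * `|x| + (`|A| + `|A - A_ n|) * `|x - x_ n| @[n --> \oo] --> (0 : R).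
  have H1 : `|A - A_ n| * `|x| @[n --> \oo] --> 0 * `|x|.
    by apply: cvgM; [exact: AA|exact: cvg_cst].
  have H3 : `|A| + `|A - A_ n| @[n --> \oo] --> `|A| + 0.
    by apply: cvgD; [exact: cvg_cst|exact: AA].
  have H2 : (`|A| + `|A - A_ n|) * `|x - x_ n| @[n --> \oo] --> (`|A| + 0) * 0.
    by apply: cvgM; [exact: H3|exact: xx].
  have : `|A - A_ n| * `|x| + (`|A| + `|A - A_ n|) * `|x - x_ n| @[n --> \oo] --> 0 * `|x| + (`|A| + 0) * 0.
    by apply: cvgD; [exact: H1|exact: H2].
  by rewrite mul0r mulr0 addr0.
apply/cvgrPdist_le => e e0; move/cvgrPdist_le : H => /(_ e e0); apply: filterS => n.
rewrite sub0r normrN => /(le_trans (ler_norm _)); apply: le_trans.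
have -> : A x - A_ n (x_ n) = (A - A_ n) x + A_ n (x - x_ n).
  by rewrite opB op_subE subrKA.
rewrite (le_trans (ler_normD _ _))//; apply: lerD; first exact: op_le.
rewrite (le_trans (op_le _ _))// ler_wpM2r//.
by rewrite -{1}(subKr A (A_ n)) (le_trans (ler_normB _ _)).
Qed.

End bounded_operators.

Lemma nice_op {R : realType} {V W : normedModType R} (A : R -> boundedOp V W) (x : R -> V) :
  nice A -> nice x -> nice (fun t => A t (x t)).
Proof.
move=> [s [ss sA]] [r [rr rx]].
exists (fun n t => s n t (r n t)); split => [n|t]; last exact: cvg_op.
exact: (simple_map2 (fun (B : boundedOp V W) y => B y)).
Qed.

(** * The mean value inequality by real induction *)

Section real_induction.
Context {R : realType}.

(** At the supremum [c] of the points where [P] holds, the hypothesis allows a jump from a point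
    just before [c] to a point beyond it, unless [b] has been reached. *)
Lemma real_induction (a b : R) (P : R -> Prop) : a <= b -> P a ->
  (forall c, a <= c <= b -> exists2 d, 0 < d & forall r r', a <= r <= c -> c <= r' <= b ->
     c - r < d -> r' - c < d -> P r -> P r') -> P b.
Proof.
move=> ab Pa step; pose S := [set r | a <= r <= b /\ P r].
have hS : has_sup S.
  by split; [exists a; rewrite /S/= lexx ab|exists b => r [/andP[]]].
pose c := sup S.
have ac : a <= c by apply: ub_le_sup; [exact: hS.2|rewrite /S/= lexx ab].
have cb : c <= b by apply: ge_sup; [exact: hS.1|move=> r [/andP[]]].
have [|d d0 H] := step c; first by rewrite ac cb.
have [r [/andP[ar rb] Pr] cr] := sup_adherent d0 hS.
have rc : r <= c by apply: ub_le_sup; [exact: hS.2|rewrite /S/= ar rb].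
have d2 : 0 < d / 2 by rewrite divr_gt0.
have [bd|bd] := leP b (c + d / 2).
  apply: (H r b) => //; rewrite ?ar ?cb ?lexx//; last by lra.
  by rewrite -/c in cr; lra.
have Pc : P (c + d / 2).
  apply: (H r) => //; rewrite ?ar ?rc ?lerDl ?(ltW d2) ?(ltW bd)//; last by lra.
  by rewrite -/c in cr; lra.
have : c + d / 2 <= c.
  apply: ub_le_sup; first exact: hS.2.
  by split => //; rewrite (ltW bd) andbT; lra.
by lra.
Qed.

Lemma derivative_within_local {E : normedModType R} (A : set R) (f : R -> E) t l e :
  has_derivative_within A f t l -> 0 < e ->
  exists2 d, 0 < d & forall r, A r -> `|r - t| < d -> `|f r - f t| <= (`|l| + e) * `|r - t|.
Proof.
move=> /cvgrPdist_lt H e0; have /nbhs_ballP[d /= d0 Hd] := H e e0.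
exists d => // r Ar rt; have [->|rt0] := eqVneq r t.
  by rewrite !subrr !normr0 mulr0.
have rt0' : r - t != 0 by rewrite subr_eq0.
have := Hd r; rewrite /ball/= distrC => /(_ rt rt0 Ar) => H1.
have -> : f r - f t = (r - t) *: ((r - t)^-1 *: (f r - f t)).
  by rewrite scalerA mulfV// scale1r.
rewrite normrZ mulrC ler_wpM2r//.
rewrite -(subrK l (_ *: _)) (le_trans (ler_normD _ _))// addrC lerD2l distrC.
exact: ltW.
Qed.

(** Real induction on [|f r - f a| <= (M + e') (r - a)]. The slack [e'] absorbs the error of the
    difference quotients on both sides of a point, and it is arbitrary. *)
Lemma mean_value_le {E : normedModType R} (f : R -> E) (df : R -> E) (s T M a b : R) :
  (forall t, s <= t <= T -> has_derivative_within `[s, T] f t (df t)) ->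
  (forall t, s <= t <= T -> `|df t| <= M) ->
  s <= a -> a <= b -> b <= T -> `|f b - f a| <= M * (b - a).
Proof.
move=> fdf dfM sa ab bT; apply/ler_addgt0Pr => e e0.
have [->|ab0] := eqVneq a b.
  by rewrite !subrr normr0 mulr0 add0r ltW.
have ab1 : 0 < b - a by rewrite subr_gt0 lt_neqAle ab0.
pose e' := e / (b - a).
have e'0 : 0 < e' by rewrite divr_gt0.
rewrite (_ : M * (b - a) + e = (M + e') * (b - a)); last first.
  by rewrite /e'; field; rewrite gt_eqF.
apply: (@real_induction a b (fun r => `|f r - f a| <= (M + e') * (r - a))) => //.
  by rewrite !subrr normr0 mulr0.
move=> c /andP[ac cb].
have sc : s <= c <= T by rewrite (le_trans sa ac) (le_trans cb bT).
have [d d0 Hd] := derivative_within_local (fdf c sc) e'0.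
exists d => // r r' /andP[ar rc] /andP[cr' r'b] crd rcd Hr.
have H u : s <= u -> u <= T -> `|u - c| < d -> `|f u - f c| <= (M + e') * `|u - c|.
  move=> su uT uc; apply: le_trans (Hd u _ uc) _; first by rewrite /= in_itv/= su uT.
  by rewrite ler_wpM2r// lerD2r dfM.
have H1 : `|f r' - f c| <= (M + e') * (r' - c).
  rewrite -[X in _ * X]ger0_norm ?subr_ge0//; apply: H.
  - exact: le_trans sa (le_trans ac cr').
  - exact: le_trans r'b bT.
  - by rewrite ger0_norm ?subr_ge0.
have H2 : `|f r - f c| <= (M + e') * (c - r).
  rewrite -[X in _ * X]ger0_norm ?subr_ge0// distrC [X in _ * X]distrC distrC; apply: H.
  - exact: le_trans sa ar.
  - exact: le_trans rc (le_trans cb bT).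
  - by rewrite distrC ger0_norm ?subr_ge0.
have -> : f r' - f a = (f r' - f c) + (f c - f r) + (f r - f a).
  by rewrite -addrA !subrKA.
rewrite (le_trans (ler_normD _ _))// (le_trans (lerD (ler_normD _ _) (lexx _)))//.
rewrite (distrC (f c)); lra.
Qed.

End real_induction.

(** A normalized kernel: it vanishes outside the triangle, and a single function [kappa] bounds both
    its norm and its Lipschitz constant in the first argument, for every [s]. [vk_lip] requires
    [s <= a] because the kernel may jump across the diagonal. [vk_inv] is the quantitative form of
    the invertibility of [k s s]. *)
Record volterra_kernel {R : realType} {E : normedModType R} (T : R)
    (ker : R -> R -> boundedOp E E) (kappa : R -> R) (C : R) := {
  vk_nice : forall t, 0 <= t <= T -> nice (ker t);
  vk_out : forall t s, ~ (0 <= s <= t /\ s <= T) -> ker t s = 0;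
  vk_meas : measurable_fun setT kappa;
  vk_ge0 : forall s, 0 <= kappa s;
  vk_bound : forall t s, t <= T -> `|ker t s| <= kappa s;
  vk_lip : forall a b s, s <= a -> a <= b -> b <= T ->
    `|ker b s - ker a s| <= kappa s * (b - a);
  vk_diag : nice (fun s => ker s s);
  vk_C : 0 <= C;
  vk_inv : {ae @lebesgue_measure R, forall s, 0 <= s <= T ->
    forall v, `|v| <= C * `|ker s s v|} }.

(** * Construction of the normalized kernel *)

Section kernel_construction.
Context {R : realType} {E : completeNormedModType R} (T : R) (T0 : 0 < T).
Variables (k dk : R -> R -> boundedOp E E).
Hypotheses (k1 : forall s t, 0 <= s <= t -> t <= T ->
      has_derivative_within `[s, T] (k^~ s) t (dk t s))
    (k2 : forall t, `[0, T]%classic t -> {within `[0, t], continuous (k t)})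
    (k3 : {within `[0, T], continuous (fun t => k t t)} /\
      forall t, `[0, T]%classic t -> invertible_op (k t t)).
Variable m : R -> R.
Hypothesis km : forall s t, 0 <= s <= t -> t <= T -> `|dk t s| <= m s.

Lemma kernel_lipschitz s a b : 0 <= s -> s <= a -> a <= b -> b <= T ->
  `|k b s - k a s| <= m s * (b - a).
Proof.
move=> s0 sa ab bT; apply: (@mean_value_le _ _ (k^~ s) (dk^~ s) s T) => //.
  by move=> t /andP[st tT]; apply: k1; rewrite ?s0.
by move=> t /andP[st tT]; apply: km; rewrite ?s0.
Qed.

Lemma kernel_diag_bounded : exists2 M : R, 0 <= M & forall s, 0 <= s <= T -> `|k s s| <= M.
Proof.
have := continuous_compact k3.1 (@segment_compact _ 0 T).
move=> /compact_bounded [M [_ kM]]; exists (`|M| + 1); first exact: addr_ge0.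
move=> s sT; apply: (kM (`|M| + 1)); first by rewrite ltr_pwDr// ler_norm.
by exists s => //; rewrite /= in_itv.
Qed.

Lemma within_itv_dist {V : normedModType R} (f : R -> V) (a b c e : R) :
  {within `[a, b], continuous f} -> a <= c <= b -> 0 < e ->
  exists2 d, 0 < d & forall r, a <= r <= b -> `|r - c| < d -> `|f r - f c| < e.
Proof.
move=> cf cab e0.
have : f @ within `[a, b] (nbhs c) --> f c.
  by move/subspace_continuousP : cf; apply; rewrite /= in_itv.
move=> /cvgrPdist_lt/(_ e e0)/nbhs_ballP[d /= d0 Hd]; exists d => // r rab rc.
rewrite distrC; apply: Hd; first by rewrite /ball/= distrC.
by rewrite /= in_itv.
Qed.

(** Near each [c] the bound follows by perturbing the inverse of [k c c]. Real induction then
    replaces a finite subcover: each step adds the local constant to the previous one. *)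
Lemma kernel_diag_inverse : exists2 C : R, 0 <= C & forall s, 0 <= s <= T ->
  forall v, `|v| <= C * `|k s s v|.
Proof.
pose P r := exists2 C : R, 0 <= C & forall s, 0 <= s <= r -> forall v, `|v| <= C * `|k s s v|.
have loc c : 0 <= c <= T -> exists2 d, 0 < d & exists2 C : R, 0 <= C &
    forall s, 0 <= s <= T -> `|s - c| < d -> forall v, `|v| <= C * `|k s s v|.
  move=> cT; have [B [BK _]] : invertible_op (k c c) by apply: k3.2; rewrite /= in_itv.
  (* At this distance from [k c c] the perturbation costs at most half of [|v|], whence the constant
     [2 |B|]; the summand 1 allows for [B = 0]. *)
  have e0 : 0 < 2^-1 / (`|B| + 1) by rewrite divr_gt0 ?invr_gt0 ?ltr_wpDl.
  have [d d0 Hd] := within_itv_dist k3.1 cT e0.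
  exists d => //; exists (2 * `|B|); first exact: mulr_ge0.
  move=> s sT sc v; have H1 : `|v| <= `|B| * `|k c c v|.
    by rewrite -{1}(BK v) op_le.
  have H2 : `|k c c v| <= `|k s s v| + `|k s s - k c c| * `|v|.
    have -> : k c c v = k s s v - (k s s - k c c) v.
      by rewrite op_subE subKr.
    by rewrite (le_trans (ler_normB _ _))// lerD2l op_le.
  have H3 : `|B| * `|k s s - k c c| <= 2^-1.
    have := ltW (Hd s sT sc); rewrite ler_pdivlMr ?ltr_wpDl// mulrC.
    by apply: le_trans; rewrite ler_wpM2r// lerDl.
  have H4 := ler_wpM2l (normr_ge0 B) H2.
  have H5 := ler_wpM2r (normr_ge0 v) H3.
  rewrite mulrDr in H4; rewrite -mulrA; rewrite -mulrA in H5; lra.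
suff : P T by [].
apply: (@real_induction _ 0 T P) => [||c cT]; first exact: ltW.
  have [|d d0 [C C0 HC]] := loc 0; first by rewrite lexx ltW.
  exists C => // s; rewrite -eq_le => /eqP <- v.
  by apply: HC; rewrite ?lexx ?ltW// subrr normr0.
have [d d0 [C C0 HC]] := loc c cT.
exists d => // r r' /andP[r0 rc] /andP[cr' r'T] crd rcd [C' C'0 HC'].
exists (C + C'); first exact: addr_ge0.
move=> s /andP[s0 sr'] v; rewrite mulrDl.
have [sr|rs] := leP s r.
  by apply: le_trans (HC' s _ v) _; rewrite ?s0// lerDr mulr_ge0.
apply: le_trans (HC s _ _ v) _; rewrite ?s0 ?(le_trans sr' r'T)//; last by rewrite lerDl mulr_ge0.
by rewrite ltr_norml; apply/andP; split; lra.
Qed.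

End kernel_construction.

Section clamp.
Context {R : realType}.
Implicit Types a b r s : R.

(** The projection onto [[a, b]] for [a <= b]; composition with it extends functions continuous on
    the interval to the whole line. *)
Definition clamp a b r := Num.max a (Num.min b r).

Lemma clamp_itv a b r : a <= b -> a <= clamp a b r <= b.
Proof. by move=> ab; rewrite /clamp le_max lexx/= ge_max ab ge_min lexx. Qed.

Lemma clamp_id a b r : a <= r <= b -> clamp a b r = r.
Proof. by move=> /andP[ar rb]; rewrite /clamp (min_idPr rb) (max_idPr ar). Qed.

Lemma clamp_dist a b r s : `|clamp a b r - clamp a b s| <= `|r - s|.
Proof.
have R1 := ler_norm (r - s); have := ler_norm (s - r); rewrite distrC => R2.
rewrite /clamp ler_norml.
have [br|br] := leP b r; have [bs|bs] := leP b s;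
  have [] := leP a b; have [] := leP a r; have [] := leP a s => *;
  apply/andP; split; lra.
Qed.

Lemma clamp_continuous {V : normedModType R} (f : R -> V) a b : a <= b ->
  {within `[a, b], continuous f} -> continuous (f \o clamp a b).
Proof.
move=> ab cf r; apply/cvgrPdist_lt => e e0.
have [d d0 Hd] := within_itv_dist cf (clamp_itv r ab) e0.
apply/nbhs_ballP; exists d => // s /= rs; rewrite distrC; apply: Hd; first exact: clamp_itv.
by apply: le_lt_trans (clamp_dist a b s r) _; rewrite distrC.
Qed.

End clamp.

Lemma kernel_exists {R : realType} {E : completeNormedModType R} (T : R) (T0 : 0 < T)
    (k dk : R -> R -> boundedOp E E) (p : R) (q : \bar R) (m : R -> R^o) :
  1 <= p -> (1 < q)%E -> ((p%:E)^-1 + q^-1 = 1)%E ->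
  (forall s t, 0 <= s <= t -> t <= T ->
      has_derivative_within `[s, T] (k^~ s) t (dk t s)) ->
  (forall t, `[0, T]%classic t -> {within `[0, t], continuous (k t)}) ->
  ({within `[0, T], continuous (fun t => k t t)} /\
      forall t, `[0, T]%classic t -> invertible_op (k t t)) ->
  in_Lp `[0, T] q m ->
  (forall s t, 0 <= s <= t -> t <= T -> `|dk t s| <= m s) ->
  exists (N : set R) (ker : R -> R -> boundedOp E E) (kappa : R -> R) (C : R),
    [/\ measurable N /\ leb N = 0%E, volterra_kernel T ker kappa C,
      forall t s, 0 <= s <= t -> t <= T -> ~ N s -> ker t s = k t s &
      forall c : R -> R, measurable_fun setT c -> (forall t, 0 <= c t) ->
        intg `[0, T] (fun t => c t `^ p) -> intg `[0, T] (fun t => kappa t * c t)].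
Proof.
move=> p1 q1 pq k1 k2 k3 Lm km.
have mI : measurable (`[0, T]%classic : set R) by [].
have fI := leb_itv_lty 0 T.
have p0 : 0 < p := lt_le_trans ltr01 p1.
have [m' [mm' m'0 m'm m'c]] := conjugate_intg mI fI p1 q1 pq Lm.
have [N [mN N0 NP]] := m'm.
have m'E s : 0 <= s <= T -> ~ N s -> m s <= m' s.
  move=> sT Ns; have -> : m' s = `|m s|.
    by apply: contrapT => H; apply: Ns; apply: NP => /(_ _); rewrite /= in_itv/= => /(_ sT).
  exact: ler_norm.
have [M M0 kM] := kernel_diag_bounded k3.
have [C C0 kC] := kernel_diag_inverse T0 k3.
(* [N] contains the times where [m'] may differ from [|m|]. The kernel is kept on [A t] only, so
   that the estimates by [m'] hold without exception. *)
pose A t : set R := (`[0, t] `&` `[0, T]) `\` N.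
have mA t : measurable (A t) by apply: measurableD => //; exact: measurableI.
have AP t s : A t s <-> [/\ 0 <= s <= t, s <= T & ~ N s].
  rewrite /A/= !in_itv/=; split => [[[/andP[s0 st] /andP[_ sT]] Ns]|[/andP[s0 st] sT Ns]].
    by rewrite s0 st.
  by rewrite s0 st sT.
pose ker t s : boundedOp E E := if s \in A t then k t s else 0.
(* [M] bounds the diagonal, [T m'] the variation of the kernel away from the diagonal, and [m'] its
   Lipschitz constant. *)
pose kappa s := M + 1 + (T + 1) * m' s.
have kin t s : A t s -> ker t s = k t s by move=> As; rewrite /ker mem_set.
have kout t s : ~ A t s -> ker t s = 0 by move=> As; rewrite /ker memNset.
have T10 : 0 <= T + 1 by rewrite addr_ge0// ltW.
have kap0 s : 0 <= kappa s by rewrite addr_ge0// ?mulr_ge0// addr_ge0.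
have m'k s : m' s <= kappa s.
  by have := m'0 s; have := mulr_ge0 (ltW T0) (m'0 s); rewrite /kappa mulrDl mul1r; lra.
have klip s a b : 0 <= s -> s <= a -> a <= b -> b <= T -> ~ N s ->
    `|k b s - k a s| <= m' s * (b - a).
  move=> s0 sa ab bT Ns; apply: le_trans (kernel_lipschitz k1 km s0 sa ab bT) _.
  by rewrite ler_wpM2r ?subr_ge0// m'E// s0 (le_trans sa)// (le_trans ab).
exists N, ker, kappa, C; split => //.
- split => //.
  + move=> t /andP[t0 tT].
    have -> : ker t = fun s => if s \in A t then (k t \o clamp 0 t) s else 0.
      apply/funext => s; rewrite /ker; case: ifPn => // /set_mem/AP[st _ _].
      by rewrite /= clamp_id.
    apply: nice_if => //; last exact: nice_cst.
    by apply: continuous_nice; apply: clamp_continuous => //; apply: k2; rewrite /= in_itv/= t0.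
  + by move=> t s st; apply: kout => /AP[? ? _]; apply: st.
  + apply: measurable_funD; first exact: measurable_cst.
    by apply: measurable_funM => //; exact: measurable_cst.
  + move=> t s tT; have [As|As] := pselect (A t s); last by rewrite kout// normr0.
    rewrite kin//; move/AP : As => [/andP[s0 st] sT Ns].
    rewrite -(subrK (k s s) (k t s)) (le_trans (ler_normD _ _))//.
    have H1 := klip s s t s0 (lexx s) st tT Ns.
    have H2 : m' s * (t - s) <= m' s * T by rewrite ler_wpM2l//; lra.
    have H3 : `|k s s| <= M by rewrite kM// s0.
    by have := m'0 s; rewrite /kappa mulrDl mul1r (mulrC T); lra.
  + move=> a b s sa ab bT; have sT := le_trans sa (le_trans ab bT).
    have [As|As] := pselect (A a s); last first.
      rewrite kout; last first.
        by move=> /AP[/andP[s0 _] _ Ns]; apply: As; apply/AP; rewrite s0 sa.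
      by rewrite kout// subrr normr0 mulr_ge0// subr_ge0.
    move/AP : (As) => [/andP[s0 _] _ Ns].
    rewrite !kin//; last by apply/AP; rewrite s0 (le_trans sa ab) sT.
    apply: le_trans (klip s a b s0 sa ab bT Ns) _.
    by rewrite ler_wpM2r ?subr_ge0.
  + have -> : (fun s => ker s s) = fun s => if s \in A T then ((fun s => k s s) \o clamp 0 T) s else 0.
      apply/funext => s; have [As|As] := pselect (A T s).
        move/AP : (As) => [sT _ Ns]; rewrite kin ?mem_set//= ?clamp_id//.
        by apply/AP; move/andP : sT => [-> ->]; rewrite lexx.
      rewrite memNset//= kout// => /AP[/andP[s0 _] sT Ns]; apply: As; apply/AP.
      by rewrite s0 sT.
    apply: nice_if => //; last exact: nice_cst.
    apply: continuous_nice; apply: clamp_continuous; [exact: ltW|exact: k3.1].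
  + exists N; split => // s /= H; apply: contrapT => Ns; apply: H => sT v.
    rewrite kin; first exact: kC.
    by apply/AP; move/andP : sT => [-> ->]; rewrite lexx.
- move=> t s /andP[s0 st] tT Ns; apply: kin; apply/AP.
  by rewrite s0 st (le_trans st tT).
- move=> c mc c0 ic.
  have ic1 := Lp_intg mI fI p1 mc c0 ic.
  have := intgD mI (intgZ mI (M + 1) ic1) (intgZ mI (T + 1) (m'c c mc c0 ic)).
  by congr (leb.-integrable _ _); apply/funext => t /=; rewrite /kappa [in RHS]mulrDl -mulrA.
Qed.

Lemma leb_itv_oc {R : realType} (a b : R) : a <= b ->
  leb (`]a, b]%classic : set R) = (b - a)%:E.
Proof.
move=> ab; rewrite lebesgue_measure_itv/= lte_fin; case: ltP => [_|ba]; first by rewrite EFinB.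
by rewrite (le_anti (introT andP (conj ab ba))) subrr.
Qed.

(** * The integral operator of a normalized kernel *)

Section volterra_operator.
Context {R : realType} {E : completeNormedModType R} (T : R).
Variables (ker : R -> R -> boundedOp E E) (kappa : R -> R) (C : R).
Hypotheses (T0 : 0 < T) (vk : volterra_kernel T ker kappa C).
Local Notation I := (`[0, T]%classic : set R).
Let mI : measurable I := measurable_itv _.
Let fI : (leb I < +oo)%E := leb_itv_lty 0 T.
Implicit Types (w u : R -> E) (g : R -> R).

(** The domain of integration is all of [[0, T]], independent of [t]: the kernel vanishes for
    [s > t]. *)
Definition volterra w t := bint I (fun s => ker t s (w s)).
Definition admissible w := nice w /\ intg I (fun s => kappa s * `|w s|).

Lemma kernel_app_le t w s : t <= T -> `|ker t s (w s)| <= kappa s * `|w s|.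
Proof. by move=> tT; rewrite (le_trans (op_le _ _))// ler_wpM2r// (vk_bound vk). Qed.

Lemma kernel_app_out t w s : ~ (0 <= s <= t /\ s <= T) -> ker t s (w s) = 0.
Proof. by move=> st; rewrite (vk_out vk st) op_zeroE. Qed.

Lemma kernel_app_nice t w : 0 <= t <= T -> nice w -> nice (fun s => ker t s (w s)).
Proof. by move=> tT nw; apply: nice_op => //; exact: (vk_nice vk). Qed.

Lemma kernel_app_intg t w : 0 <= t <= T -> admissible w ->
  intg I (fun s => `|ker t s (w s)|).
Proof.
move=> tT [nw iw]; apply: (intg_le mI) iw _.
  by apply: nice_norm_measurableD; exact: kernel_app_nice.
by move=> s _; rewrite normr_id; apply: kernel_app_le; case/andP: tT.
Qed.

Lemma kappa_norm_measurable w D : nice w -> measurable_fun D (fun s => kappa s * `|w s|).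
Proof.
move=> nw; apply: measurable_funM; first exact: measurable_funS (vk_meas vk).
exact: measurable_funS (nice_norm_measurable nw).
Qed.

Lemma admissible_comb a b w u : admissible w -> admissible u ->
  admissible (fun s => a *: w s + b *: u s).
Proof.
move=> [nw iw] [nu iu]; have nwu : nice (fun s => a *: w s + b *: u s).
  by apply: niceD; exact: niceZ.
split => //.
apply: (intg_le mI (kappa_norm_measurable nwu) (intgD mI (intgZ mI `|a| iw) (intgZ mI `|b| iu))).
move=> s _; rewrite ger0_norm ?mulr_ge0 ?(vk_ge0 vk)//.
rewrite !(mulrCA _ (kappa s)) -mulrDr ler_wpM2l ?(vk_ge0 vk)//.
by rewrite (le_trans (ler_normD _ _))// !normrZ.
Qed.

Lemma volterra_comb a b w u t : 0 <= t <= T -> admissible w -> admissible u ->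
  volterra (fun s => a *: w s + b *: u s) t = a *: volterra w t + b *: volterra u t.
Proof.
move=> tT aw au; have [nw _] := aw; have [nu _] := au.
have nkw := kernel_app_nice tT nw; have nku := kernel_app_nice tT nu.
have ikw := kernel_app_intg tT aw; have iku := kernel_app_intg tT au.
rewrite /volterra -!bintZ// -bintD//.
- by congr bint; apply/funext => s; rewrite opD !opZ.
- exact: niceZ.
- exact: niceZ.
- exact: intg_normZ.
- exact: intg_normZ.
Qed.

Lemma volterra_norm w t : 0 <= t <= T -> admissible w ->
  `|volterra w t| <= \int[leb]_(s in `[0, t]) (kappa s * `|w s|).
Proof.
move=> tT aw; have [nw iw] := aw; have /andP[t0 tT'] := tT.
apply: le_trans (bint_norm mI fI (kernel_app_nice tT nw) (kernel_app_intg tT aw)) _.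
have sub := subset_itv0 tT'.
rewrite -(rint_sub sub).
  apply: le_rint => //.
  - exact: intg_sub (kernel_app_intg tT aw).
  - exact: intg_sub iw.
  - by move=> s _; exact: kernel_app_le.
move=> s /= _ st; rewrite kernel_app_out ?normr0// => -[st' _].
by apply: st; rewrite /= in_itv.
Qed.

(** The first term accounts for the change of the kernel at times [s <= a], by its Lipschitz bound;
    the second for the part of the domain between [a] and [b]. *)
Definition modulus g a b := (b - a) * \int[leb]_(s in I) g s + \int[leb]_(s in `]a, b]) g s.

Lemma volterra_modulus w g a b : 0 <= a -> a <= b -> b <= T -> admissible w ->
  intg I g -> (forall s, I s -> kappa s * `|w s| <= g s) ->
  `|volterra w b - volterra w a| <= modulus g a b.
Proof.
move=> a0 ab bT aw ig wg; have [nw iw] := aw.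
have aT : 0 <= a <= T by rewrite a0 (le_trans ab).
have bT' : 0 <= b <= T by rewrite bT (le_trans a0).
have nB := niceB (kernel_app_nice bT' nw) (kernel_app_nice aT nw).
have mab : measurable (`]a, b]%classic : set R) by [].
have sab : `]a, b]%classic `<=` I.
  move=> s /=; rewrite !in_itv/= => /andP[ats sb].
  by rewrite (le_trans a0 (ltW ats)) (le_trans sb bT).
have g0 s : I s -> 0 <= g s.
  by move=> Is; apply: le_trans (wg s Is); rewrite mulr_ge0 ?(vk_ge0 vk).
have i1 : intg I (fun s => \1_(`]a, b]%classic) s * g s).
  apply: (intg_le mI) (ig) _.
    by apply: measurable_funM; [exact: measurable_indic|exact: intg_meas ig].
  move=> s Is; rewrite normrM indicE ger0_norm// (ger0_norm (g0 s Is)).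
  by rewrite ler_piMl ?g0// lern1 leq_b1.
have ib := kernel_app_intg bT' aw; have ia := kernel_app_intg aT aw.
have bound s : I s -> `|ker b s (w s) - ker a s (w s)| <= (b - a) * g s + \1_(`]a, b]%classic) s * g s.
  move=> Is; have gs := g0 s Is; rewrite /= in_itv/= in Is; have /andP[s0 sT] := Is.
  have ba0 : 0 <= b - a by rewrite subr_ge0.
  have Is' : I s by rewrite /= in_itv.
  have [sa|sa] := leP s a.
    rewrite -op_subE (le_trans (op_le _ _))// (@le_trans _ _ ((b - a) * g s))//.
      apply: le_trans (_ : kappa s * (b - a) * `|w s| <= _).
        by rewrite ler_wpM2r// (vk_lip vk).
      by rewrite mulrAC mulrC ler_wpM2l// wg.
    by rewrite lerDl mulr_ge0// indicE.
  rewrite (@kernel_app_out a); last by case=> /andP[_]; rewrite leNgt sa.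
  rewrite subr0; have [sb|sb] := leP s b.
    rewrite indicE mem_set/= ?in_itv/= ?sa// mul1r.
    apply: le_trans (kernel_app_le _ _ bT) _.
    by apply: le_trans (wg s Is') _; rewrite lerDr mulr_ge0.
  rewrite kernel_app_out; last by case=> /andP[_]; rewrite leNgt sb.
  by rewrite normr0 addr_ge0// mulr_ge0// indicE.
rewrite /volterra -bintB//; [|exact: kernel_app_nice|exact: kernel_app_nice].
have iB : intg I (fun s => `|ker b s (w s) - ker a s (w s)|).
  apply: (intg_le mI) (intgD mI (intgZ mI (b - a) ig) i1) _; first exact: nice_norm_measurableD.
  by move=> s Is; rewrite normr_id bound.
apply: le_trans (bint_norm mI fI nB iB) _.
apply: le_trans (le_rint mI iB (intgD mI (intgZ mI (b - a) ig) i1) bound) _.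
rewrite rintD ?intgZ// rintZ// /modulus lerD2l le_eqVlt; apply/orP; left; apply/eqP.
rewrite -(rint_sub sab); last by move=> s _ sn; rewrite indicE memNset ?mul0r.
by apply: eq_Rintegral => s /set_mem ss; rewrite indicE mem_set ?mul1r.
Qed.

(** Absolute continuity of the integral: beyond a level [n] the function has integral below [e / 2],
    and the rest is at most [b - a] times the constant [K]. *)
Lemma modulus_small g : intg I g -> forall e, 0 < e -> exists2 d, 0 < d &
  forall a b, 0 <= a -> a <= b -> b <= T -> b - a < d -> modulus g a b < e.
Proof.
move=> ig e e0.
pose h n s := Num.max (`|g s| - n%:R) 0.
have mg := intg_meas ig; have ign := intg_norm ig.
have mh n : measurable_fun I (h n).
  by apply: measurable_maxr => //; apply: measurable_funB => //; exact: measurableT_comp.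
have hg n s : `|h n s| <= `|g s|.
  rewrite ger0_norm; last by rewrite le_max lexx orbT.
  by rewrite ge_max normr_ge0 andbT gerBl.
have ih n : intg I (h n) by apply: (intg_le mI (mh n) ign) => t _; exact: hg.
have cv : (\int[leb]_(s in I) h n s) @[n --> \oo] --> (0 : R).
  apply: (rint_dct0 mI mh ign); last by apply: aeW => t _ n; exact: hg.
  apply: aeW => s _; apply: cvg_near_cst.
  near=> n; rewrite /h; apply/max_idPr; rewrite subr_le0.
  by near: n; exact: nbhs_infty_ger.
have e2 : 0 < e / 2 by rewrite divr_gt0.
have /cvgrPdist_lt/(_ _ e2)[n _ /(_ n (leqnn n))/=] := cv.
rewrite sub0r normrN => /(le_lt_trans (ler_norm _)) hn.
pose K := `|\int[leb]_(s in I) g s| + n%:R + 1.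
have K0 : 0 < K by rewrite ltr_wpDl// addr_ge0.
exists (e / 2 / K) => [|a b a0 ab bT bad]; first by rewrite divr_gt0.
have mab : measurable (`]a, b]%classic : set R) by [].
have sab : `]a, b]%classic `<=` I.
  move=> s /=; rewrite !in_itv/= => /andP[ats sb].
  by rewrite (le_trans a0 (ltW ats)) (le_trans sb bT).
have fab : (leb (`]a, b]%classic : set R) < +oo)%E.
  apply: le_lt_trans fI.
  by apply: (@le_measure _ _ _ (@lebesgue_measure R)); [exact: mem_set|exact: mem_set|].
have H1 : \int[leb]_(s in `]a, b]) g s <= n%:R * (b - a) + \int[leb]_(s in I) h n s.
  apply: (@le_trans _ _ (\int[leb]_(s in `]a, b]) (n%:R + h n s))).
    apply: le_rint => //; first exact: intg_sub ig.
      by apply: intgD => //; [exact: intg_cst|exact: intg_sub (ih n)].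
    move=> s _; rewrite -lerBlDl le_max; apply/orP; left.
    by rewrite lerD2r ler_norm.
  rewrite rintD//; [|exact: intg_cst|exact: intg_sub (ih n)].
  apply: lerD; last by apply: rint_subset_le => // s _; rewrite le_max lexx orbT.
  by rewrite Rintegral_cst// -[b - a]/(fine (b - a)%:E) -(leb_itv_oc ab).
have H2 : (b - a) * \int[leb]_(s in I) g s <= (b - a) * `|\int[leb]_(s in I) g s|.
  by rewrite ler_wpM2l ?subr_ge0// ler_norm.
have H3 : (b - a) * K < e / 2 by rewrite -ltr_pdivlMr.
have H4 : 0 <= b - a by rewrite subr_ge0.
rewrite /modulus; move: H1 H2 H3 hn; rewrite (mulrC n%:R (b - a)) /K !mulrDr mulr1.
set x1 := \int[leb]_(s in `]a, b]) g s; set x2 := \int[leb]_(s in I) h n s.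
set x3 := (b - a) * \int[leb]_(s in I) g s; set x4 := (b - a) * `|_|.
set x5 := (b - a) * n%:R.
move: x1 x2 x3 x4 x5 => x1 x2 x3 x4 x5 H1 H2 H3 hn; clear -R H1 H2 H3 H4 hn; lra.
Unshelve. all: by end_near. Qed.

Lemma volterra_dct (w_ : nat -> R -> E) w g t : 0 <= t <= T ->
  (forall n, nice (w_ n)) -> nice w -> measurable_fun setT g ->
  intg I (fun s => kappa s * g s) -> (forall n s, `|w_ n s| <= g s) ->
  {ae @lebesgue_measure R, forall s, I s -> w_ n s @[n --> \oo] --> w s} ->
  admissible w /\ volterra (w_ n) t @[n --> \oo] --> volterra w t.
Proof.
move=> tT nw_ nw mg ig wg ww.
have wbound : {ae @lebesgue_measure R, forall s, I s -> `|w s| <= g s}.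
  move: ww; apply: ae_mono => s ww Is; have ws := ww Is.
  have /cvg_lim <- // : `|w_ n s| @[n --> \oo] --> `|w s| by apply: cvg_norm.
  apply: limr_le; last by apply: nearW => n; exact: wg.
  by apply/cvg_ex; exists `|w s|; apply: cvg_norm.
have aw : admissible w.
  split => //; apply: (intg_ae mI (kappa_norm_measurable nw) ig).
  move: wbound; apply: ae_mono => s ws Is.
  by rewrite ger0_norm ?mulr_ge0 ?(vk_ge0 vk)// ler_wpM2l ?(vk_ge0 vk)// ws.
split => //.
have := @bint_dct _ _ I mI fI (fun n s => ker t s (w_ n s)) (fun s => ker t s (w s))
  (fun s => kappa s * g s) (fun n => kernel_app_nice tT (nw_ n)) (kernel_app_nice tT nw) ig.
case=> //.
- by move: ww; apply: ae_mono => s ww Is; apply: cvg_op; [exact: cvg_cst|exact: ww].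
- apply: aeW => s _ n; apply: le_trans (kernel_app_le _ _ _) _; first by case/andP: tT.
  by rewrite ler_wpM2l ?(vk_ge0 vk).
Qed.

Lemma volterra_ae_eq w u t : 0 <= t <= T -> admissible w -> nice u ->
  {ae @lebesgue_measure R, forall s, 0 <= s <= t -> w s = u s} ->
  volterra w t = volterra u t.
Proof.
move=> tT aw nu wu; apply: bint_ae => //.
- by apply: kernel_app_nice => //; case: aw.
- exact: kernel_app_nice.
- exact: kernel_app_intg.
move: wu; apply: ae_mono => s wu Is; have [st|st] := pselect (0 <= s <= t).
  by rewrite wu.
by rewrite !kernel_app_out// => -[].
Qed.

End volterra_operator.

(** * Uniqueness of densities *)

Lemma halving_le0 {R : realType} (x B : R) : (forall n, x <= B * 2^-1 ^+ n) -> x <= 0.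
Proof.
move=> xB; have cv : B * 2^-1 ^+ n @[n --> \oo] --> B * (0 : R).
  apply: cvgM; first exact: cvg_cst.
  by apply: cvg_expr; rewrite ger0_norm ?invr_ge0// invf_lt1// ltr1n.
rewrite mulr0 in cv; rewrite -(cvg_lim (@Rhausdorff R) cv).
by apply: limr_ge; [apply/cvg_ex; exists 0|exact: nearW].
Qed.

Section volterra_uniqueness.
Context {R : realType} {E : completeNormedModType R} (T : R).
Variables (ker : R -> R -> boundedOp E E) (kappa : R -> R) (C : R).
Hypotheses (T0 : 0 < T) (vk : volterra_kernel T ker kappa C).
Local Notation I := (`[0, T]%classic : set R).
Hypothesis ik : intg I kappa.
Let mI : measurable I := measurable_itv _.
Let fI : (leb I < +oo)%E := leb_itv_lty 0 T.
Implicit Types (w u v : R -> E).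
Local Notation volterra := (volterra T ker).
Local Notation admissible := (admissible T kappa).

Section null.
Variables (v : R -> E) (a : R).
Hypotheses (aT : 0 <= a <= T) (av : admissible v)
  (v0 : forall t, 0 <= t <= a -> volterra v t = 0).
Let U s := ker s s (v s).
Let G t := \int[leb]_(s in `[0, t]) (kappa s * `|v s|).
Let nv : nice v := av.1.
Let iv : intg I (fun s => kappa s * `|v s|) := av.2.

Let U_out s : ~ (0 <= s <= T) -> U s = 0.
Proof. by move=> sT; rewrite /U (vk_out vk) ?op_zeroE// => -[/andP[s0 _] sT']; apply: sT; rewrite s0. Qed.

Let nU : nice U.
Proof. by apply: nice_op => //; exact: vk_diag vk. Qed.

Let U_le s : `|U s| <= kappa s * `|v s|.
Proof.
have [sT|sT] := leP s T; first exact: (kernel_app_le vk).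
by rewrite U_out ?normr0 ?mulr_ge0 ?(vk_ge0 vk)// => /andP[_]; rewrite leNgt sT.
Qed.

Let iU : intg I (fun s => `|U s|).
Proof.
apply: (intg_le mI) (iv) _; first exact: nice_norm_measurableD.
by move=> s _; rewrite normr_id U_le.
Qed.

(** The difference of [volterra v b] and [volterra v b'] vanishes and may be subtracted from the
    integral of [U] over [(b', b]]. The remaining integrand compares two values of the kernel whose
    first arguments are at least [s] and differ by at most [b - b']: [s] and [b] after [b'], [b']
    and [b] before. *)
Let bint_diag_le b' b : 0 <= b' -> b' <= b -> b <= a ->
  `|bint I (fun s => if s \in `]b', b]%classic then U s else 0)| <= (b - b') * G b.
Proof.
move=> b'0 b'b ba; have /andP[a0 aT'] := aT.
have bT : b <= T := le_trans ba aT'.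
have bT' : 0 <= b <= T by rewrite bT (le_trans b'0).
have b'T : 0 <= b' <= T by rewrite b'0 (le_trans b'b).
pose Uc s := if s \in `]b', b]%classic then U s else 0.
have nUc : nice Uc by apply: nice_if => //; exact: nice_cst.
have iUc : intg I (fun s => `|Uc s|).
  apply: (intg_le mI) iU _; first exact: nice_norm_measurableD.
  by move=> s _; rewrite normr_id /Uc; case: ifP => // _; rewrite normr0.
have nb := kernel_app_nice vk bT' nv; have nb' := kernel_app_nice vk b'T nv.
have ib := kernel_app_intg vk bT' av; have ib' := kernel_app_intg vk b'T av.
have ibb : intg I (fun s => `|ker b s (v s) - ker b' s (v s)|).
  apply: (intg_le mI) (intgD mI ib ib') _; first by apply: nice_norm_measurableD; exact: niceB.
  by move=> s _; rewrite normr_id ler_normB.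
have -> : bint I Uc = bint I (fun s => Uc s - (ker b s (v s) - ker b' s (v s))).
  rewrite bintB//; last exact: niceB.
  rewrite bintB// -!/(volterra v _) !v0 ?b'0 ?(le_trans b'0)//.
  - by rewrite !subr0.
  - exact: le_trans b'b ba.
have nd : nice (fun s => Uc s - (ker b s (v s) - ker b' s (v s))) by do 2 apply: niceB => //.
have id : intg I (fun s => `|Uc s - (ker b s (v s) - ker b' s (v s))|).
  apply: (intg_le mI) (intgD mI iUc ibb) _; first exact: nice_norm_measurableD.
  by move=> s _; rewrite normr_id ler_normB.
apply: le_trans (bint_norm mI fI nd id) _.
have sub := subset_itv0 bT.
have ivb := intg_sub (measurable_itv _) mI sub iv.
have memP s : (s \in (`]b', b]%classic : set R)) = (b' < s <= b).
  by apply/idP/idP => [/set_mem|H]; [|apply: mem_set]; rewrite /= in_itv.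
rewrite -(rint_sub sub); last first.
  move=> s /=; rewrite !in_itv/= => /andP[s0 sT] /negP; rewrite s0/= => sb.
  rewrite /Uc memP (negbTE sb) andbF (kernel_app_out vk) ?(kernel_app_out vk).
  - by rewrite !subr0 normr0.
  - by move=> [/andP[_ sb'] _]; move/negP: sb; apply; exact: le_trans b'b.
  - by move=> [/andP[_ sb'] _]; move/negP: sb; apply.
rewrite /G -rintZ//; apply: le_rint => //.
- exact: intg_sub id.
- exact: intgZ.
move=> s /=; rewrite in_itv/= => /andP[s0 sb].
have sT := le_trans sb bT.
rewrite mulrA (mulrC _ (kappa s)) /Uc memP sb andbT; case: ltP => b's.
  rewrite (kernel_app_out vk (t := b')); last by case=> /andP[_]; rewrite leNgt b's.
  rewrite subr0 -opprB normrN /U -op_subE (le_trans (op_le _ _))// ler_wpM2r//.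
  apply: le_trans (vk_lip vk (lexx s) sb bT) _.
  by rewrite ler_wpM2l ?(vk_ge0 vk)// lerD2l lerN2 ltW.
rewrite sub0r normrN -op_subE (le_trans (op_le _ _))// ler_wpM2r//.
exact: (vk_lip vk b's b'b bT).
Qed.

(** By Lebesgue's differentiation theorem [e (U s)] is a.e. the derivative of its integral, and the
    difference quotients to the left of [s] are bounded by [G s]. *)
Let dual_diag_le (e : dual E) : (forall x, `|e x| <= `|x|) ->
  {ae @lebesgue_measure R, forall s, 0 < s <= a -> `|e (U s)| <= G s}.
Proof.
move=> e1; have /andP[a0 aT'] := aT.
pose f : R -> R := fun s => e (U s).
have mf : measurable_fun setT f by exact: dual_measurable.
have ifI : intg I f.
  apply: (intg_le mI) iU _; first exact: measurable_funS mf.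
  by move=> s _; exact: e1.
have fout s : ~ I s -> f s = 0.
  by move=> Is; rewrite /f U_out ?dual0// => sT; apply: Is; rewrite /= in_itv.
have ifT : intg setT f.
  have := (integrable_mkcond (mu := @lebesgue_measure R) (EFin \o f) mI).1 ifI.
  congr (leb.-integrable _ _); apply/funext => s; rewrite patchE.
  by case: ifPn => // sI /=; rewrite fout// => Is; move/negP: sI; apply; exact: mem_set.
have locf : locally_integrable setT f by apply: open_integrable_locally => //; exact: openT.
have iy y : leb.-integrable [set` Interval (BLeft 0) (BRight y)] (EFin \o f).
  exact: integrableS ifT.
have := FTC1 iy locf; apply: ae_mono => x + /andP[x0 xa].
move=> H; have [|dF F'] := H; first exact: x0.
set F := (fun y => _) in dF F'.
have FB y : 0 <= y -> y < x -> `|F x - F y| <= (x - y) * G x.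
  move=> y0 yx; have xT := le_trans xa aT'.
  have sub : `]y, x]%classic `<=` I.
    move=> s /=; rewrite !in_itv/= => /andP[ys sx].
    by rewrite (le_trans y0 (ltW ys)) (le_trans sx xT).
  have -> : F x - F y = \int[leb]_(s in `]y, x]) f s.
    rewrite /F (@Rintegral_itvB _ _ (BLeft 0) (BRight x) y)//.
    by rewrite bnd_simp ltW.
  have nUc : nice (fun s => if s \in `]y, x]%classic then U s else 0).
    by apply: nice_if => //; exact: nice_cst.
  have iUc : intg I (fun s => `|if s \in `]y, x]%classic then U s else 0|).
    apply: (intg_le mI) iU _; first exact: nice_norm_measurableD.
    by move=> s _; rewrite normr_id; case: ifP => // _; rewrite normr0.
  apply: le_trans (bint_diag_le y0 (ltW yx) xa); rewrite (le_trans _ (e1 _))//.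
  rewrite (bintP mI fI nUc iUc).
  rewrite -(rint_sub sub); last by move=> s _ sn; rewrite memNset// dual0.
  rewrite le_eqVlt; apply/orP; left; apply/eqP; congr (`|_|).
  by apply: eq_Rintegral => s ss; rewrite ss.
rewrite leNgt; apply/negP => Gf.
have cv : (h^-1 *: (F (h + x) - F x)) @[h --> (0 : R)^'] --> f x.
  have FE : (fun h : R => h^-1 *: ((F \o shift x) (h *: 1) - F x)) = (fun h => h^-1 *: (F (h + x) - F x)).
    by apply/funext => h; rewrite /= [h%:A]mulr1.
  by move: dF; rewrite /derivable FE -F'.
have e0 : 0 < `|f x| - G x by rewrite subr_gt0.
have := cv; move=> /cvgrPdist_lt/(_ _ e0)/nbhs_ballP[d /= d0 Hd].
pose r := Num.min (d / 2) (x / 2).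
have r0 : 0 < r by rewrite lt_min !divr_gt0.
have rd : r < d by rewrite gt_min ltr_pdivrMr// mulr_natr mulr2n ltrDl d0.
have rx : r < x by rewrite gt_min [X in _ || X]ltr_pdivrMr// mulr_natr mulr2n ltrDl x0 orbT.
have := Hd (- r); rewrite /ball/= sub0r opprK gtr0_norm// oppr_eq0 gt_eqF//.
move=> /(_ rd isT); apply/negP; rewrite -leNgt lerBlDr.
have xr : 0 <= - r + x by rewrite addrC subr_ge0 ltW.
have xr' : - r + x < x by rewrite gtrDr oppr_lt0.
have H1 : `|(- r)^-1 *: (F (- r + x) - F x)| <= G x.
  rewrite normrZ normfV normrN gtr0_norm// ler_pdivrMl// distrC.
  by apply: le_trans (FB _ xr xr') _; rewrite opprD opprK addrCA subrr addr0.
apply: le_trans (_ : _ <= `|f x - (- r)^-1 *: (F (- r + x) - F x)| + `|(- r)^-1 *: (F (- r + x) - F x)|) _.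
  by rewrite -{1}(subrK ((- r)^-1 *: (F (- r + x) - F x)) (f x)) ler_normD.
by rewrite lerD2l.
Qed.

(** Functionals norming the points of a countable set close to all values of [U] recover the norm of
    [U s] outside one null set. The bound on the inverse of the diagonal turns it into a bound on
    [v s]. *)
Let diag_le : {ae @lebesgue_measure R, forall s, 0 < s <= a -> `|v s| <= C * G s}.
Proof.
have [d [_ dP]] := nice_dense (fun _ : nat => nU).
have [e eP] := choice (fun j => dual_norming (d j)).
have /andP[a0 aT'] := aT.
have /ae_nat := fun j => dual_diag_le (eP j).1.
move: (vk_inv vk); apply: ae_mono2 => s vs es s0.
have /andP[s0' sa] := s0.
have Us : `|U s| <= G s.
  apply/ler_addgt0Pr => r r0; have [i di] := dP 0%N s (r / 2) (divr_gt0 r0 (ltr0n R 2)).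
  have H1 := es i s0; have [ei1 ei2] := eP i.
  have H2 : `|U s| <= `|U s - d i| + `|d i|.
    by rewrite -{1}(subrK (d i) (U s)) ler_normD.
  have H3 : e i (d i) = e i (U s) - e i (U s - d i) by rewrite dualB subKr.
  have := ler_norm (e i (U s)); have := ei1 (U s - d i); rewrite ler_norml => /andP[H4 _] H5.
  move: H1 H2 H3 H4 H5 di; rewrite ei2; move: (G s) => g; lra.
apply: le_trans (vs _ (v s)) _; first by rewrite (ltW s0') (le_trans sa).
by rewrite ler_wpM2l ?(vk_C vk).
Qed.

(** As [|v| <= C G] a.e., [G t] is at most the integral of [C kappa G] over [[0, t]]. With the
    weight of [C kappa], a bound on [G] by a multiple of [om] can be halved indefinitely, so that
    [G a] vanishes. *)
Lemma volterra_null : {ae @lebesgue_measure R, forall s, 0 <= s <= a -> v s = 0}.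
Proof.
have /andP[a0 aT'] := aT.
have mCk : measurable_fun setT (fun s => C * kappa s).
  by apply: measurable_funM => //; exact: (vk_meas vk).
have [om [com om1 _ omP]] := weight_exists mCk
  (fun s => mulr_ge0 (vk_C vk) (vk_ge0 vk s)) (intgZ mI C ik).
have Gmono t : 0 <= t <= a -> G t <= G a.
  move=> /andP[t0 ta]; apply: rint_subset_le => //.
  - by move=> s /=; rewrite !in_itv/= => /andP[-> st]; rewrite (le_trans st).
  - exact: (intg_sub (measurable_itv _) mI (subset_itv0 aT') iv).
  - by move=> s _; rewrite mulr_ge0// (vk_ge0 vk).
have G0 t : 0 <= G t.
  by apply: Rintegral_ge0 => s _; rewrite mulr_ge0// (vk_ge0 vk).
have s0 : {ae @lebesgue_measure R, forall s, s != 0}.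
  exists [set 0]; split => //; first exact: lebesgue_measure_set1.
  by move=> s /= /negP; rewrite negbK => /eqP.
have P n t : 0 <= t <= a -> G t <= G a * 2^-1 ^+ n * om t.
  elim: n t => [|n IH] t ta; have /andP[t0 ta'] := ta.
    by rewrite expr0 mulr1 (le_trans (Gmono _ ta))// ler_peMr// om1.
  have tT : 0 <= t <= T by rewrite t0 (le_trans ta').
  have [io ole] := omP t tT.
  have mt : measurable (`[0, t]%classic : set R) by [].
  apply: (@le_trans _ _ (\int[leb]_(s in `[0, t]) (G a * 2^-1 ^+ n * (C * kappa s * om s)))).
    apply: rint_ae_le => //.
    - by apply: (intg_sub mt mI _ iv); apply: subset_itv0; case/andP: tT.
    - exact: intgZ.
    move: s0 diag_le; apply: ae_mono2 => s s0 ds /=; rewrite in_itv/= => /andP[s0' st].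
    have sa : 0 <= s <= a by rewrite s0' (le_trans st).
    have vs : `|v s| <= C * G s by apply: ds; rewrite lt_neqAle eq_sym s0 s0' (le_trans st).
    have -> : G a * 2^-1 ^+ n * (C * kappa s * om s) = kappa s * (C * (G a * 2^-1 ^+ n * om s)) by ring.
    rewrite ler_wpM2l ?(vk_ge0 vk)//; apply: le_trans vs _.
    by rewrite ler_wpM2l ?(vk_C vk)//; exact: IH.
  rewrite rintZ// exprSr -!mulrA ler_wpM2l// ler_wpM2l ?exprn_ge0 ?invr_ge0//.
  by rewrite mulrC.
have Ga : G a <= 0.
  apply: (@halving_le0 _ _ (G a * om a)) => n.
  by apply: le_trans (P n a _) _; rewrite ?a0 ?lexx// mulrAC.
move: s0 diag_le; apply: ae_mono2 => s s0 ds /andP[s0' sa].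
apply/eqP; rewrite -normr_le0; apply: le_trans (ds _) _.
  by rewrite lt_neqAle eq_sym s0 s0'.
by rewrite mulr_ge0_le0 ?(vk_C vk)// (le_trans (Gmono s _))// s0'.
Qed.
End null.

Lemma volterra_unique w u a : 0 <= a <= T -> admissible w -> admissible u ->
  (forall t, 0 <= t <= a -> volterra w t = volterra u t) ->
  {ae @lebesgue_measure R, forall s, 0 <= s <= a -> w s = u s}.
Proof.
move=> aT aw au wu; have /andP[a0 aT'] := aT.
have av := admissible_comb vk 1 (-1) aw au.
have v0 t : 0 <= t <= a -> volterra (fun s => 1 *: w s + (-1) *: u s) t = 0.
  move=> ta; have tT : 0 <= t <= T by case/andP: ta => -> ta; rewrite (le_trans ta).
  by rewrite (volterra_comb vk)// wu// scale1r scaleN1r subrr.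
have := volterra_null aT av v0; apply: ae_mono => s H sa.
by have := H sa; rewrite scale1r scaleN1r => /eqP; rewrite subr_eq0 => /eqP.
Qed.
End volterra_uniqueness.

(** * Curves *)

Section continuous_curves.
Context {R : realType} (T : R) (T0 : 0 < T) {E : normedModType R}.
Local Notation I := (`[0, T]%classic : set R).
Local Notation C := (contItv T E).
Implicit Types (x y : C) (t : R).

(* Evaluation, made total by projecting onto [0, T] first. *)
Definition ev x t : E := valL_ 0 (contItv_fun x) (clamp 0 T t).

Let valLE (f : set_type I -> E) (u : set_type I) : valL_ 0 f (val u) = f u.
Proof. exact: (congr1 (@^~ u) (valLK 0 f)). Qed.

Lemma ev_point t : exists u : set_type I, forall x, ev x t = x u.
Proof.
have tI : clamp 0 T t \in I by apply: mem_set; rewrite /= in_itv/= clamp_itv// ltW.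
by exists (exist _ (clamp 0 T t) tI : set_type I) => x; rewrite -valLE.
Qed.

Lemma ev_val x (u : set_type I) : ev x (val u) = x u.
Proof.
have := set_valP u; rewrite /= in_itv/= => uI.
by rewrite /ev clamp_id// valLE.
Qed.

Lemma evD x y t : ev (x + y) t = ev x t + ev y t.
Proof. by have [u uE] := ev_point t; rewrite !uE. Qed.

Lemma evZ (a : R) x t : ev (a *: x) t = a *: ev x t.
Proof. by have [u uE] := ev_point t; rewrite !uE. Qed.

Lemma evB x y t : ev (x - y) t = ev x t - ev y t.
Proof. by have [u uE] := ev_point t; rewrite !uE. Qed.

Lemma ev_continuous x : continuous (ev x).
Proof.
have := contItv_in x; rewrite classical_sets.inE /= => /(@subspace_valL_continuousP' _ _ _ 0) cx.
by apply: clamp_continuous => //; exact: ltW.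
Qed.

Lemma ev_le x t : `|ev x t| <= `|x|.
Proof.
have [u ->] := ev_point t.
have := @segment_compact _ 0 T; move=> /(continuous_compact (continuous_subspaceT (@ev_continuous x))).
move=> /compact_bounded [M [_ xM]].
apply: (@le_sup_image _ _ setT (fun u => `|x u|) (M + 1)) => // v _.
apply: (xM (M + 1)); first by rewrite ltrDl.
by exists (val v); [exact: set_valP|rewrite ev_val].
Qed.

Lemma ev_dist x y t : `|ev x t - ev y t| <= `|x - y|.
Proof. by rewrite -evB ev_le. Qed.

Lemma contItv_norm_le x M : 0 <= M -> (forall t, 0 <= t <= T -> `|ev x t| <= M) -> `|x| <= M.
Proof.
move=> M0 xM; apply: (@sup_image_le _ _ setT (fun u => `|x u|)) => // u _.
by rewrite -(ev_val x u) xM//; have := set_valP u; rewrite /= in_itv.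
Qed.

Lemma ev_inj x y : (forall t, 0 <= t <= T -> ev x t = ev y t) -> x = y.
Proof.
move=> xy; apply/val_inj/funext => u; rewrite -[LHS]ev_val -[RHS]ev_val xy//.
by have := set_valP u; rewrite /= in_itv.
Qed.

Lemma contItv_exists (f : R -> E) :
  (forall t e, 0 <= t <= T -> 0 < e -> exists2 d, 0 < d & forall s, 0 <= s <= T ->
     `|t - s| < d -> `|f t - f s| < e) ->
  exists x : C, forall t, 0 <= t <= T -> ev x t = f t.
Proof.
move=> fe; pose g t := f (clamp 0 T t).
have T0' : 0 <= T := ltW T0.
have cg : continuous g.
  move=> t; apply/cvgrPdist_lt => e e0; have [d d0 Hd] := fe _ e (clamp_itv t T0') e0.
  apply/nbhs_ballP; exists d => // s; rewrite /ball/= => ts.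
  by apply: Hd; [exact: clamp_itv|exact: le_lt_trans (clamp_dist 0 T t s) ts].
have cf : continuous (fun u : set_type I => g (val u)).
  by move=> u; apply: continuous_comp; [exact: initial_continuous|exact: cg].
have cfin : (fun u : set_type I => g (val u)) \in @continuous_on_itv R T E by rewrite classical_sets.inE.
exists (ContItv cfin) => t tT.
have tI : t \in I by apply: mem_set; rewrite /= in_itv.
by rewrite -[t]/(val (exist _ t tI : set_type I)) ev_val /= /g clamp_id.
Qed.

End continuous_curves.

Lemma seq_closed {R : realType} {V : normedModType R} (X : set V) :
  (forall (x_ : nat -> V) x, (forall n, X (x_ n)) -> x_ n @[n --> \oo] --> x -> X x) ->
  closed X.
Proof.
move=> XP x clx; have H n : exists y, X y /\ `|x - y| < n.+1%:R^-1.
  have n0 : 0 < n.+1%:R^-1 :> R by rewrite invr_gt0.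
  have [y [Xy]] := clx _ (nbhsx_ballx x _ n0); by rewrite -ball_normE => xy; exists y.
have [x_ xP] := choice H; apply: (XP x_) => [n|]; first exact: (xP n).1.
apply/cvgrPdist_lt => e e0; near=> n; apply: lt_trans (xP n).2 _.
by near: n; exact: (near_infty_natSinv_lt (PosNum e0)).
Unshelve. all: by end_near. Qed.

Lemma compact_subseq {R : realType} {V : normedModType R} (K : set V) (x_ : nat -> V) :
  compact K -> (forall n, K (x_ n)) ->
  exists x, K x /\ exists2 u : nat -> nat, forall n, (n <= u n)%N & x_ (u n) @[n --> \oo] --> x.
Proof.
move=> cK Kx; have Kn : (x_ @ \oo) K by exists 0%N => // n _; exact: Kx.
have [x [Kx' clx]] := cK (x_ @ \oo) _ Kn.
have H n : exists m, (n <= m)%N /\ `|x - x_ m| < n.+1%:R^-1.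
  have n0 : 0 < n.+1%:R^-1 :> R by rewrite invr_gt0.
  have [||y [[m /= nm <-]]] := clx [set x_ m | m in [set m | (n <= m)%N]] (ball x n.+1%:R^-1).
  - by exists n => // m /= nm; exists m.
  - exact: nbhsx_ballx.
  - by rewrite -ball_normE => xm; exists m.
have [u uP] := choice H; exists x; split => //; exists u => [n|]; first exact: (uP n).1.
apply/cvgrPdist_lt => e e0; near=> n; apply: lt_trans (uP n).2 _.
by near: n; exact: (near_infty_natSinv_lt (PosNum e0)).
Unshelve. all: by end_near. Qed.

(** If continuity failed at [z], images of a sequence tending to [z] would stay away from [f z]. By
    compactness some of them converge, and the closed graph identifies the limit with [f z]. *)
Lemma closed_graph_continuous {R : realType} {U : pseudoMetricType R} {V : normedModType R}
    (A : set U) (K : set V) (f : U -> V) : compact K -> (forall z, A z -> K (f z)) ->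
  (forall (z_ : nat -> U) z y, (forall n, A (z_ n)) -> A z -> z_ n @[n --> \oo] --> z ->
     f (z_ n) @[n --> \oo] --> y -> y = f z) ->
  {within A, continuous f}.
Proof.
move=> cK fK gr; apply/subspace_continuousP => z Az.
apply/cvgrPdist_lt => e e0; apply: contrapT => nH.
have H n : exists z', [/\ A z', ball z n.+1%:R^-1 z' & e <= `|f z - f z'|].
  apply: contrapT => nn; apply: nH; have n0 : 0 < n.+1%:R^-1 :> R by rewrite invr_gt0.
  apply: filterS (nbhsx_ballx z _ n0) => z' zz' Az'; rewrite ltNge; apply/negP => ez'.
  by apply: nn; exists z'.
have [z_ zP] := choice H.
have zz : z_ n @[n --> \oo] --> z.
  apply/cvg_ballP => d d0; near=> n; have [_ + _] := zP n; apply: le_ball.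
  by apply/ltW; near: n; exact: near_infty_natSinv_lt (PosNum d0).
have [y [Ky [u nu fu]]] := compact_subseq cK (fun n => fK _ (let: And3 a _ _ := zP n in a)).
have uoo : u n @[n --> \oo] --> \oo.
  by move=> B [N _ NB]; exists N => // n /= Nn; apply: NB; exact: leq_trans (nu n).
have yE : y = f z.
  apply: (gr (z_ \o u)) => //; first by move=> n; have [] := zP (u n).
  exact: cvg_comp uoo zz.
have /cvgrPdist_lt/(_ e e0)[N _ /(_ N (leqnn N))/=] := fu.
by rewrite yE ltNge; have [_ _ ->] := zP (u N).
Unshelve. all: by end_near. Qed.

(** * The Arzela-Ascoli theorem *)

Section compactness_of_curves.
Context {R : realType} (T : R) (T0 : 0 < T).

(** Proximity up to [r] on a grid of mesh [d / 2], and the oscillation of both curves between grid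
    points, give a distance of at most [3 r]. *)
Lemma cov_curves {E : normedModType R} (X : set (contItv T E)) r : 0 < r ->
  (forall t r, 0 < r -> cov [set ev x t | x in X] r) ->
  (exists2 d, 0 < d & forall x s t, X x -> 0 <= s -> s <= t -> t <= T -> t - s < d ->
     `|ev x t - ev x s| < r) ->
  cov X (4 * r).
Proof.
move=> r0 + [d d0 eqX].
(* The centres have to be equicontinuous as well, hence to belong to [Y]. The induction on the times
   therefore passes to the subsets of curves of [Y] whose value at [t] lies in a given ball. *)
have grid (ts : seq R) (Y : set (contItv T E)) :
    (forall t r, 0 < r -> cov [set ev x t | x in Y] r) ->
    exists l : seq (contItv T E), (forall c, c \in l -> Y c) /\
      forall x, Y x -> exists2 c, c \in l & forall t, t \in ts -> `|ev x t - ev c t| < r.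
  elim: ts Y => [|t ts IH] Y cY.
    have [->|/set0P[y Yy]] := eqVneq Y set0; first by exists [::].
    by exists [:: y]; split => [c|x Yx]; [rewrite mem_seq1 => /eqP->|exists y => //; rewrite mem_seq1].
  have r2 : 0 < r / 2 by rewrite divr_gt0.
  have [m mP] := cY t _ r2.
  have H c : exists l : seq (contItv T E), (forall z, z \in l -> Y z /\ `|ev z t - c| < r / 2) /\
      forall x, Y x -> `|ev x t - c| < r / 2 ->
      exists2 z, z \in l & forall t', t' \in ts -> `|ev x t' - ev z t'| < r.
    have [|l [lY lP]] := IH [set x | Y x /\ `|ev x t - c| < r / 2].
      by move=> t' r' r'0; apply: cov_subset (cY t' r' r'0) => _ [x [Yx _] <-]; exists x.
    by exists l; split => [//|x Yx xc]; exact: lP.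
  have [l_ lP] := choice H.
  exists (flatten [seq l_ c | c <- m]); split.
    by move=> z /flatten_mapP[c _ zc]; exact: ((lP c).1 z zc).1.
  move=> x Yx; have [|c cm xc] := mP (ev x t); first by exists x.
  have [z zc zP] := (lP c).2 x Yx xc.
  exists z; first by apply/flatten_mapP; exists c.
  move=> t'; rewrite in_cons => /predU1P[->|]; last exact: zP.
  have := ((lP c).1 z zc).2; rewrite distrC => zc'.
  by rewrite -(subrKA c) (splitr r) (le_lt_trans (ler_normD _ _))// ltrD.
move=> cX; have d2 : 0 < d / 2 by rewrite divr_gt0.
pose ts := [seq i%:R * (d / 2) | i <- iota 0 (Num.truncn (T / (d / 2))).+1].
have tsP t : 0 <= t <= T -> exists2 t', t' \in ts & [/\ 0 <= t', t' <= t & t - t' < d].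
  move=> /andP[t0 tT]; have td : 0 <= t / (d / 2) by rewrite divr_ge0// ltW.
  exists ((Num.truncn (t / (d / 2)))%:R * (d / 2)).
    apply/mapP; exists (Num.truncn (t / (d / 2))) => //; rewrite mem_iota/= add0n ltnS le_truncn//.
    by rewrite ler_pM2r ?invr_gt0.
  have /andP[A1 A2] := truncn_itv td.
  rewrite ler_pdivlMr// in A1; rewrite ltr_pdivrMr// in A2.
  split => //; first by rewrite mulr_ge0// ltW.
  move: A2; rewrite -addn1 natrD mulrDl mul1r; move: (_%:R * _) => t'; lra.
have [l [lX lP]] := grid ts X cX.
exists l => x Xx; have [c cl xc] := lP x Xx; exists c => //.
apply: (@le_lt_trans _ _ (3 * r)); last by rewrite ltr_pM2r// ltr_nat.
apply: contItv_norm_le => // [|t tT]; first by rewrite mulr_ge0// ltW.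
have [t' t'ts [t'0 t't td]] := tsP t tT; have /andP[_ tT'] := tT.
rewrite evB//; have H1 := eqX x t' t Xx t'0 t't tT' td.
have := eqX c t' t (lX c cl) t'0 t't tT' td; rewrite distrC => H2.
have H3 := xc t' t'ts.
have -> : ev x t - ev c t = (ev x t - ev x t') + (ev x t' - ev c t') + (ev c t' - ev c t).
  by rewrite subrKA subrKA.
have := ler_normD ((ev x t - ev x t') + (ev x t' - ev c t')) (ev c t' - ev c t).
have := ler_normD (ev x t - ev x t') (ev x t' - ev c t').
move: H1 H2 H3; lra.
Qed.

Lemma ultra_cov {V : choiceType} (F : set_system V) (l : seq V) (B : V -> set V) (X : set V) :
  UltraFilter F -> F X -> (forall x, X x -> exists2 c, c \in l & B c x) ->
  exists c, F (B c).
Proof.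
move=> UF; elim: l X => [|c l IH] X FX XB.
  by have [x /XB[]] := filter_ex FX.
have [|FB] := in_ultra_setVsetC (B c) UF; first by exists c.
have [|x [Xx Bx]|c' Fc'] := IH (X `&` ~` B c); [exact: filterI| |by exists c'].
have [c'] := XB x Xx; rewrite in_cons => /predU1P[->//|c'l]; by exists c'.
Qed.

(** An ultrafilter on a totally bounded set contains arbitrarily small balls. It thus converges at
    each time, because [E] is complete, and uniformly, so that the limit is a continuous curve. *)
Lemma compact_curves {E : completeNormedModType R} (X : set (contItv T E)) :
  closed X -> (forall r, 0 < r -> cov X r) -> compact X.
Proof.
move=> clX cX; rewrite compact_ultra => F UF FX.
have ball_F r : 0 < r -> exists c, F (ball c r).
  move=> r0; have [l lP] := cX r r0.
  apply: (ultra_cov (l := l) (X := X)) => // x /lP[c cl xc]; exists c => //.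
  by rewrite -ball_normE/= distrC.
have cF t : cvg ((fun x => ev x t) @ F).
  apply/cauchy_cvgP/cauchy_exP => r r0.
  have [c Fc] := ball_F r r0; exists (ev c t).
  suff : F [set x | ball (ev c t) r (ev x t)] by [].
  apply: filterS Fc => x; rewrite -!ball_normE/= => xc.
  exact: le_lt_trans (ev_dist T0 c x t) xc.
pose phi t := lim ((fun x => ev x t) @ F).
have phiP r c : F (ball c r) -> forall t, `|phi t - ev c t| <= r.
  move=> Fc t.
  have cv : `|ev x t - ev c t| @[x --> F] --> `|phi t - ev c t|.
    by apply: cvg_norm; apply: cvgB; [exact: cF|exact: cvg_cst].
  rewrite -(cvg_lim (@Rhausdorff R) cv); apply: limr_le; first by apply/cvg_ex; eexists; exact: cv.
  apply: filterS Fc => x; rewrite -!ball_normE => xc.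
  by apply: le_trans (ev_dist T0 x c t) _; rewrite distrC; exact: ltW.
have [|x xphi] := @contItv_exists _ _ T0 _ phi.
  move=> t e tT e0; have e4 : 0 < e / 4 by rewrite divr_gt0.
  have [c /phiP cphi] := ball_F _ e4.
  have /cvgrPdist_lt/(_ _ e4)/nbhs_ballP[d /= d0 Hd] := @ev_continuous _ _ T0 _ c t.
  exists d => // s sT ts; have := Hd s ts; have H1 := cphi t; have := cphi s.
  rewrite distrC => H2 H3.
  have -> : phi t - phi s = (phi t - ev c t) + (ev c t - ev c s) + (ev c s - phi s).
    by rewrite subrKA subrKA.
  have := ler_normD ((phi t - ev c t) + (ev c t - ev c s)) (ev c s - phi s).
  have := ler_normD (phi t - ev c t) (ev c t - ev c s).
  move: H1 H2 H3 e0; lra.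
have Fx : F --> x.
  apply/cvgrPdist_lt => e e0; have e4 : 0 < e / 4 by rewrite divr_gt0.
  have [c Fc] := ball_F _ e4; apply: filterS (Fc) => y; rewrite -ball_normE => yc.
  have H1 : `|x - c| <= e / 4.
    apply: (contItv_norm_le); first exact: ltW.
    by move=> t tT; rewrite evB// xphi//; exact: phiP.
  have H2 : `|c - y| < e / 4 by exact: yc.
  rewrite -(subrKA c); apply: le_lt_trans (ler_normD _ _) _.
  apply: lt_le_trans (ler_ltD H1 H2) _.
  by rewrite -mulrDr ler_piMr ?(ltW e0)//; lra.
exists x; split => //; apply: clX => B /Fx FB.
by have [y [Xy By]] := filter_ex (filterI FX FB); exists y.
Qed.
End compactness_of_curves.

(** * Closed convex hulls and selections *)

Section closed_convex_hull.
Context {R : realType} {E : normedModType R}.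
Implicit Types (A B : set E).

Definition chull A : set E := [set y | forall B, closed B -> cvx B -> A `<=` B -> B y].

Lemma chull_closed A : closed (chull A).
Proof.
move=> y cly B clB cB AB; apply: (clB) => U /cly[z [zA Uz]].
by exists z; split => //; apply: (zA B).
Qed.

Lemma chull_cvx A : cvx (chull A).
Proof. by move=> a x y a0 a1 Ax Ay B clB cB AB; apply: (cB) => //; [apply: Ax|apply: Ay]. Qed.

Lemma sub_chull A : A `<=` chull A.
Proof. by move=> y Ay B _ _; apply. Qed.

Lemma chull_sub A B : closed B -> cvx B -> A `<=` B -> chull A `<=` B.
Proof. by move=> clB cB AB y; apply. Qed.

Lemma chull_mono A B : A `<=` B -> chull A `<=` chull B.
Proof. by move=> AB y Ay B' clB cB BB; apply: Ay => // z /AB /BB. Qed.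

(** The points at distance at most [r] from a zonotope containing the centres form a closed convex
    set, which contains [A] and thus its hull; the zonotope is totally bounded. *)
Lemma cov_chull A r r' : cov A r -> r < r' -> cov (chull A) r'.
Proof.
move=> [l lA] rr'; pose Z : set E := zonotope (size l) (fun i => l`_i) 1.
pose B := [set y : E | forall e, 0 < e -> exists2 z, Z z & `|y - z| < r + e].
have e0 : 0 < (r' - r) / 2 by rewrite divr_gt0 ?subr_gt0.
have -> : r' = (r' - r) / 2 + (r + (r' - r) / 2).
  by rewrite addrCA -splitr subrKC.
apply: (cov_near (cov_zonotope (size l) (fun i => l`_i) 1 e0)) => y.
suff : chull A `<=` B by move=> AB /AB /(_ _ e0)[z Zz yz]; exists z => //; exact: ltW.
apply: chull_sub.
- move=> y' cly e e'0; have e2 : 0 < e / 2 by rewrite divr_gt0.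
  have [y1 [/(_ _ e2)[z Zz yz]]] := cly _ (nbhsx_ballx y' _ e2).
  rewrite -ball_normE/= => yy; exists z => //.
  have := ler_normD (y' - y1) (y1 - z); rewrite subrKA; lra.
- move=> a x1 x2 a0 a1 B1 B2 e e'0.
  have [z1 Z1 xz1] := B1 e e'0; have [z2 Z2 xz2] := B2 e e'0.
  exists (a *: z1 + (1 - a) *: z2); first exact: cvx_zonotope.
  have -> : a *: x1 + (1 - a) *: x2 - (a *: z1 + (1 - a) *: z2) =
    a *: (x1 - z1) + (1 - a) *: (x2 - z2).
    by rewrite !scalerBr opprD addrACA.
  have a1' : 0 <= 1 - a by rewrite subr_ge0.
  apply: le_lt_trans (ler_normD _ _) _; rewrite !normrZ !ger0_norm//.
  have [->|a_neq0] := eqVneq a 0; first by rewrite mul0r add0r subr0 mul1r.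
  have a_gt0 : 0 < a by rewrite lt_neqAle eq_sym a_neq0.
  have -> : r + e = a * (r + e) + (1 - a) * (r + e) by rewrite -mulrDl subrKC mul1r.
  by rewrite ltr_leD// ?ltr_pM2l// ler_wpM2l// ltW.
- move=> y' Ay e e'0; have [c cl yc] := lA y' Ay.
  by exists c; [exact: zonotope_mem|rewrite (lt_trans yc)// ltrDl].
Qed.

(** A point [y] outside [G x] is separated from it by a functional. Upper hemicontinuity keeps the
    values of [G] near [x] in a half-space that misses [y], and a closed half-space contains their
    closed convex hull. *)
Lemma uhc_limit (G : E -> set E) x y : upper_hemicontinuous G ->
  closed (G x) -> cvx (G x) -> G x !=set0 ->
  (forall r, 0 < r -> chull [set z | exists2 x', `|x' - x| < r & G x' z] y) -> G x y.
Proof.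
move=> uG clG cG [z0 Gz0] yG; apply: clG => U /nbhs_ballP[d /= d0 dU].
apply: contrapT => nU.
have dG c : G x c -> d <= `|y - c|.
  move=> Gc; rewrite leNgt; apply/negP => yc; apply: nU; exists c; split => //.
  by apply: dU; rewrite -ball_normE.
have [||||e [_ eP]] := @dual_separation _ _ [set y - c | c in G x] d.
- move=> a _ _ a0 a1 [c1 G1 <-] [c2 G2 <-]; exists (a *: c1 + (1 - a) *: c2).
    exact: cG.
  by rewrite !scalerBr addrACA -scalerDl subrKC scale1r opprD.
- by exists (y - z0), z0.
- exact: ltW.
- by move=> _ [c Gc <-]; exact: dG.
(* Strictly between [e y] and the supremum of [e] on [G x], which is at most [e y - d]. *)
pose a := e y - d / 2.
have xa : (ereal_sup [set (e c)%:E | c in G x] < a%:E)%E.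
  apply: le_lt_trans (_ : (e y - d)%:E < a%:E)%E.
    apply: ge_ereal_sup => _ [c Gc <-]; rewrite lee_fin.
    by have := eP (y - c) (ex_intro2 _ _ c Gc erefl); rewrite dualB; lra.
  by rewrite lte_fin /a ltrD2l ltrN2; lra.
have /nbhs_ballP[r /= r0 rP] := uG e x a xa.
have [] : ~ (e y <= a) by rewrite /a; move: d0; lra.
apply: (yG r r0 [set z | e z <= a]).
- apply: (@closed_comp _ _ e [set z | z <= a]); last exact: closed_le.
  by move=> z _; exact: dual_continuous.
- move=> l z1 z2 l0 l1 /= H1 H2; rewrite dualD !dualZ.
  have -> : a = l * a + (1 - l) * a by rewrite -mulrDl subrKC mul1r.
  by rewrite lerD// ler_wpM2l// subr_ge0.
- move=> z [x' xx' Gz] /=.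
  have := rP x'; rewrite -ball_normE/= distrC => /(_ xx') H.
  rewrite -lee_fin; apply: le_trans (ltW H).
  by apply: ereal_sup_ubound; exists z.
Qed.

End closed_convex_hull.

Section density_limits.
Context {R : realType} {E : completeNormedModType R} (T : R).
Variables (ker : R -> R -> boundedOp E E) (kappa : R -> R) (C : R).
Hypotheses (vk : volterra_kernel T ker kappa C).
Local Notation I := (`[0, T]%classic : set R).
Let mI : measurable I := measurable_itv _.
Let fI : (leb I < +oo)%E := leb_itv_lty 0 T.
Local Notation volterra := (volterra T ker).
Local Notation admissible := (admissible T kappa).
Implicit Types (z : nat -> R -> E) (w : R -> E) (b : R -> R).

Lemma admissible_bound w b : nice w -> (forall s, `|w s| <= b s) ->
  intg I (fun s => kappa s * b s) -> admissible w.
Proof.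
move=> nw wb ib; split => //; apply: (intg_le mI (kappa_norm_measurable vk nw) ib) => s _.
by rewrite ger0_norm ?mulr_ge0 ?(vk_ge0 vk)// ler_wpM2l ?(vk_ge0 vk).
Qed.

(** Convex combinations of tails converge a.e. A closed convex set that contains a tail of [z m s]
    therefore contains [w s], which is how all pointwise constraints pass to the limit; the operator
    being linear, the combinations keep the limit of its values. *)
Lemma density_limit z b : (forall n, nice (z n)) -> (forall n s, `|z n s| <= b s) ->
  measurable_fun setT b -> intg I b -> intg I (fun s => kappa s * b s) ->
  {ae @lebesgue_measure R, forall s, I s -> forall r, 0 < r -> cov (range (z ^~ s)) r} ->
  exists w, [/\ nice w, forall s, `|w s| <= b s,
    {ae @lebesgue_measure R, forall s, I s -> forall M B, closed B -> cvx B ->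
      (forall m, (M <= m)%N -> B (z m s)) -> B (w s)} &
    forall t l, 0 <= t <= T -> volterra (z n) t @[n --> \oo] --> l -> volterra w t = l].
Proof.
move=> nz zb mb ib ikb tz.
have [v [w0 [nw0 nv vb vw]]] := convex_compactness mI fI nz zb ib tz.
(* The limit inherits the bound only a.e.; it is set to zero elsewhere. *)
pose A := [set s | `|w0 s| <= b s].
pose w s := if s \in A then w0 s else 0.
have mA : measurable A by apply: measurable_set_le => //; exact: nice_norm_measurable.
have nw : nice w by apply: nice_if => //; exact: nice_cst.
have b0 s : 0 <= b s by apply: le_trans (zb 0%N s).
have wb s : `|w s| <= b s.
  by rewrite /w; case: ifPn => [/set_mem//|_]; rewrite normr0.
have ww0 : {ae @lebesgue_measure R, forall s, I s -> w s = w0 s}.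
  move: vw; apply: ae_mono => s vw Is; rewrite /w mem_set// /A/=.
  have cv : `|v n s| @[n --> \oo] --> `|w0 s| by apply: cvg_norm; exact: vw.
  rewrite -(cvg_lim (@Rhausdorff R) cv); apply: limr_le; last exact: nearW.
  by apply/cvg_ex; eexists; exact: cv.
exists w; split => //.
  move: vw ww0; apply: ae_mono2 => s vw ww0 Is M B clB cB zB.
  rewrite ww0//; apply: (closed_cvg B clB (F := \oo) (u_ := v ^~ s)); last exact: vw.
  exists M => // n /= Mn.
  apply: (cvx_hull_sub (C := [set f : R -> E | B (f s)]) _ _ (nv n).2).
    by move=> a f g a0 a1 /= Bf Bg; apply: cB.
  by move=> _ [m /= nm <-] /=; apply: zB; exact: leq_trans nm.
move=> t l tT zl.
have [//|aw0 vw0] := volterra_dct vk tT (fun n => (nv n).1) nw0 mb ikb vb _.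
have -> : volterra w t = volterra w0 t.
  symmetry; apply: (volterra_ae_eq vk) => //.
  move: ww0; apply: ae_mono => s ww0 /andP[s0 st]; rewrite ww0//= in_itv/= s0.
  by case/andP: tT => _; exact: le_trans.
apply: (@cvg_unique E (@norm_hausdorff _ E) (volterra (v n) t @[n --> \oo]) _ _ _ vw0).
apply/cvgrPdist_le => e e0.
have /cvgrPdist_le/(_ e e0)[M _ MP] := zl.
exists M => // n /= Mn.
(* Convex by linearity of the operator, and containing a tail of [z]: so it contains [v n]. *)
pose Q := [set f : R -> E | admissible f /\ `|l - volterra f t| <= e].
suff : Q (v n) by case.
apply: (cvx_hull_sub (C := Q) _ _ (nv n).2).
  move=> a f g a0 a1 [af lf] [ag lg]; split; first exact: (admissible_comb vk).
  rewrite (volterra_comb vk)//.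
  have -> : l - (a *: volterra f t + (1 - a) *: volterra g t) =
      a *: (l - volterra f t) + (1 - a) *: (l - volterra g t).
    by rewrite !scalerBr addrACA -scalerDl subrKC scale1r opprD.
  have a1' : 0 <= 1 - a by rewrite subr_ge0.
  apply: le_trans (ler_normD _ _) _; rewrite !normrZ !ger0_norm//.
  have -> : e = a * e + (1 - a) * e by rewrite -mulrDl subrKC mul1r.
  by rewrite lerD// ler_wpM2l.
move=> _ [m /= nm <-]; split; first exact: (admissible_bound (nz m) (zb m) ikb).
by apply: MP => /=; exact: leq_trans nm.
Qed.

End density_limits.

Lemma ae_mono3 {R : realType} (P Q S U : R -> Prop) :
  (forall t, P t -> Q t -> S t -> U t) ->
  {ae @lebesgue_measure R, forall t, P t} -> {ae @lebesgue_measure R, forall t, Q t} ->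
  {ae @lebesgue_measure R, forall t, S t} -> {ae @lebesgue_measure R, forall t, U t}.
Proof. by move=> PQSU; apply: filterS3. Qed.

(** Greedy choice: the balls around the points chosen so far never cover [A]. *)
Lemma separated_sequence {R : realType} {E : normedModType R} (A : set E) r : ~ cov A r ->
  exists y : nat -> E, (forall n, A (y n)) /\ forall n m, (n < m)%N -> r <= `|y m - y n|.
Proof.
move=> nA; have H (l : seq E) : exists y, A y /\ forall c, c \in l -> r <= `|y - c|.
  apply: contrapT => nH; apply: nA; exists l => y Ay; apply: contrapT => nc.
  by apply: nH; exists y; split => // c cl; rewrite leNgt; apply/negP => yc; apply: nc; exists c.
have [f fP] := choice H; pose L := fix L n := if n is n'.+1 then f (L n') :: L n' else [::].
exists (fun n => f (L n)); split => [n|n m nm]; first exact: (fP _).1.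
apply: (fP (L m)).2; elim: m nm => // m IH; rewrite ltnS leq_eqVlt in_cons => /predU1P[->|/IH ->].
  by rewrite eqxx.
by rewrite orbT.
Qed.

Lemma compact_cov {R : realType} {E : normedModType R} (K : set E) r : compact K -> 0 < r -> cov K r.
Proof.
move=> cK r0; apply: contrapT => /separated_sequence[y [Ky yr]].
have [x [_ [u nu ux]]] := compact_subseq cK Ky.
have r2 : 0 < r / 2 by rewrite divr_gt0.
have /cvgrPdist_lt/(_ _ r2)[N _ NP] := ux.
have := NP N (leqnn N); have := NP (u N).+1 (leqW (nu N)).
have := yr (u N) (u (u N).+1) (nu _) => /=.
have := ler_normB (x - y (u N)) (x - y (u (u N).+1)).
rewrite opprB addrC subrKA; lra.
Qed.

Lemma nice_piecewise {R : realType} {E : normedModType R} (p : R -> nat) (g : nat -> R -> E) :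
  (forall i, measurable [set s | p s = i]) -> (forall i, nice (g i)) ->
  nice (fun s => g (p s) s).
Proof.
move=> mp ng; have [d [_ dP]] := nice_dense ng.
apply: (nice_of_dist (d := d)) => [j|t e e0]; last exact: dP.
move=> _ B mB; rewrite setTI.
rewrite (_ : _ @^-1` B = \bigcup_i ([set s | p s = i] `&` (fun s => `|g i s - d j|) @^-1` B)).
  apply: bigcup_measurable => i _; apply: measurableI => //.
  by rewrite -[X in measurable X]setTI; exact: nice_dist_measurable.
apply/seteqP; split => s /=; first by exists (p s).
by move=> [i _ [<-]].
Qed.

Lemma truncn_measurable {R : realType} (a : R) i : measurable [set s : R | Num.truncn (s * a) = i].
Proof.
have m1 n : measurable [set s : R | (Num.truncn (s * a) <= n)%N].
  under eq_set do rewrite truncn_le_nat.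
  by apply: measurable_set_lt => //; apply: measurable_funM.
case: i => [|i].
  rewrite (_ : [set s | _] = [set s | (Num.truncn (s * a) <= 0)%N])//.
  by apply/seteqP; split => s /=; rewrite leqn0 => /eqP.
rewrite (_ : [set s | _] = [set s | (Num.truncn (s * a) <= i.+1)%N] `\`
    [set s | (Num.truncn (s * a) <= i)%N]).
  by apply: measurableD.
apply/seteqP; split => s /=; first by move=> ->; rewrite leqnn ltnn.
by move=> [H1 /negP]; rewrite -ltnNge => H2; apply/eqP; rewrite eqn_leq H1.
Qed.

(** The hypotheses on the field, with measurable nonnegative bounds whose products with [kappa] are
    integrable. The null set in [af_sel] depends on [x] and that in [af_cov] on [Omega], so that
    both are applied to countable families only. *)
Record admissible_field {R : realType} {E : normedModType R} (T : R) (kappa : R -> R)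
    (F : R -> E -> set E) (c eta : R -> R) := {
  af_c_meas : measurable_fun setT c;
  af_c_ge0 : forall s, 0 <= c s;
  af_c_intg : intg `[0, T] c;
  af_kc_intg : intg `[0, T] (fun s => kappa s * c s);
  af_eta_meas : measurable_fun setT eta;
  af_eta_ge0 : forall s, 0 <= eta s;
  af_keta_intg : intg `[0, T] (fun s => kappa s * eta s);
  af_ne : forall s x, 0 <= s <= T -> F s x !=set0;
  af_closed : forall s x, 0 <= s <= T -> closed (F s x);
  af_cvx : forall s x, 0 <= s <= T -> cvx (F s x);
  af_sel : forall x, exists f, nice f /\
    {ae @lebesgue_measure R, forall s, 0 <= s <= T -> F s x (f s)};
  af_uhc : {ae @lebesgue_measure R, forall s, 0 <= s <= T -> upper_hemicontinuous (F s)};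
  af_bound : {ae @lebesgue_measure R, forall s, 0 <= s <= T ->
    forall x y, F s x y -> `|y| <= c s * (1 + `|x|)};
  af_cov : forall Omega M, (forall x, Omega x -> `|x| <= M) ->
    {ae @lebesgue_measure R, forall s, 0 <= s <= T -> forall r r', 0 < r ->
      cov Omega r -> eta s * r < r' -> cov (\bigcup_(x in Omega) F s x) r'} }.

(** * Selections of the field along a curve *)

Section selection.
Context {R : realType} {E : completeNormedModType R} (T : R).
Variables (ker : R -> R -> boundedOp E E) (kappa : R -> R) (C : R).
Hypotheses (T0 : 0 < T) (vk : volterra_kernel T ker kappa C).
Variables (F : R -> E -> set E) (c eta : R -> R).
Hypothesis af : admissible_field T kappa F c eta.
Local Notation I := (`[0, T]%classic : set R).
Let mI : measurable I := measurable_itv _.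
Let fI : (leb I < +oo)%E := leb_itv_lty 0 T.

Lemma bound_intg (B : R) : [/\ measurable_fun setT (fun s => c s * B),
  intg I (fun s => c s * B) & intg I (fun s => kappa s * (c s * B))].
Proof.
split.
- by apply: measurable_funM => //; exact: (af_c_meas af).
- rewrite (_ : (fun s => c s * B) = fun s => B * c s); last by apply/funext => s; ring.
  by apply: intgZ => //; exact: (af_c_intg af).
- rewrite (_ : (fun s => _) = fun s => B * (kappa s * c s)); last by apply/funext => s; ring.
  by apply: intgZ => //; exact: (af_kc_intg af).
Qed.

(** A compact set is covered at every radius, and [af_cov] multiplies the radius by the finite
    number [eta s] only. *)
Lemma field_cov_compact (K : set E) : compact K ->
  {ae @lebesgue_measure R, forall s, 0 <= s <= T -> forall r, 0 < r ->
    cov (\bigcup_(x in K) F s x) r}.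
Proof.
move=> cK; have [M [_ KM]] := compact_bounded cK.
have KM1 x : K x -> `|x| <= M + 1 by move=> Kx; apply: KM => //; rewrite ltrDl.
have := af_cov af KM1; apply: ae_mono => s H sT r r0.
have e0 := af_eta_ge0 af s.
have r1 : 0 < r / (eta s + 1) by rewrite divr_gt0// ltr_wpDl.
apply: (H sT _ _ r1 (compact_cov cK r1)).
by rewrite mulrA ltr_pdivrMr ?ltr_wpDl// mulrC ltr_pM2l// ltrDl.
Qed.

(** Freezing [x] on the intervals of a grid of mesh [1 / (m + 1)] involves countably many points,
    for which [af_sel] provides selections. Their values lie in the totally bounded image of the
    compact range of [x], so that a limit density exists; upper hemicontinuity puts it into the
    field along [x]. *)
Lemma selection_exists (x : contItv T E) : exists w, [/\ nice w,
  forall s, `|w s| <= c s * (1 + `|x|) &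
  {ae @lebesgue_measure R, forall s, 0 <= s <= T -> F s (ev x s) (w s)}].
Proof.
have [g gP] := choice (fun y => af_sel af y).
pose tau m i : R := i%:R / m.+1%:R.
pose p m (s : R) := Num.truncn (s * m.+1%:R).
pose u m (s : R) := g (ev x (tau m (p m s))) s.
pose A m := [set s : R | `|u m s| <= c s * (1 + `|x|)].
pose z m (s : R) := if s \in A m then u m s else 0.
have [mb ib ikb] := bound_intg (1 + `|x|).
have b0 s : 0 <= c s * (1 + `|x|) by rewrite mulr_ge0 ?(af_c_ge0 af)// addr_ge0.
have nu m : nice (u m).
  apply: (nice_piecewise (p := p m) (g := fun i => g (ev x (tau m i)))).
    by move=> i; exact: truncn_measurable.
  by move=> i; exact: (gP _).1.
have nz m : nice (z m).
  apply: nice_if; [|exact: nu|exact: nice_cst].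
  by apply: measurable_set_le => //; exact: nice_norm_measurable.
have zb m s : `|z m s| <= c s * (1 + `|x|).
  by rewrite /z; case: ifPn => [/set_mem//|_]; rewrite normr0.
have zF : {ae @lebesgue_measure R, forall s, 0 <= s <= T -> forall m,
    F s (ev x (tau m (p m s))) (z m s)}.
  have H1 := ae_nat (fun m => ae_nat (fun i => (gP (ev x (tau m i))).2)).
  move: (af_bound af) H1; apply: ae_mono2 => s sb H sT m.
  have Fu := H m (p m s) sT.
  rewrite /z mem_set//; apply: le_trans (sb sT _ _ Fu) _.
  by rewrite ler_wpM2l ?(af_c_ge0 af)// lerD2l ev_le.
have taus s m : 0 <= s <= T -> `|s - tau m (p m s)| < m.+1%:R^-1.
  move=> /andP[s0 sT]; have m0 : 0 < m.+1%:R :> R by [].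
  have /truncn_itv/andP[] : 0 <= s * m.+1%:R by rewrite mulr_ge0.
  rewrite -/(p m s) -ler_pdivrMr// -ltr_pdivlMr// -/(tau m (p m s)) => H1 H2.
  rewrite ger0_norm ?subr_ge0// ltrBlDl; apply: lt_le_trans H2 _.
  by rewrite -addn1 natrD mulrDl mul1r.
have cK : compact (ev x @` I).
  by apply: continuous_compact; [apply: continuous_subspaceT; exact: ev_continuous|exact: segment_compact].
have evI t : (ev x @` I) (ev x t).
  exists (clamp 0 T t); first by rewrite /= in_itv/= clamp_itv// ltW.
  by rewrite /ev (clamp_id (clamp_itv t (ltW T0))).
have tz : {ae @lebesgue_measure R, forall s, I s -> forall r, 0 < r -> cov (range (z ^~ s)) r}.
  move: zF (field_cov_compact cK); apply: ae_mono2 => s zF sc; rewrite /= in_itv/= => sT r r0.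
  apply: cov_subset (sc sT r r0) => _ [m _ <-]; exists (ev x (tau m (p m s))); first exact: evI.
  exact: zF.
have [w [nw wb wz _]] := density_limit vk nz zb mb ib ikb tz.
exists w; split => //.
move: zF (af_uhc af) wz; apply: ae_mono3 => s zF' us wz sT.
have Is : I s by rewrite /= in_itv.
apply: (uhc_limit (us sT)).
- exact: (af_closed af).
- exact: (af_cvx af).
- exact: (af_ne af).
move=> r r0; have /cvgrPdist_lt/(_ _ r0)/nbhs_ballP[d /= d0 Hd] := @ev_continuous _ _ T0 _ x s.
have [M _ MP] := near_infty_natSinv_lt (PosNum d0).
apply: (wz Is M) => [||m Mm]; [exact: chull_closed|exact: chull_cvx|].
apply: sub_chull; exists (ev x (tau m (p m s))); last exact: zF'.
rewrite distrC; apply: Hd; rewrite /ball/=.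
by apply: lt_trans (taus s m sT) _; exact: MP.
Qed.

End selection.

(** * The compact invariant set *)

Lemma curve_unif_continuous {R : realType} {E : normedModType R} (T : R) (T0 : 0 < T)
    (x : contItv T E) e : 0 < e -> exists2 d, 0 < d &
  forall s t, 0 <= s <= T -> 0 <= t <= T -> `|s - t| < d -> `|ev x s - ev x t| < e.
Proof.
move=> e0; apply: contrapT => nH.
have H n : exists st : R * R, [/\ 0 <= st.1 <= T, 0 <= st.2 <= T, `|st.1 - st.2| < n.+1%:R^-1 &
    e <= `|ev x st.1 - ev x st.2|].
  apply: contrapT => nn; apply: nH; exists n.+1%:R^-1; first by rewrite invr_gt0.
  by move=> s t sT tT st; rewrite ltNge; apply/negP => ex; apply: nn; exists (s, t).
have [st stP] := choice H.
have [n|s [_ [u nu us]]] := @compact_subseq R R^o `[0, T]%classic (fun n => (st n).1) (@segment_compact _ 0 T).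
  by have [] := stP n; rewrite /= in_itv.
have e2 : 0 < e / 2 by rewrite divr_gt0.
have /cvgrPdist_lt/(_ _ e2)/nbhs_ballP[d /= d0 Hd] := @ev_continuous _ _ T0 _ x s.
have d2 : 0 < d / 2 by rewrite divr_gt0.
have [N _ NP] := near_infty_natSinv_lt (PosNum d2).
have /cvgrPdist_lt/(_ _ d2)[N' _ N'P] := us.
pose n := maxn N N'; have [_ _ d1 ee] := stP (u n).
have sd1 : `|s - (st (u n)).1| < d / 2 by apply: N'P; exact: leq_maxr.
have sd2 : `|(st (u n)).1 - (st (u n)).2| < d / 2.
  by apply: lt_trans d1 _; apply: NP => /=; apply: leq_trans (nu n); exact: leq_maxl.
have H1 : `|ev x s - ev x (st (u n)).1| < e / 2.
  by apply: Hd; rewrite /ball/= (lt_trans sd1)// ltr_pdivrMr// mulr_natr mulr2n ltrDl.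
have H2 : `|ev x s - ev x (st (u n)).2| < e / 2.
  apply: Hd; rewrite /ball/=; have := ler_normD (s - (st (u n)).1) ((st (u n)).1 - (st (u n)).2).
  rewrite subrKA; move: sd1 sd2; lra.
have := ler_normB (ev x s - ev x (st (u n)).2) (ev x s - ev x (st (u n)).1).
rewrite opprB addrC subrKA; move: H1 H2 ee; lra.
Qed.

Section invariant_set.
Context {R : realType} {E : completeNormedModType R} (T : R).
Variables (ker : R -> R -> boundedOp E E) (kappa : R -> R) (C : R).
Hypotheses (T0 : 0 < T) (vk : volterra_kernel T ker kappa C).
Variables (F : R -> E -> set E) (c eta : R -> R).
Hypothesis af : admissible_field T kappa F c eta.
Variable omega : R -> R.
Hypotheses (om1 : forall t, 0 <= t -> 1 <= omega t)
  (omT : forall t, t <= T -> omega t <= omega T)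
  (omc : forall t, 0 <= t <= T -> intg `[0, t] (fun s => kappa s * c s * omega s) /\
     \int[leb]_(s in `[0, t]) (kappa s * c s * omega s) <= omega t / 2)
  (ome : forall t, 0 <= t <= T -> intg `[0, t] (fun s => kappa s * eta s * omega s) /\
     \int[leb]_(s in `[0, t]) (kappa s * eta s * omega s) <= omega t / 8).
Variable h : contItv T E.
Local Notation I := (`[0, T]%classic : set R).
Let mI : measurable I := measurable_itv _.
Let fI : (leb I < +oo)%E := leb_itv_lty 0 T.
Local Notation volterra := (volterra T ker).
Local Notation admissible := (admissible T kappa).
Implicit Types (x : contItv T E) (w : R -> E) (X : set (contItv T E)).

Definition density x w := nice w /\ forall t, 0 <= t <= T -> ev x t = ev h t + volterra w t.

Definition slice X s : set E := [set ev x s | x in X].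

Definition field_hull X s : set E := chull (\bigcup_(y in slice X s) F s y).

Definition step X := [set x : contItv T E | exists w, density x w /\
  {ae @lebesgue_measure R, forall s, 0 <= s <= T -> field_hull X s (w s)}].

Definition inclusion_solution := [set x : contItv T E | exists w, density x w /\
  {ae @lebesgue_measure R, forall s, 0 <= s <= T -> F s (ev x s) (w s)}].

(** As [omega >= 1], this constant satisfies [1 + |h| + r0 omega / 2 <= r0 omega], so that the bound
    [r0 omega] reproduces itself. *)
Let r0 := 2 * (1 + `|h|).

Definition curve_bound s := c s * (r0 * omega T).

(** An a priori bound and a common modulus of continuity of [x - h]. Both conditions are closed and
    convex and refer to no density, so that they survive the passage to closed convex hulls. *)
Definition barrier := [set x : contItv T E | (forall t, 0 <= t <= T -> 1 + `|ev x t| <= r0 * omega t) /\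
  forall a b, 0 <= a -> a <= b -> b <= T ->
    `|(ev x b - ev h b) - (ev x a - ev h a)| <= modulus T (fun s => kappa s * curve_bound s) a b].

Let r0_ge0 : 0 <= r0. Proof. by rewrite mulr_ge0// addr_ge0. Qed.

Let om0 t : 0 <= t -> 0 <= omega t. Proof. by move=> t0; apply: le_trans (om1 t0). Qed.

Lemma curve_bound_ge0 s : 0 <= curve_bound s.
Proof. by rewrite mulr_ge0 ?(af_c_ge0 af)// mulr_ge0// om0// ltW. Qed.

(** Limits of densities require a bound at every time. A density bounded a.e. is altered on a null
    set, which does not change its integrals. *)
Lemma truncate_density w : nice w ->
  {ae @lebesgue_measure R, forall s, 0 <= s <= T -> `|w s| <= curve_bound s} ->
  exists w', [/\ nice w', forall s, `|w' s| <= curve_bound s,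
    {ae @lebesgue_measure R, forall s, 0 <= s <= T -> w' s = w s},
    admissible w' & forall t, 0 <= t <= T -> volterra w' t = volterra w t].
Proof.
move=> nw wb; pose A := [set s | `|w s| <= curve_bound s].
have [mb ib ikb] := bound_intg af (r0 * omega T).
have nw' : nice (fun s => if s \in A then w s else 0).
  apply: nice_if => //; last exact: nice_cst.
  by apply: measurable_set_le => //; exact: nice_norm_measurable.
have w'b s : `|if s \in A then w s else 0| <= curve_bound s.
  by case: ifPn => [/set_mem//|_]; rewrite normr0 curve_bound_ge0.
have aw' : admissible (fun s => if s \in A then w s else 0).
  exact: (admissible_bound vk nw' w'b ikb).
have ww' : {ae @lebesgue_measure R, forall s, 0 <= s <= T -> (if s \in A then w s else 0) = w s}.
  by move: wb; apply: ae_mono => s wb sT; rewrite mem_set//; exact: wb.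
exists (fun s => if s \in A then w s else 0); split => // t tT.
apply: (volterra_ae_eq vk) => //; move: ww'; apply: ae_mono => s ww' /andP[s0 st].
by rewrite ww'// s0 (le_trans st)//; case/andP: tT.
Qed.

Lemma volterra_weight w K t : admissible w -> 0 <= K -> 0 <= t <= T ->
  {ae @lebesgue_measure R, forall s, 0 <= s <= T -> `|w s| <= c s * (K * omega s)} ->
  `|volterra w t| <= K * omega t / 2.
Proof.
move=> aw K0 tT wK; apply: le_trans (volterra_norm vk tT aw) _.
have [ic lc] := omc tT; have /andP[_ tT'] := tT.
have mt : measurable (`[0, t]%classic : set R) := measurable_itv _.
apply: (@le_trans _ _ (\int[leb]_(s in `[0, t]) (K * (kappa s * c s * omega s)))).
  apply: rint_ae_le => //.
  - exact: (intg_sub mt mI (subset_itv0 tT') aw.2).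
  - exact: intgZ.
  move: wK; apply: ae_mono => s wK /=; rewrite in_itv/= => /andP[s0 st].
  have -> : K * (kappa s * c s * omega s) = kappa s * (c s * (K * omega s)) by ring.
  by rewrite ler_wpM2l ?(vk_ge0 vk)// wK// s0 (le_trans st).
by rewrite rintZ// -mulrA ler_wpM2l.
Qed.

Lemma density_barrier x w : density x w ->
  {ae @lebesgue_measure R, forall s, 0 <= s <= T -> `|w s| <= c s * (r0 * omega s)} ->
  barrier x.
Proof.
move=> [nw xw] wb; have [mb ib ikb] := bound_intg af (r0 * omega T).
have [|w' [nw' w'b ww' aw' vw']] := truncate_density nw.
  move: wb; apply: ae_mono => s wb sT; apply: le_trans (wb sT) _.
  have /andP[_ sT'] := sT; rewrite /curve_bound ler_wpM2l ?(af_c_ge0 af)//.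
  by rewrite ler_wpM2l// omT.
split => [t tT|a b a0 ab bT].
  have H1 : `|volterra w' t| <= r0 * omega t / 2.
    apply: volterra_weight => //; move: ww' wb; apply: ae_mono2 => s ws wb sT.
    by rewrite ws//; exact: wb.
  rewrite xw// -vw'//; have := ler_normD (ev h t) (volterra w' t).
  have := ev_le T0 h t; have H2 : r0 <= r0 * omega t by rewrite ler_peMr// om1//; case/andP: tT.
  move: H1 H2; rewrite /r0; move: (_ * omega t) => z; lra.
have aT : 0 <= a <= T by rewrite a0 (le_trans ab).
have bT' : 0 <= b <= T by rewrite bT (le_trans a0).
rewrite !xw// -!vw'// !(addrC (ev h _)) !addrK.
apply: (volterra_modulus vk) => // s _.
by rewrite ler_wpM2l ?(vk_ge0 vk).
Qed.

Lemma field_hull_bound X : X `<=` barrier ->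
  {ae @lebesgue_measure R, forall s, 0 <= s <= T -> forall y, field_hull X s y ->
    `|y| <= c s * (r0 * omega s)}.
Proof.
move=> XB; move: (af_bound af); apply: ae_mono => s sb sT y.
suff : field_hull X s `<=` [set y | `|y| <= c s * (r0 * omega s)] by apply.
apply: chull_sub.
- apply: (@closed_comp _ _ (@Num.norm R E) [set z | z <= _]); last exact: closed_le.
  by move=> z _; exact: norm_continuous.
- move=> a y1 y2 a0 a1 /= H1 H2; apply: le_trans (ler_normD _ _) _.
  have a1' : 0 <= 1 - a by rewrite subr_ge0.
  rewrite !normrZ !ger0_norm//.
  have -> : c s * (r0 * omega s) = a * (c s * (r0 * omega s)) + (1 - a) * (c s * (r0 * omega s)).
    by rewrite -mulrDl subrKC mul1r.
  by rewrite lerD// ler_wpM2l.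
- move=> y' [_ [x Xx <-] Fy]; apply: le_trans (sb sT _ _ Fy) _.
  by rewrite ler_wpM2l ?(af_c_ge0 af)//; exact: (XB x Xx).1.
Qed.

Lemma step_barrier X : X `<=` barrier -> step X `<=` barrier.
Proof.
move=> XB x [w [xw wX]]; apply: (density_barrier xw).
by move: (field_hull_bound XB) wX; apply: ae_mono2 => s sb wX sT; apply: sb => //; exact: wX.
Qed.

(** The norm of the solution gives a crude bound to start from. Each application of the integral
    equation halves its excess over [r0 omega], which therefore disappears. *)
Lemma solution_barrier : inclusion_solution `<=` barrier.
Proof.
move=> x [w [xw wF]]; have [nw xwE] := xw.
have wb : {ae @lebesgue_measure R, forall s, 0 <= s <= T -> `|w s| <= c s * (1 + `|ev x s|)}.
  by move: (af_bound af) wF; apply: ae_mono2 => s sb wF sT; apply: sb => //; exact: wF.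
have [mb ib ikb] := bound_intg af (1 + `|x|).
have aw : admissible w.
  split => //; apply: (intg_ae mI (kappa_norm_measurable vk nw) ikb).
  move: wb; apply: ae_mono => s wb /=; rewrite in_itv/= => sT.
  rewrite ger0_norm ?mulr_ge0 ?(vk_ge0 vk)// ler_wpM2l ?(vk_ge0 vk)//.
  by apply: le_trans (wb sT) _; rewrite ler_wpM2l ?(af_c_ge0 af)// lerD2l ev_le.
have P n t : 0 <= t <= T -> 1 + `|ev x t| <= (r0 + (1 + `|x|) * 2^-1 ^+ n) * omega t.
  elim: n t => [|n IH] t tT; have /andP[t0 tT'] := tT.
    rewrite expr0 mulr1 mulrDl; apply: ler_wpDl; first by rewrite mulr_ge0// om0.
    apply: (@le_trans _ _ (1 + `|x|)); first by rewrite lerD2l ev_le.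
    by rewrite ler_peMr ?om1// addr_ge0.
  have K0 : 0 <= r0 + (1 + `|x|) * 2^-1 ^+ n.
    by rewrite addr_ge0// mulr_ge0 ?addr_ge0// exprn_ge0// invr_ge0.
  have H1 : `|volterra w t| <= (r0 + (1 + `|x|) * 2^-1 ^+ n) * omega t / 2.
    apply: volterra_weight => //; move: wb; apply: ae_mono => s wb sT.
    by apply: le_trans (wb sT) _; rewrite ler_wpM2l ?(af_c_ge0 af)//; exact: IH.
  rewrite xwE//; have := ler_normD (ev h t) (volterra w t); have := ev_le T0 h t.
  have H2 : r0 <= r0 * omega t by rewrite ler_peMr// om1.
  have -> : (r0 + (1 + `|x|) * 2^-1 ^+ n.+1) * omega t = r0 * omega t + (1 + `|x|) * 2^-1 ^+ n * omega t / 2.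
    by rewrite exprSr; ring.
  move: H1 H2; rewrite mulrDl /r0; move: (_ * omega t) (_ * _ * omega t) => z z'; lra.
apply: (density_barrier xw); move: wb; apply: ae_mono => s wb sT.
apply: le_trans (wb sT) _; rewrite ler_wpM2l ?(af_c_ge0 af)//.
rewrite -subr_le0; apply: (@halving_le0 _ _ ((1 + `|x|) * omega s)) => n.
by have := P n s sT; rewrite mulrDl [(1 + `|x|) * _ * _]mulrAC -lerBlDl.
Qed.

Lemma barrier_equicontinuous e : 0 < e -> exists2 d, 0 < d & forall x s t, barrier x ->
  0 <= s <= T -> 0 <= t <= T -> `|s - t| < d -> `|ev x s - ev x t| < e.
Proof.
move=> e0; have e2 : 0 < e / 2 by rewrite divr_gt0.
have [d1 d10 H1] := curve_unif_continuous T0 h e2.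
have [_ _ ikb] := bound_intg af (r0 * omega T).
have [d2 d20 H2] := modulus_small ikb e2.
exists (Num.min d1 d2); first by rewrite lt_min d10.
suff H x s t : barrier x -> 0 <= s -> s <= t -> t <= T -> t - s < Num.min d1 d2 ->
    `|ev x t - ev x s| < e.
  move=> x s t Bx /andP[s0 sT] /andP[t0 tT]; have [st|st] := leP s t.
    by rewrite distrC ger0_norm ?subr_ge0// => st'; rewrite distrC; exact: H.
  by rewrite ger0_norm ?subr_ge0 ?ltW// => st'; apply: H => //; exact: ltW.
move=> [_ Bx] s0 st tT; rewrite lt_min => /andP[st1 st2].
have sT : 0 <= s <= T by rewrite s0 (le_trans st).
have tT' : 0 <= t <= T by rewrite tT (le_trans s0).
have A1 := H1 t s tT' sT; rewrite ger0_norm ?subr_ge0// in A1.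
have := le_lt_trans (Bx s t s0 st tT) (H2 s t s0 st tT st2).
have := A1 st1; have := ler_normD (ev h t - ev h s) ((ev x t - ev h t) - (ev x s - ev h s)).
have -> : ev h t - ev h s + (ev x t - ev h t - (ev x s - ev h s)) = ev x t - ev x s.
  by rewrite opprB addrACA addKr addrCA subrr addr0.
lra.
Qed.

Lemma barrier_closed : closed barrier.
Proof.
apply: seq_closed => x_ x Bx xx.
have cv t : ev (x_ n) t @[n --> \oo] --> ev x t.
  apply/cvgrPdist_lt => e e0; have /cvgrPdist_lt/(_ _ e0)[N _ NP] := xx.
  by exists N => // n Nn; apply: le_lt_trans (ev_dist T0 _ _ _) _; exact: NP.
split => [t tT|a b a0 ab bT].
  have cv' : 1 + `|ev (x_ n) t| @[n --> \oo] --> 1 + `|ev x t|.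
    by apply: cvgD; [exact: cvg_cst|exact: cvg_norm].
  rewrite -(cvg_lim (@Rhausdorff R) cv'); apply: limr_le.
    by apply/cvg_ex; eexists; exact: cv'.
  by apply: nearW => n; exact: (Bx n).1.
have cv' : `|(ev (x_ n) b - ev h b) - (ev (x_ n) a - ev h a)| @[n --> \oo] -->
    `|(ev x b - ev h b) - (ev x a - ev h a)|.
  by apply: cvg_norm; do ![apply: cvgB]; do ?[exact: cv|exact: cvg_cst].
rewrite -(cvg_lim (@Rhausdorff R) cv'); apply: limr_le.
  by apply/cvg_ex; eexists; exact: cv'.
by apply: nearW => n; exact: (Bx n).2.
Qed.

Lemma barrier_cvx : cvx barrier.
Proof.
move=> l x y l0 l1 [x1 x2] [y1 y2]; have l1' : 0 <= 1 - l by rewrite subr_ge0.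
split => [t tT|a b a0 ab bT].
  rewrite evD// !evZ//; apply: (@le_trans _ _ (l * (1 + `|ev x t|) + (1 - l) * (1 + `|ev y t|))).
    have := ler_normD (l *: ev x t) ((1 - l) *: ev y t); rewrite !normrZ !ger0_norm//.
    rewrite !(mulrDr _ 1) !mulr1; move: (l * `|ev x t|) ((1 - l) * `|ev y t|) => z z'; lra.
  have -> : r0 * omega t = l * (r0 * omega t) + (1 - l) * (r0 * omega t) by rewrite -mulrDl subrKC mul1r.
  by rewrite lerD// ler_wpM2l//; [exact: x1|exact: y1].
set M := modulus _ _ _ _.
have -> : M = l * M + (1 - l) * M by rewrite -mulrDl subrKC mul1r.
have -> : ev (l *: x + (1 - l) *: y) b - ev h b - (ev (l *: x + (1 - l) *: y) a - ev h a) =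
    l *: ((ev x b - ev h b) - (ev x a - ev h a)) + (1 - l) *: ((ev y b - ev h b) - (ev y a - ev h a)).
  rewrite -!evB//.
  have -> : l *: x + (1 - l) *: y - h = l *: (x - h) + (1 - l) *: (y - h).
    by rewrite !scalerBr addrACA -opprD -scalerDl subrKC scale1r.
  move: (x - h) (y - h) => X Y.
  by rewrite !evD// !evZ// !scalerBr opprD addrACA.
apply: le_trans (ler_normD _ _) _; rewrite !normrZ !ger0_norm//.
by rewrite lerD// ler_wpM2l//; [exact: x2|exact: y2].
Qed.
End invariant_set.

Lemma separated_not_cov {R : realType} {E : normedModType R} (y : nat -> E) r :
  (forall n m, (n < m)%N -> r <= `|y m - y n|) -> ~ cov (range y) (r / 2).
Proof.
move=> yr [l lP]; have H n : exists c, c \in l /\ `|y n - c| < r / 2.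
  by have [|c cl yc] := lP (y n); [exists n|exists c].
have [f fP] := choice H.
have [n [m [nm fnm]]] : exists n m, (n < m)%N /\ f n = f m.
  apply: contrapT => nE; have /(uniq_leq_size) : uniq [seq f i | i <- iota 0 (size l).+1].
    rewrite map_inj_in_uniq ?iota_uniq// => n m _ _ fnm.
    have [nm|mn|//] := ltngtP n m; exfalso; apply: nE; first by exists n, m.
    by exists m, n.
  move=> /(_ l); rewrite size_map size_iota ltnn => H'.
  by have /(_ _)/notF : _ -> false := H' ; apply => _ /mapP[i _ ->]; exact: (fP i).1.
have := yr n m nm; have := (fP n).2; have := (fP m).2; rewrite fnm.
have := ler_normB (y m - f m) (y n - f m); rewrite opprB addrA subrK; lra.
Qed.

(** * Compactness of the smallest invariant set *)

Section minimal_set.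
Context {R : realType} {E : completeNormedModType R} (T : R).
Variables (ker : R -> R -> boundedOp E E) (kappa : R -> R) (C : R).
Hypotheses (T0 : 0 < T) (vk : volterra_kernel T ker kappa C).
Variables (F : R -> E -> set E) (c eta : R -> R).
Hypothesis af : admissible_field T kappa F c eta.
Variable omega : R -> R.
Hypotheses (om1 : forall t, 0 <= t -> 1 <= omega t)
  (omT : forall t, t <= T -> omega t <= omega T)
  (omc : forall t, 0 <= t <= T -> intg `[0, t] (fun s => kappa s * c s * omega s) /\
     \int[leb]_(s in `[0, t]) (kappa s * c s * omega s) <= omega t / 2)
  (ome : forall t, 0 <= t <= T -> intg `[0, t] (fun s => kappa s * eta s * omega s) /\
     \int[leb]_(s in `[0, t]) (kappa s * eta s * omega s) <= omega t / 8).
Variable h : contItv T E.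
Local Notation I := (`[0, T]%classic : set R).
Let mI : measurable I := measurable_itv _.
Let fI : (leb I < +oo)%E := leb_itv_lty 0 T.
Local Notation volterra := (volterra T ker).
Local Notation admissible := (admissible T kappa).
Local Notation barrier := (barrier kappa c omega h).
Local Notation step := (step ker F h).
Local Notation solution := (inclusion_solution ker F h).
Local Notation bnd := (curve_bound c omega h).
Implicit Types (x : contItv T E) (w : R -> E) (X Z : set (contItv T E)).

(** Inclusion in [barrier] builds in boundedness and equicontinuity. The curve [h] keeps the set
    nonempty before any solution is known to exist. *)
Definition invariant X := [/\ closed X, cvx X, X `<=` barrier, step X `<=` X
  & solution `<=` X /\ X h].

Definition minimal_set : set (contItv T E) := [set x | forall X, invariant X -> X x].

Lemma barrier_h : barrier h.
Proof.
split => [t /andP[t0 tT]|a b a0 ab bT].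
  have := om1 t0; have := ev_le T0 h t; have H0 := normr_ge0 h.
  move=> H1 H2; have : 1 + `|h| <= (1 + `|h|) * omega t by rewrite ler_peMr// addr_ge0.
  by rewrite -mulrA; move: (_ * omega t) H1 => z; lra.
rewrite !subrr normr0 /modulus addr_ge0//.
  rewrite mulr_ge0 ?subr_ge0//; apply: Rintegral_ge0 => s _.
  by rewrite mulr_ge0 ?(vk_ge0 vk)// (curve_bound_ge0 T0 af om1).
by apply: Rintegral_ge0 => s _; rewrite mulr_ge0 ?(vk_ge0 vk)// (curve_bound_ge0 T0 af om1).
Qed.

Lemma step_mono X Z : X `<=` Z -> step X `<=` step Z.
Proof.
move=> XZ x [w [xw wX]]; exists w; split => //; move: wX; apply: ae_mono => s wX sT.
apply: chull_mono (wX sT) => y [_ [z Xz <-] Fy]; exists (ev z s) => //.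
by exists z => //; exact: XZ.
Qed.

Lemma invariant_barrier : invariant barrier.
Proof.
split.
- exact: barrier_closed.
- exact: barrier_cvx.
- by [].
- exact: (step_barrier T0 vk af om1 omT omc (h := h)).
- by split; [exact: (solution_barrier T0 vk af om1 omT omc (h := h))|exact: barrier_h].
Qed.

Lemma invariant_minimal : invariant minimal_set.
Proof.
split.
- move=> x clx X iX; have [clX _ _ _ _] := iX; apply: (clX) => U /clx[z [zX Uz]].
  by exists z; split => //; apply: (zX X).
- move=> l x y l0 l1 Xx Xy X iX; have [_ cX _ _ _] := iX.
  by apply: (cX) => //; [apply: Xx|apply: Xy].
- by move=> x; apply; exact: invariant_barrier.
- move=> x sx X iX; have [_ _ _ sX _] := iX; apply: sX.
  by apply: step_mono sx => z; apply.
- split => [x sx X iX|X iX]; have [_ _ _ _ [sX Xh]] := iX; last exact: Xh.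
  exact: sX.
Qed.

Lemma solution_step X : solution `<=` X -> solution `<=` step X.
Proof.
move=> SX x xS; have Xx := SX x xS; have [w [xw wF]] := xS.
exists w; split => //; move: wF; apply: ae_mono => s wF sT; apply: sub_chull.
by exists (ev x s); [exists x|exact: wF].
Qed.

(** The intersection of [Z] with the smallest invariant set is invariant: the solutions belong to it
    since each of them is produced by [step] from the solutions themselves. *)
Lemma minimal_set_sub Z : closed Z -> cvx Z -> step minimal_set `<=` Z -> Z h ->
  minimal_set `<=` Z.
Proof.
move=> clZ cZ sZ Zh; have [clX cX bX sX [solX Xh]] := invariant_minimal.
suff iZ : invariant (Z `&` minimal_set) by move=> x /(_ _ iZ)[].
split.
- exact: closedI.
- by move=> l x y l0 l1 [Zx Xx] [Zy Xy]; split; [exact: cZ|exact: cX].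
- by move=> x [_ /bX].
- move=> x sx; have : step minimal_set x by apply: step_mono sx => z [].
  by move=> sx'; split; [exact: sZ|exact: sX].
- split=> // x xS; split; last exact: solX.
  by apply: sZ; exact: (solution_step solX).
Qed.

Let P m := forall t r, 0 <= t <= T -> m * omega t < r -> cov (slice minimal_set t) r.

Let om0 t : 0 <= t -> 0 <= omega t. Proof. by move=> t0; apply: le_trans (om1 t0). Qed.

(** The slice varies with [s], while the null set of [af_cov] depends on the set. The hypothesis is
    applied to the countably many sets [Om n i] of values of the curves near the time [i / (n + 1)];
    by equicontinuity they are close to the slice at a time [s] nearby. *)
Lemma field_cov m : 0 <= m -> P m ->
  {ae @lebesgue_measure R, forall s, 0 <= s <= T -> forall r, eta s * (m * omega s) < r ->
    cov (\bigcup_(y in slice minimal_set s) F s y) r}.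
Proof.
move=> m0 Pm; have [_ _ bX _ _] := invariant_minimal.
pose Om n i := [set y | exists x s, [/\ minimal_set x, 0 <= s <= T,
   `|s - i%:R / n.+1%:R| < n.+1%:R^-1 & y = ev x s]].
pose M := 2 * (1 + `|h|) * omega T.
have OmM n i y : Om n i y -> `|y| <= M.
  move=> [x [s [Xx /andP[s0 sT] _ ->]]]; have := (bX x Xx).1 s; rewrite s0 sT => /(_ isT) H.
  apply: (@le_trans _ _ (1 + `|ev x s|)); first by rewrite lerDr.
  by apply: le_trans H _; rewrite ler_wpM2l ?mulr_ge0 ?addr_ge0// omT.
have := ae_nat (fun n => ae_nat (fun i => af_cov af (@OmM n i))).
apply: ae_mono => s H sT r rr; have /andP[s0 sT'] := sT.
have e0 := af_eta_ge0 af s; have e1 : 0 < eta s + 1 by rewrite ltr_wpDl.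
(* Small enough that enlarging the radius [m omega s] by [d] keeps its product with [eta s] below
   [r]; half of [d] goes to the cover of the slice and half to equicontinuity. *)
pose d := (r - eta s * (m * omega s)) / (eta s + 1) / 2.
have d0 : 0 < d by rewrite !divr_gt0// subr_gt0.
have d2 : 0 < d / 2 by rewrite divr_gt0.
pose r1 := m * omega s + d.
have r10 : 0 < r1 by rewrite ltr_wpDl// mulr_ge0// om0.
have er1 : eta s * r1 < r.
  have -> : eta s * r1 = eta s * (m * omega s) + eta s * d by rewrite mulrDr.
  rewrite -ltrBrDl; apply: (@le_lt_trans _ _ ((eta s + 1) * d)).
    by rewrite ler_wpM2r ?(ltW d0)// lerDl.
  rewrite /d mulrA (mulrC (eta s + 1)) divfK ?gt_eqF//.
  by rewrite ltr_pdivrMr// mulr_natr mulr2n ltrDl subr_gt0.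
have [b b0 Hb] := barrier_equicontinuous T0 af omega h d2.
have b2 : 0 < b / 2 by rewrite divr_gt0.
have [n _ /(_ n (leqnn n))/= nb] := near_infty_natSinv_lt (PosNum b2).
have nb' : n.+1%:R^-1 < b / 2 := nb.
pose i := Num.truncn (s * n.+1%:R).
have si : `|s - i%:R / n.+1%:R| < n.+1%:R^-1.
  have n0 : 0 < n.+1%:R :> R by [].
  have /truncn_itv/andP[] : 0 <= s * n.+1%:R by rewrite mulr_ge0.
  rewrite -/i -ler_pdivrMr// -ltr_pdivlMr// => H1 H2.
  rewrite ger0_norm ?subr_ge0// ltrBlDl; apply: lt_le_trans H2 _.
  by rewrite -addn1 natrD mulrDl mul1r.
apply: cov_subset (H n i sT r1 r r10 _ er1).
  by move=> y [_ [x Xx <-] Fy]; exists (ev x s) => //; exists x, s.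
have -> : r1 = m * omega s + d / 2 + d / 2 by rewrite -addrA -splitr.
apply: (cov_near (B := slice minimal_set s)).
  by apply: Pm => //; rewrite ltrDl.
move=> _ [x [s' [Xx s'T s'i ->]]]; exists (ev x s); first by exists x.
apply/ltW/(Hb x) => //; first exact: bX.
have := ler_normB (s' - i%:R / n.+1%:R) (s - i%:R / n.+1%:R); rewrite opprB addrA subrK.
move: si s'i nb'; move: (n.+1%:R^-1) => z; lra.
Qed.

(** The slice lies in the closed convex hull of [ev h t] and of the slice of [step minimal_set], by
    minimality, and hulls do not increase noncompactness. If the latter slice were not covered, it
    would contain a separated sequence of integrals, against the estimate for integrals of
    sequences. *)
Lemma halving m : 0 <= m -> P m -> P (m / 2).
Proof.
move=> m0 Pm t r tT tr; have [clX cX bX sX [solX Xh]] := invariant_minimal.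
have /andP[t0 tT'] := tT; have mt : measurable (`[0, t]%classic : set R) := measurable_itv _.
have ft := leb_itv_lty 0 t.
pose r1 := (m / 2 * omega t + r) / 2.
have r1l : m / 2 * omega t < r1 by rewrite /r1; move: tr; move: (_ * omega t) => z; lra.
have r1r : r1 < r by rewrite /r1; move: tr; move: (_ * omega t) => z; lra.
have cN : cov (slice (step minimal_set) t) r1.
  apply: contrapT => /separated_sequence[y [yN ysep]].
  have H n : exists w, [/\ nice w, forall s, `|w s| <= bnd s,
      {ae @lebesgue_measure R, forall s, 0 <= s <= T -> field_hull F minimal_set s (w s)} &
      y n = ev h t + volterra w t].
    have [x [w [[nw xw] wX]] <-] := yN n.
    have [|w' [nw' w'b ww' aw' vw']] := truncate_density T0 vk af om1 (h := h) nw.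
      move: (field_hull_bound af bX) wX; apply: ae_mono2 => s sb wX sT.
      apply: le_trans (sb sT _ (wX sT)) _.
      rewrite ler_wpM2l ?(af_c_ge0 af)// ler_wpM2l ?mulr_ge0 ?addr_ge0// omT//.
      by case/andP: sT.
    exists w'; split => //; last by rewrite vw'// xw.
    by move: ww' wX; apply: ae_mono2 => s ws wX sT; rewrite ws//; exact: wX.
  have [w_ wP] := choice H.
  have [_ _ ikb] := bound_intg af (2 * (1 + `|h|) * omega T).
  have ikbt := intg_sub mt mI (subset_itv0 tT') ikb.
  have [ie le] := ome tT.
  pose rho s := m * (kappa s * eta s * omega s).
  have irho : intg `[0, t] rho by apply: intgZ.
  have nk n : nice (fun s => ker t s (w_ n s)).
    by apply: (kernel_app_nice vk) => //; have [] := wP n.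
  have kb n s : `|ker t s (w_ n s)| <= kappa s * bnd s.
    apply: le_trans (kernel_app_le vk _ _ tT') _.
    by rewrite ler_wpM2l ?(vk_ge0 vk)//; have [_ ->] := wP n.
  have crho : {ae @lebesgue_measure R, forall s, `[0, t]%classic s -> forall r, rho s < r ->
      cov (range (fun n => ker t s (w_ n s))) r}.
    have wX := ae_nat (fun n => let: And4 _ _ b _ := wP n in b).
    move: (field_cov m0 Pm) wX; apply: ae_mono2 => s cs wX; rewrite /= in_itv/= => /andP[s0 st] r2 rr2.
    have sT : 0 <= s <= T by rewrite s0 (le_trans st).
    have k0 := vk_ge0 vk s; have k1 : 0 < kappa s + 1 by rewrite ltr_wpDl.
    pose d := (r2 - rho s) / (kappa s + 1) / 2.
    have d0 : 0 < d by rewrite !divr_gt0// subr_gt0.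
    have d2 : 0 < d / 2 by rewrite divr_gt0.
    have kd : kappa s * (eta s * (m * omega s) + d) < r2.
      have -> : kappa s * (eta s * (m * omega s) + d) = rho s + kappa s * d by rewrite /rho; ring.
      rewrite -ltrBrDl; apply: (@le_lt_trans _ _ ((kappa s + 1) * d)).
        by rewrite ler_wpM2r ?(ltW d0)// lerDl.
      rewrite /d mulrA (mulrC (kappa s + 1)) divfK ?gt_eqF//.
      by rewrite ltr_pdivrMr// mulr_natr mulr2n ltrDl subr_gt0.
    have h1 : eta s * (m * omega s) < eta s * (m * omega s) + d / 2 by rewrite ltrDl.
    have h2 : eta s * (m * omega s) + d / 2 < eta s * (m * omega s) + d.
      by rewrite ltrD2l ltr_pdivrMr// mulr_natr mulr2n ltrDl.
    have [l lP] := cov_chull (cs sT _ h1) h2.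
    exists [seq ker t s z | z <- l] => _ [n _ <-].
    have [z zl wz] := lP _ (wX n sT).
    exists (ker t s z); first exact: map_f.
    rewrite -opB; apply: le_lt_trans (op_le _ _) _; apply: le_lt_trans kd.
    by apply: ler_pM => //; [exact: (vk_bound vk)|exact: ltW].
  (* The weight gives [\int rho <= m omega t / 8]. One factor 2 is lost in the estimate for
     sequences of integrals, another because a sequence separated by [r1] is only known not to be
     covered at radius [r1 / 2]. *)
  have r12 : 2 * \int[leb]_(s in `[0, t]) rho s < r1 / 2.
    rewrite rintZ//; have := ler_wpM2l m0 le; move: (m * \int[_]_(_ in _) _) => z.
    move: r1l; rewrite mulrA -(mulrA m) (mulrC _ (omega t)) mulrA.
    move: (m * omega t) => z'; lra.
  have := bint_cov mt ft nk kb ikbt irho crho r12.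
  have /separated_not_cov : forall n n', (n < n')%N -> r1 <=
      `|(fun n => bint `[0, t] (fun s => ker t s (w_ n s))) n' - bint `[0, t] (fun s => ker t s (w_ n s))|.
    move=> n n' nn'; apply: le_trans (ysep n n' nn') _.
    have [nw1 wb1 _ ->] := wP n; have [nw2 wb2 _ ->] := wP n'.
    have H2 w' : nice w' -> (forall s, `|w' s| <= bnd s) ->
        bint `[0, t] (fun s => ker t s (w' s)) = volterra w' t.
      move=> nw' wb'; apply: bint_sub => //.
      - exact: subset_itv0.
      - exact: (kernel_app_nice vk).
      - exact: (kernel_app_intg vk tT (admissible_bound vk nw' wb' ikb)).
      - move=> s Is sn; apply: (kernel_app_out vk) => -[st _]; apply: sn.
        by rewrite /= in_itv.
    by rewrite !H2// opprD addrACA subrr add0r.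
  by [].
have cNh : cov (slice (step minimal_set) t `|` [set ev h t]) r1.
  have [l lP] := cN; exists (ev h t :: l) => y [/lP[z zl yz]|->].
    by exists z => //; rewrite in_cons zl orbT.
  exists (ev h t); first by rewrite mem_head.
  rewrite subrr normr0; apply: le_lt_trans r1l.
  by rewrite mulr_ge0 ?om0// divr_ge0.
apply: cov_subset (cov_chull cNh r1r) => _ [x Xx <-].
pose Z := [set x : contItv T E | chull (slice (step minimal_set) t `|` [set ev h t]) (ev x t)].
suff : minimal_set `<=` Z by apply.
apply: minimal_set_sub.
- apply: seq_closed => x_ x' Zx xx; apply: (closed_cvg _ (@chull_closed _ _ _) (F := \oo) (u_ := fun n => ev (x_ n) t)).
    exact: nearW.
  apply/cvgrPdist_lt => e e0; have /cvgrPdist_lt/(_ _ e0)[N _ NP] := xx.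
  by exists N => // n Nn; apply: le_lt_trans (ev_dist T0 _ _ _) _; exact: NP.
- by move=> l x1 x2 l0 l1 Z1 Z2; rewrite /Z/= evD// !evZ//; exact: chull_cvx.
- by move=> x' sx'; apply: sub_chull; left; exists x'.
- by apply: sub_chull; right.
Qed.

Lemma slice_cov t r : 0 <= t <= T -> 0 < r -> cov (slice minimal_set t) r.
Proof.
move=> tT r0'; have [_ _ bX _ _] := invariant_minimal; have /andP[t0 _] := tT.
pose m0 := 2 * (1 + `|h|); have m00 : 0 <= m0 by rewrite mulr_ge0// addr_ge0.
have P0 : P m0.
  move=> s r' sT rr; exists [:: 0] => _ [x Xx <-]; exists 0; first by rewrite mem_head.
  rewrite subr0; apply: le_lt_trans rr; apply: le_trans ((bX x Xx).1 s sT).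
  by rewrite lerDr.
have Pn n : P (m0 * 2^-1 ^+ n).
  elim: n => [|n IH]; first by rewrite expr0 mulr1.
  rewrite exprSr mulrA; apply: halving => //.
  by rewrite mulr_ge0// exprn_ge0// invr_ge0.
have [n nr] : exists n, m0 * 2^-1 ^+ n * omega t < r.
  apply: contrapT => nE; have : r <= 0.
    apply: (@halving_le0 _ _ (m0 * omega t)) => n; rewrite leNgt; apply/negP => H.
    by apply: nE; exists n; rewrite mulrAC.
  by rewrite leNgt r0'.
exact: (Pn n).
Qed.

Lemma minimal_set_compact : compact minimal_set.
Proof.
have [clX _ bX _ _] := invariant_minimal.
apply: (compact_curves T0) => // r r0'.
have r4 : 0 < r / 4 by rewrite divr_gt0.
have -> : r = 4 * (r / 4) by rewrite mulrC divfK.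
apply: (cov_curves T0) => //.
  move=> t r' r'0; have := slice_cov (clamp_itv t (ltW T0)) r'0.
  by apply: cov_subset => _ [x Xx <-]; exists x => //; rewrite /ev (clamp_id (clamp_itv t (ltW T0))).
have [d d0 H] := barrier_equicontinuous T0 af omega h r4.
exists d => // x s t Xx s0 st tT td; apply: H.
- exact: bX.
- by rewrite tT (le_trans s0).
- by rewrite s0 (le_trans st).
- by rewrite ger0_norm ?subr_ge0.
Qed.

Lemma minimal_hull_cov : {ae @lebesgue_measure R, forall s, 0 <= s <= T -> forall r, 0 < r ->
  cov (field_hull F minimal_set s) r}.
Proof.
have P0 : P 0 by move=> t r tT; rewrite mul0r; exact: slice_cov.
have := field_cov (lexx 0) P0; apply: ae_mono => s H sT r r0'.
have r2 : 0 < r / 2 by rewrite divr_gt0.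
apply: (cov_chull (r := r / 2)); first by apply: H => //; rewrite mul0r mulr0.
by rewrite ltr_pdivrMr// mulr_natr mulr2n ltrDl.
Qed.

End minimal_set.

(** * Approximate solutions *)

Section approximate_solutions.
Context {R : realType} {E : completeNormedModType R} (T : R).
Variables (ker : R -> R -> boundedOp E E) (kappa : R -> R) (C : R).
Hypotheses (T0 : 0 < T) (vk : volterra_kernel T ker kappa C).
Hypothesis ik : intg `[0, T] kappa.
Variables (F : R -> E -> set E) (c eta : R -> R).
Hypothesis af : admissible_field T kappa F c eta.
Variable omega : R -> R.
Hypotheses (om1 : forall t, 0 <= t -> 1 <= omega t)
  (omT : forall t, t <= T -> omega t <= omega T).
Variables (h : contItv T E) (X : set (contItv T E)).
Local Notation I := (`[0, T]%classic : set R).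
Let mI : measurable I := measurable_itv _.
Let fI : (leb I < +oo)%E := leb_itv_lty 0 T.
Local Notation volterra := (volterra T ker).
Local Notation admissible := (admissible T kappa).
Local Notation density := (density ker h).
Local Notation step := (step ker F h).
Local Notation solution := (inclusion_solution ker F h).
Local Notation bnd := (curve_bound c omega h).
Local Notation hull := (field_hull F X).
Hypotheses (cX : compact X) (bX : X `<=` barrier kappa c omega h)
  (sX : step X `<=` X) (solX : solution `<=` X) (Xh : X h)
  (hX : {ae @lebesgue_measure R, forall s, 0 <= s <= T -> forall r, 0 < r -> cov (hull s) r}).
Implicit Types (x y : contItv T E) (w v : R -> E) (e a : R).

Let clX : closed X.
Proof. by apply: compact_closed cX; exact: norm_hausdorff. Qed.

Definition hull_valued w := nice w /\
  {ae @lebesgue_measure R, forall s, 0 <= s <= T -> hull s (w s)}.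

Lemma hull_truncate w : hull_valued w -> exists w', [/\ nice w', forall s, `|w' s| <= bnd s,
    {ae @lebesgue_measure R, forall s, 0 <= s <= T -> w' s = w s},
    admissible w' & forall t, 0 <= t <= T -> volterra w' t = volterra w t].
Proof.
move=> [nw wX]; apply: (truncate_density T0 vk af om1) => //.
move: (field_hull_bound af bX) wX; apply: ae_mono2 => s sb wX sT.
apply: le_trans (sb sT _ (wX sT)) _.
rewrite ler_wpM2l ?(af_c_ge0 af)// ler_wpM2l ?mulr_ge0 ?addr_ge0// omT//.
by case/andP: sT.
Qed.

Lemma hull_admissible w : hull_valued w -> admissible w.
Proof.
move=> hw; have [w' [nw' w'b ww' [_ iw'] _]] := hull_truncate hw; have [nw _] := hw.
split => //; apply: (intg_ae mI (kappa_norm_measurable vk nw) iw').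
move: ww'; apply: ae_mono => s ws; rewrite /= in_itv/= => sT.
by rewrite ger0_norm ?mulr_ge0 ?(vk_ge0 vk)// ws.
Qed.

Lemma curve_exists w : hull_valued w -> exists x, density x w.
Proof.
move=> hw; have [w' [nw' w'b ww' aw' vw']] := hull_truncate hw; have [nw _] := hw.
have [_ _ ikb] := bound_intg af (2 * (1 + `|h|) * omega T).
have [|x xE] := @contItv_exists _ _ T0 _ (fun t => ev h t + volterra w' t).
  move=> t e tT e0; have e2 : 0 < e / 2 by rewrite divr_gt0.
  have [d1 d10 H1] := curve_unif_continuous T0 h e2.
  have [d2 d20 H2] := modulus_small ikb e2.
  exists (Num.min d1 d2); first by rewrite lt_min d10.
  suff H a b : 0 <= a -> a <= b -> b <= T -> b - a < Num.min d1 d2 ->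
      `|ev h b + volterra w' b - (ev h a + volterra w' a)| < e.
    move=> s sT; have [/andP[s0 s1] /andP[t0 t1]] := (sT, tT); have [ts|ts] := leP t s.
      by rewrite distrC ger0_norm ?subr_ge0// => ts'; rewrite distrC; exact: H.
    by rewrite ger0_norm ?subr_ge0 ?ltW// => ts'; apply: H => //; exact: ltW.
  move=> a0 ab bT; rewrite lt_min => /andP[ab1 ab2].
  have aT : 0 <= a <= T by rewrite a0 (le_trans ab).
  have bT' : 0 <= b <= T by rewrite bT (le_trans a0).
  have A1 := H1 b a bT' aT; rewrite ger0_norm ?subr_ge0// in A1.
  have A2 := H2 a b a0 ab bT ab2.
  have A3 : `|volterra w' b - volterra w' a| <= modulus T (fun s => kappa s * bnd s) a b.
    by apply: (volterra_modulus vk) => // s _; rewrite ler_wpM2l ?(vk_ge0 vk).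
  rewrite opprD addrACA; have := ler_normD (ev h b - ev h a) (volterra w' b - volterra w' a).
  have := A1 ab1; have := le_lt_trans A3 A2; lra.
by exists x; split => // t tT; rewrite xE// vw'.
Qed.

Lemma density_step x w : density x w -> hull_valued w -> X x.
Proof. by move=> xw [_ hw]; apply: sX; exists w. Qed.

Lemma density_unique x y w v a : 0 <= a <= T -> density x w -> density y v ->
  hull_valued w -> hull_valued v -> (forall t, 0 <= t <= a -> ev x t = ev y t) ->
  {ae @lebesgue_measure R, forall s, 0 <= s <= a -> w s = v s}.
Proof.
move=> aT [_ xw] [_ yv] hw hv xy; have /andP[a0 aT'] := aT.
have wv t : 0 <= t <= a -> volterra w t = volterra v t.
  move=> ta; have tT : 0 <= t <= T by case/andP: ta => -> ta; rewrite (le_trans ta).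
  by have := xy t ta; rewrite xw// yv// => /addrI.
exact: (volterra_unique vk ik aT (hull_admissible hw) (hull_admissible hv) wv).
Qed.

Lemma density_ae w v a : 0 <= a <= T -> hull_valued w -> hull_valued v ->
  {ae @lebesgue_measure R, forall s, 0 <= s <= a -> w s = v s} ->
  forall t, 0 <= t <= a -> volterra w t = volterra v t.
Proof.
move=> aT hw [nv _] wv t /andP[t0 ta]; have /andP[a0 aT'] := aT.
apply: (volterra_ae_eq vk) => //; first by rewrite t0 (le_trans ta).
  exact: hull_admissible.
by move: wv; apply: ae_mono => s wv /andP[s0 st]; rewrite wv// s0 (le_trans st).
Qed.

Lemma density0 x w : density x w -> hull_valued w -> ev x 0 = ev h 0.
Proof.
move=> [_ xw] hw; have T0' : 0 <= (0 : R) <= T by rewrite lexx ltW.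
rewrite xw//; have := volterra_norm vk T0' (hull_admissible hw).
by rewrite set_itv1 Rintegral_set1 normr_le0 => /eqP ->; rewrite addr0.
Qed.

Lemma ev_cvg (x_ : nat -> contItv T E) x (t_ : nat -> R) t : x_ n @[n --> \oo] --> x ->
  t_ n @[n --> \oo] --> t -> ev (x_ n) (t_ n) @[n --> \oo] --> ev x t.
Proof.
move=> xx tt; apply/cvgrPdist_lt => e e0; have e2 : 0 < e / 2 by rewrite divr_gt0.
have /cvgrPdist_lt/(_ _ e2) H1 := xx.
have H2 : ev x (t_ n) @[n --> \oo] --> ev x t.
  by apply: (cvg_comp t_ (ev x) tt); exact: (@ev_continuous _ _ T0 _ x t).
have /cvgrPdist_lt/(_ _ e2) H3 := H2.
near=> n.
have A1 : `|x - x_ n| < e / 2 by near: n.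
have A2 : `|ev x t - ev x (t_ n)| < e / 2 by near: n.
have := ler_normD (ev x t - ev x (t_ n)) (ev x (t_ n) - ev (x_ n) (t_ n)).
rewrite subrKA; have := ev_dist T0 x (x_ n) (t_ n); lra.
Unshelve. all: by end_near. Qed.

(** Total boundedness of the hulls at almost every time supplies a limit density. The last clause is
    what carries pointwise constraints depending on the sequence over to it. *)
Lemma density_closure (x_ : nat -> contItv T E) x (w_ : nat -> R -> E) :
  (forall n, density (x_ n) (w_ n)) -> (forall n, hull_valued (w_ n)) ->
  x_ n @[n --> \oo] --> x -> exists w, [/\ density x w, hull_valued w &
    {ae @lebesgue_measure R, forall s, 0 <= s <= T -> forall M B, closed B -> cvx B ->
      (forall m, (M <= m)%N -> B (w_ m s)) -> B (w s)}].
Proof.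
move=> xw hw xx; have [z zP] := choice (fun n => hull_truncate (hw n)).
have [mb ib ikb] := bound_intg af (2 * (1 + `|h|) * omega T).
have zw := ae_nat (fun n => let: And5 _ _ b _ _ := zP n in b).
have wX := ae_nat (fun n => (hw n).2).
have tz : {ae @lebesgue_measure R, forall s, I s -> forall r, 0 < r -> cov (range (z ^~ s)) r}.
  move: zw wX hX; apply: ae_mono3 => s zw wX hX'; rewrite /= in_itv/= => sT r r0.
  by apply: cov_subset (hX' sT r r0) => _ [n _ <-]; rewrite zw//; exact: wX.
have [||w [nw wb wz vw]] := density_limit vk _ _ mb ib ikb tz.
- by move=> n; have [] := zP n.
- by move=> n; have [] := zP n.
have wl : {ae @lebesgue_measure R, forall s, 0 <= s <= T -> forall M B, closed B -> cvx B ->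
      (forall m, (M <= m)%N -> B (w_ m s)) -> B (w s)}.
  move: zw wz; apply: ae_mono2 => s zw wz sT M B clB cB Bw.
  have Is : I s by rewrite /= in_itv.
  by apply: (wz Is M) => // m Mm; rewrite zw//; exact: Bw.
exists w; split => //.
- split => // t tT; rewrite (vw t (ev x t - ev h t))//; first by rewrite subrKC.
  have : ev (x_ n) t - ev h t @[n --> \oo] --> ev x t - ev h t.
    by apply: cvgB; [apply: ev_cvg => //; exact: cvg_cst|exact: cvg_cst].
  apply: cvg_trans; apply: near_eq_cvg; apply: nearW => n.
  have [_ xwn] := xw n; have [_ _ _ _ ->//] := zP n.
  by rewrite xwn// addrC addKr.
- split => //; move: wl wX; apply: ae_mono2 => s wl wX sT.
  apply: (wl sT 0%N) => [||m _]; [exact: chull_closed|exact: chull_cvx|exact: wX].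
Qed.

(** The intersection over all [e' > e] is stable when [p] varies along a convergent sequence, as
    compactness of [approx_solution] demands. *)
Definition near_hull e (p : E) s : set E := [set y | forall e', e < e' ->
  chull (\bigcup_(q in [set q | slice X s q /\ `|q - p| < e']) F s q) y].

Definition approx_solution e := [set x : contItv T E | exists w, density x w /\ nice w /\
  {ae @lebesgue_measure R, forall s, 0 <= s <= T -> near_hull e (ev x s) s (w s)}].

Lemma near_hull_sub e p s : near_hull e p s `<=` hull s.
Proof.
move=> y /(_ (e + 1)); rewrite ltrDl ltr01 => /(_ isT).
by apply: chull_mono => z [q [Xq _] Fq]; exists q.
Qed.

Lemma near_hull_valued e x w : nice w ->
  {ae @lebesgue_measure R, forall s, 0 <= s <= T -> near_hull e (ev x s) s (w s)} ->
  hull_valued w.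
Proof.
move=> nw wx; split => //; move: wx; apply: ae_mono => s wx sT.
by apply: near_hull_sub; exact: wx.
Qed.

Lemma approx_solution_sub e : approx_solution e `<=` X.
Proof.
move=> x [w [xw [nw wx]]]; apply: (density_step xw); exact: near_hull_valued wx.
Qed.

Lemma approx_solution_mono e e' : e <= e' -> approx_solution e `<=` approx_solution e'.
Proof.
move=> ee x [w [xw [nw wx]]]; exists w; split => //; split => //.
move: wx; apply: ae_mono => s wx sT r er; apply: (wx sT).
exact: le_lt_trans er.
Qed.

Lemma solution_approx e : 0 <= e -> solution `<=` approx_solution e.
Proof.
move=> e0 x xS; have Xx := solX xS; have [w [xw wF]] := xS; have [nw _] := xw.
exists w; split => //; split => //; move: wF; apply: ae_mono => s wF sT r er.
apply: sub_chull; exists (ev x s); last exact: wF.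
by split; [exists x|rewrite subrr normr0 (le_lt_trans e0)].
Qed.

Lemma approx_solution_compact e : compact (approx_solution e).
Proof.
apply: (subclosed_compact _ cX); last exact: approx_solution_sub.
apply: seq_closed => x_ x Kx xx; have [w_ wP] := choice Kx.
have hw n : hull_valued (w_ n) by have [_ [nw wx]] := wP n; exact: near_hull_valued wx.
have [w [xw [nw hw'] wl]] := density_closure (fun n => (wP n).1) hw xx.
exists w; split => //; split => //.
have wx := ae_nat (fun n => (wP n).2.2).
move: wx wl; apply: ae_mono2 => s wx wl sT e' ee'.
have d0 : 0 < (e' - e) / 2 by rewrite divr_gt0// subr_gt0.
have : ev (x_ n) s @[n --> \oo] --> ev x s by apply: ev_cvg => //; exact: cvg_cst.
move=> /cvgrPdist_lt/(_ _ d0)[M _ MP].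
apply: (wl sT M) => [||m Mm]; [exact: chull_closed|exact: chull_cvx|].
have : e < e + (e' - e) / 2 by rewrite ltrDl.
move=> /(wx m sT); apply: chull_mono => y [q [Xq qx] Fq]; exists q => //; split => //.
have xm : `|ev x s - ev (x_ m) s| < (e' - e) / 2 := MP m Mm.
rewrite distrC in xm.
have := ler_normD (q - ev (x_ m) s) (ev (x_ m) s - ev x s); rewrite subrKA; lra.
Qed.

Lemma approx_solution_cap :
  \bigcap_n approx_solution n.+1%:R^-1 = solution.
Proof.
apply/seteqP; split => [x Kx|x xS n _]; last first.
  by apply: solution_approx => //; rewrite invr_ge0.
have [w_ wP] := choice (fun n => Kx n Logic.I).
have hw n : hull_valued (w_ n) by have [_ [nw wx]] := wP n; exact: near_hull_valued wx.
exists (w_ 0%N); split; first exact: (wP 0%N).1.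
have T0' : 0 <= T <= T by rewrite lexx ltW.
have wE := ae_nat (fun n => density_unique T0' (wP 0%N).1 (wP n).1 (hw 0%N) (hw n) (fun _ _ => erefl)).
have wx := ae_nat (fun n => (wP n).2.2).
move: wE wx (af_uhc af); apply: ae_mono3 => s wE wx us sT.
apply: (uhc_limit (us sT)).
- exact: (af_closed af).
- exact: (af_cvx af).
- exact: (af_ne af).
move=> r r0; have [n _ /(_ n (leqnn n))/= nr] := near_infty_natSinv_lt (PosNum r0).
rewrite (wE n sT); apply: chull_mono (wx n sT r nr) => y [q [_ qx] Fq].
by exists q.
Qed.

End approximate_solutions.

(** * Contractibility *)

Lemma ae_and {R : realType} (P Q : R -> Prop) :
  {ae @lebesgue_measure R, forall t, P t} -> {ae @lebesgue_measure R, forall t, Q t} ->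
  {ae @lebesgue_measure R, forall t, P t /\ Q t}.
Proof. exact: filterI. Qed.

(** Points of weight zero are exempt from lying in [A]: with bump functions as weights, only the net
    points close to the curve count. *)
Lemma cvx_weighted {R : realType} (V : lmodType R) (A : set V) (n : nat) (l : nat -> R)
    (z : nat -> V) : cvx A -> (forall i, 0 <= l i) ->
  (forall i, (i < n)%N -> 0 < l i -> A (z i)) -> 0 < \sum_(i < n) l i ->
  exists2 a, A a & \sum_(i < n) l i *: z i = (\sum_(i < n) l i) *: a.
Proof.
move=> cA l0; elim: n => [|n IH] Az; first by rewrite big_ord0 ltxx.
rewrite !big_ord_recr/=; have S0 : 0 <= \sum_(i < n) l i by apply: sumr_ge0.
have [ln0|ln_neq0] := eqVneq (l n) 0.
  rewrite ln0 scale0r !addr0; apply: IH => i ni; apply: Az; exact: ltnW.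
have ln_gt0 : 0 < l n by rewrite lt_neqAle eq_sym ln_neq0 l0.
have An := Az n (leqnn _) ln_gt0 => _.
have [S_eq0|S_neq0] := eqVneq (\sum_(i < n) l i) 0.
  exists (z n) => //; rewrite S_eq0 add0r big1 ?add0r// => i _.
  by have /psumr_eq0P := S_eq0; move=> -> //; rewrite scale0r.
have S_gt0 : 0 < \sum_(i < n) l i by rewrite lt_neqAle eq_sym S_neq0.
have [a Aa ->] := IH (fun i ni => Az i (ltnW ni)) S_gt0.
by have [a' Aa' ->] := cvx_cone cA S0 (l0 n) Aa An; exists a'.
Qed.

Lemma sum_cvg {R : realType} {V : normedModType R} {U : Type} (G : set_system U) {FG : Filter G}
    n (f : nat -> U -> V) (l : nat -> V) : (forall i, f i u @[u --> G] --> l i) ->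
  \sum_(i < n) f i u @[u --> G] --> \sum_(i < n) l i.
Proof.
move=> fl; elim: n => [|n IH].
  by rewrite big_ord0; under eq_fun do rewrite big_ord0; exact: cvg_cst.
by rewrite big_ord_recr; under eq_fun do rewrite big_ord_recr; apply: cvgD.
Qed.

Section contraction.
Context {R : realType} {E : completeNormedModType R} (T : R).
Variables (ker : R -> R -> boundedOp E E) (kappa : R -> R) (C : R).
Hypotheses (T0 : 0 < T) (vk : volterra_kernel T ker kappa C).
Hypothesis ik : intg `[0, T] kappa.
Variables (F : R -> E -> set E) (c eta : R -> R).
Hypothesis af : admissible_field T kappa F c eta.
Variable omega : R -> R.
Hypotheses (om1 : forall t, 0 <= t -> 1 <= omega t)
  (omT : forall t, t <= T -> omega t <= omega T).
Variables (h : contItv T E) (X : set (contItv T E)).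
Local Notation I := (`[0, T]%classic : set R).
Local Notation volterra := (volterra T ker).
Local Notation density := (density ker h).
Local Notation step := (step ker F h).
Local Notation hull := (field_hull F X).
Local Notation hull_valued := (hull_valued F X).
Local Notation near_hull := (near_hull F X).
Local Notation approx_solution := (approx_solution ker F h X).
Hypotheses (cX : compact X) (bX : X `<=` barrier kappa c omega h)
  (sX : step X `<=` X) (Xh : X h)
  (hX : {ae @lebesgue_measure R, forall s, 0 <= s <= T -> forall r, 0 < r -> cov (hull s) r}).
Implicit Types (x y : contItv T E) (w v : R -> E) (a : R).

Let clX : closed X.
Proof. by apply: compact_closed cX; exact: norm_hausdorff. Qed.

Variables (e d : R) (N : nat) (xs : nat -> contItv T E) (ws : nat -> R -> E).
Hypotheses (d0 : 0 < d)
  (eqX : forall x s t, X x -> 0 <= s <= T -> 0 <= t <= T -> `|s - t| <= d ->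
     `|ev x s - ev x t| < e / 4)
  (xsX : forall i, X (xs i))
  (net : forall y, X y -> exists2 i, (i < N)%N & `|y - xs i| < e / 2)
  (nws : forall i, nice (ws i))
  (wsF : forall i, {ae @lebesgue_measure R, forall s, 0 <= s <= T -> F s (ev (xs i) s) (ws i s)}).

(** Positive exactly when [xs i] is within [e / 2] of [y] at the delayed time. For [s < d] that time
    is negative, and [ev] returns the value at 0. *)
Definition gap i s y := e / 2 - `|ev y (s - d) - ev (xs i) (s - d)|.

(* Twice the positive part of the gap. *)
Definition bump i s y := `|gap i s y| + gap i s y.

Definition total s y := \sum_(i < N) bump i s y.

(* The value at time s depends on y only through [ev y (s - d)]. *)
Definition blend y s := \sum_(i < N) (bump i s y / total s y) *: ws i s.

Let bump_ge0 i s y : 0 <= bump i s y.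
Proof. by rewrite /bump; have := ler_norm (- gap i s y); rewrite normrN; lra. Qed.

Let bump_gt0 i s y : (0 < bump i s y) = (0 < gap i s y).
Proof.
rewrite /bump; case: (lerP (gap i s y) 0) => [g0|g0]; last by rewrite gtr0_norm// addr_gt0.
by rewrite ler0_norm// addNr ltxx.
Qed.

Lemma total_gt0 s y : X y -> 0 < total s y.
Proof.
move=> Xy; have [i iN yi] := net Xy.
rewrite /total (bigD1 (Ordinal iN))//=; apply: ltr_pwDl; last exact: sumr_ge0.
rewrite bump_gt0 subr_gt0.
exact: le_lt_trans (ev_dist T0 _ _ _) yi.
Qed.

(** Proximity [e / 2] at the delayed time, plus an oscillation of [e / 4] for each of the two curves
    over a time of length at most [d]. *)
Lemma bump_near i s y : 0 <= s <= T -> X y -> 0 < bump i s y -> `|ev (xs i) s - ev y s| < e.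
Proof.
move=> sT Xy; rewrite bump_gt0 subr_gt0 => yi.
have cl z : `|ev z s - ev z (s - d)| < e / 4 \/ ~ X z.
  have [Xz|] := pselect (X z); [left|by right].
  have -> : ev z (s - d) = ev z (clamp 0 T (s - d)).
    by rewrite /ev (clamp_id (clamp_itv _ (ltW T0))).
  apply: eqX => //; first by apply: clamp_itv; exact: ltW.
  rewrite -{1}(clamp_id sT); apply: le_trans (clamp_dist 0 T s (s - d)) _.
  by rewrite subKr gtr0_norm.
have [c1|//] := cl y; have [c2|/(_ (xsX i))//] := cl (xs i).
have -> : ev (xs i) s - ev y s = (ev (xs i) s - ev (xs i) (s - d)) +
   (ev (xs i) (s - d) - ev y (s - d)) + (ev y (s - d) - ev y s) by rewrite !subrKA.
rewrite distrC in yi; rewrite distrC in c1.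
have := ler_normD (ev (xs i) s - ev (xs i) (s - d)) (ev (xs i) (s - d) - ev y (s - d)).
have := ler_normD ((ev (xs i) s - ev (xs i) (s - d)) + (ev (xs i) (s - d) - ev y (s - d)))
  (ev y (s - d) - ev y s).
move: c1 c2 yi; lra.
Qed.

Let bump_continuous i y : continuous (fun s => bump i s y).
Proof.
move=> s; have sd : s' - d @[s' --> s] --> s - d by apply: cvgB; [exact: cvg_id|exact: cvg_cst].
have cg : gap i s' y @[s' --> s] --> gap i s y.
  apply: cvgB; first exact: cvg_cst.
  by apply: cvg_norm; apply: cvgB; apply: (cvg_comp _ _ sd); exact: (@ev_continuous _ _ T0).
by apply: cvgD => //; exact: cvg_norm.
Qed.

Lemma blend_nice y : X y -> nice (blend y).
Proof.
move=> Xy; apply: nice_sum => i _; apply: niceM => //.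
apply: continuous_nice => s; apply: cvgM; first exact: bump_continuous.
apply: cvgV; first by rewrite gt_eqF// total_gt0.
by apply: (sum_cvg (f := fun i s => bump i s y) (l := fun i => bump i s y)) => j; exact: bump_continuous.
Qed.

Lemma blend_cvg (y_ : nat -> contItv T E) y s : X y -> y_ n @[n --> \oo] --> y ->
  blend (y_ n) s @[n --> \oo] --> blend y s.
Proof.
move=> Xy yy.
have cb i : bump i s (y_ n) @[n --> \oo] --> bump i s y.
  have cg : gap i s (y_ n) @[n --> \oo] --> gap i s y.
    apply: cvgB; first exact: cvg_cst.
    apply: cvg_norm; apply: cvgB; last exact: cvg_cst.
    by apply: (ev_cvg T0 yy); exact: cvg_cst.
  by apply: cvgD => //; exact: cvg_norm.
apply: (sum_cvg (f := fun i n => (bump i s (y_ n) / total s (y_ n)) *: ws i s)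
  (l := fun i => (bump i s y / total s y) *: ws i s)) => i.
apply: cvgZ; last exact: cvg_cst.
apply: cvgM; first exact: cb.
apply: cvgV; first by rewrite gt_eqF// total_gt0.
exact: (sum_cvg (f := fun i n => bump i s (y_ n)) (l := fun i => bump i s y)).
Qed.

Lemma blend_hull : {ae @lebesgue_measure R, forall s, 0 <= s <= T -> forall y, X y ->
  near_hull e (ev y s) s (blend y s)}.
Proof.
have := ae_nat wsF; apply: ae_mono => s wsF' sT y Xy r er.
have tp := total_gt0 s Xy.
have S1 : \sum_(i < N) bump i s y / total s y = 1.
  by rewrite -mulr_suml -/(total s y) divff// gt_eqF.
have [i|i iN||p Ap] := @cvx_weighted _ _ (chull (\bigcup_(q in [set q | slice X s q /\ `|q - ev y s| < r]) F s q))
  N (fun i => bump i s y / total s y) (fun i => ws i s) (@chull_cvx _ _ _).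
- by rewrite divr_ge0// ltW.
- rewrite pmulr_lgt0 ?invr_gt0// => bi; apply: sub_chull.
  exists (ev (xs i) s); last exact: wsF'.
  split; first by exists (xs i).
  exact: lt_trans (bump_near sT Xy bi) er.
- by rewrite S1.
by rewrite /blend S1 scale1r => ->.
Qed.

Lemma blend_delay y y' b s : 0 <= b -> (forall t, 0 <= t <= T -> t <= b -> ev y t = ev y' t) ->
  s <= b + d -> blend y s = blend y' s.
Proof.
move=> b0 yy sb; have evE : ev y (s - d) = ev y' (s - d).
  have cE (z : contItv T E) : ev z (s - d) = ev z (clamp 0 T (s - d)).
    by rewrite /ev (clamp_id (clamp_itv _ (ltW T0))).
  rewrite !cE; apply: yy; first by apply: clamp_itv; exact: ltW.
  by rewrite /clamp ge_max b0/= ge_min lerBlDr sb orbT.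
by rewrite /blend /total /bump /gap evE.
Qed.

Definition glue a w y s := if s \in (`[0, a]%classic : set R) then w s else blend y s.

Let in_itv0 a s : 0 <= s -> (s \in (`[0, a]%classic : set R)) = (s <= a).
Proof.
move=> s0; apply/idP/idP => [/set_mem|sa]; last by apply: mem_set; rewrite /= in_itv/= s0.
by rewrite /= in_itv/= s0.
Qed.

Lemma glue_valued a w y : hull_valued w -> X y -> hull_valued (glue a w y).
Proof.
move=> [nw hw] Xy; split; first by apply: nice_if => //; exact: blend_nice.
move: hw blend_hull; apply: ae_mono2 => s hw bh sT; rewrite /glue.
by case: ifP => _; [exact: hw|exact: near_hull_sub (bh sT y Xy)].
Qed.

(** The density is prescribed after [a] only; before [a] it is fixed by agreement with [x], thanks
    to uniqueness of densities. *)
Definition continuation a x y := [/\ X y,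
  forall t, 0 <= t <= T -> t <= a -> ev y t = ev x t &
  exists v, [/\ density y v, hull_valued v &
    {ae @lebesgue_measure R, forall s, 0 <= s <= T -> a < s -> v s = blend y s}]].

(** Up to [a] the curves determine the densities. Beyond it, the densities up to a time [b + d]
    depend on the curves up to [b] only, so that agreement spreads by [d] at each step and reaches
    [T] after finitely many. *)
Lemma continuation_unique a x x' y y' : 0 <= a <= T ->
  (forall t, 0 <= t <= T -> t <= a -> ev x t = ev x' t) ->
  continuation a x y -> continuation a x' y' -> y = y'.
Proof.
move=> aT xx [Xy yx [v [yv hv vb]]] [Xy' yx' [v' [yv' hv' vb']]]; have /andP[a0 aT'] := aT.
have ya t : 0 <= t <= T -> t <= a -> ev y t = ev y' t.
  by move=> tT ta; rewrite yx// yx'//; exact: xx.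
have va : {ae @lebesgue_measure R, forall s, 0 <= s <= a -> v s = v' s}.
  have ya' t : 0 <= t <= a -> ev y t = ev y' t.
    by move=> /andP[t0 ta]; apply: ya => //; rewrite t0 (le_trans ta).
  exact: (density_unique T0 vk ik af om1 omT bX aT yv yv' hv hv' ya').
have P n t : 0 <= t <= T -> t <= a + n%:R * d -> ev y t = ev y' t.
  elim: n t => [|n IH] t tT; first by rewrite mul0r addr0; exact: ya.
  move=> ta; have [_ yE] := yv; have [_ yE'] := yv'; rewrite yE// yE'//; congr (_ + _).
  have T0' : 0 <= T <= T by rewrite lexx ltW.
  have /andP[t0 tT'] := tT.
  apply: (density_ae T0 vk af om1 omT bX tT hv hv'); last by rewrite t0 lexx.
  move: va vb vb'; apply: ae_mono3 => s va vb vb' /andP[s0 st].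
  have sT : 0 <= s <= T by rewrite s0 (le_trans st).
  have [sa|sa] := leP s a; first by apply: va; rewrite s0.
  rewrite vb// vb'//; apply: (blend_delay (b := a + n%:R * d)) => //.
    by rewrite addr_ge0// mulr_ge0// ltW.
  apply: le_trans st _; apply: le_trans ta _.
  by rewrite -natr1 mulrDl mul1r addrA.
apply: ev_inj => t tT; apply: (P (Num.truncn (T / d)).+1) => //.
have /andP[_ tT'] := tT; have Td : 0 <= T / d by rewrite divr_ge0// ltW.
have /andP[_ /ltW H] := truncn_itv Td; rewrite ler_pdivrMr// in H.
by apply: le_trans tT' (le_trans H _); rewrite lerDr.
Qed.

(** Successive approximations from [x]: because of the delay, an iterate and its successor agree up
    to [a + n d], so that the sequence becomes stationary once this exceeds [T]. *)
Lemma continuation_exists a x w : 0 <= a <= T -> density x w -> hull_valued w ->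
  exists y, continuation a x y.
Proof.
move=> aT xw hw; have Xx := density_step sX xw hw; have /andP[a0 aT'] := aT.
have H y : exists y1, X y -> density y1 (glue a w y) /\ X y1.
  have [Xy|] := pselect (X y); last by exists y.
  have hg := glue_valued a hw Xy.
  have [y1 yg] := curve_exists T0 vk af om1 omT bX hg.
  by exists y1 => _; split => //; exact: (density_step sX yg hg).
have [Phi PhiP] := choice H; pose y_ n := iter n Phi x.
have Xy n : X (y_ n) by elim: n => [//|n IH]; exact: (PhiP _ IH).2.
have yg n : density (y_ n.+1) (glue a w (y_ n)) := (PhiP _ (Xy n)).1.
have hg n := glue_valued a hw (Xy n).
have ya n t : 0 <= t <= T -> t <= a -> ev (y_ n) t = ev x t.
  case: n => // n tT ta; have [_ ->//] := yg n; have [_ ->//] := xw; congr (_ + _).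
  have /andP[t0 tT'] := tT.
  apply: (density_ae T0 vk af om1 omT bX tT (hg n) hw); last by rewrite t0 lexx.
  by apply: aeW => s /andP[s0 st]; rewrite /glue in_itv0// (le_trans st ta).
have P n t : 0 <= t <= T -> t <= a + n%:R * d -> ev (y_ n.+1) t = ev (y_ n) t.
  elim: n t => [|n IH] t tT; first by rewrite mul0r addr0 => ta; rewrite !ya.
  move=> ta; have [_ E1] := yg n.+1; have [_ E2] := yg n.
  rewrite (E1 t tT) (E2 t tT); congr (_ + _).
  have /andP[t0 tT'] := tT.
  apply: (density_ae T0 vk af om1 omT bX tT (hg n.+1) (hg n)); last by rewrite t0 lexx.
  apply: aeW => s /andP[s0 st]; rewrite /glue in_itv0//; case: ifP => // sa.
  apply: (blend_delay (b := a + n%:R * d)) => //.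
    by rewrite addr_ge0// mulr_ge0// ltW.
  apply: le_trans st _; apply: le_trans ta _.
  by rewrite -natr1 mulrDl mul1r addrA.
pose m := (Num.truncn (T / d)).+1.
have ym : y_ m.+1 = y_ m.
  apply: ev_inj => t tT; apply: P => //.
  have /andP[_ tT'] := tT; have Td : 0 <= T / d by rewrite divr_ge0// ltW.
  have /andP[_ /ltW H'] := truncn_itv Td; rewrite ler_pdivrMr// in H'.
  by apply: le_trans tT' (le_trans H' _); rewrite lerDr.
exists (y_ m); split; [exact: Xy|exact: ya|].
exists (glue a w (y_ m)); split; [by rewrite -{1}ym; exact: yg|exact: hg|].
by apply: aeW => s /andP[s0 sT] sa; rewrite /glue in_itv0// leNgt sa.
Qed.

(** Up to [a] the density of [y] is that of [x], by uniqueness, and inherits its constraint; after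
    [a] it is a blend, which satisfies the constraint by construction. *)
Lemma continuation_approx a x y : 0 <= a <= T -> approx_solution e x -> continuation a x y ->
  approx_solution e y.
Proof.
move=> aT [w [xw [nw wx]]] [Xy yx [v [yv hv vb]]]; have /andP[a0 aT'] := aT.
have hw := near_hull_valued nw wx.
have wv : {ae @lebesgue_measure R, forall s, 0 <= s <= a -> v s = w s}.
  have yx' t : 0 <= t <= a -> ev y t = ev x t.
    by move=> /andP[t0 ta]; apply: yx => //; rewrite t0 (le_trans ta).
  exact: (density_unique T0 vk ik af om1 omT bX aT yv xw hv hw yx').
exists v; split => //; split; first exact: hv.1.
move: wv wx (ae_and vb blend_hull); apply: ae_mono3 => s wv wx [vb' bh'] sT.
have [sa|sa] := leP s a; last by rewrite vb'//; exact: bh'.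
by rewrite wv ?yx//; [exact: wx|case/andP: sT => ->].
Qed.

Lemma continuation0_approx x y : continuation 0 x y -> approx_solution e y.
Proof.
move=> [Xy yx [v [yv hv vb]]]; exists v; split => //; split; first exact: hv.1.
have s0 : {ae @lebesgue_measure R, forall s, s != 0}.
  exists [set 0]; split => //; first exact: lebesgue_measure_set1.
  by move=> s /= /negP; rewrite negbK => /eqP.
move: s0 vb blend_hull; apply: ae_mono3 => s s0 vb bh sT; rewrite vb//; first exact: bh.
by rewrite lt_neqAle eq_sym s0; case/andP: sT.
Qed.

(** At a time [s > a] the densities eventually equal the blends along [y_ n], which converge to the
    blend along [y]. The limit density lies in every closed ball around this value, as these are
    closed convex sets. *)
Lemma continuation_closed (a_ : nat -> R) a (x_ y_ : nat -> contItv T E) x y :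
  (forall n, 0 <= a_ n <= T) ->
  (forall n, continuation (a_ n) (x_ n) (y_ n)) -> a_ n @[n --> \oo] --> a ->
  x_ n @[n --> \oo] --> x -> y_ n @[n --> \oo] --> y -> continuation a x y.
Proof.
move=> aT cn aa xx yy; have Xy : X y.
  apply: (closed_cvg X clX (F := \oo) (u_ := y_)) => //.
  by apply: nearW => n; have [] := cn n.
split => //.
  (* The curves [x_ n] and [y_ n] agree up to [a_ n] only, which may be less than [t]; they are
     compared at [b n], which tends to [t]. *)
  move=> t tT ta; pose b n := Num.min t (a_ n); have /andP[t0 tT'] := tT.
  have bt : b n @[n --> \oo] --> t.
    apply/cvgrPdist_lt => r r0; have /cvgrPdist_lt/(_ _ r0) := aa; apply: filterS => n.
    apply: le_lt_trans; rewrite /b; case: (leP t (a_ n)) => tn; first by rewrite subrr normr0.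
    rewrite gtr0_norm ?subr_gt0//; apply: le_trans (ler_norm _).
    by rewrite lerD2r.
  have bE n : ev (y_ n) (b n) = ev (x_ n) (b n).
    have [_ H _] := cn n; have /andP[an0 anT] := aT n; apply: H.
      by rewrite /b le_min t0 an0 ge_min tT'.
    by rewrite /b ge_min lexx orbT.
  have cy := ev_cvg T0 yy bt; have cx := ev_cvg T0 xx bt.
  have E1 : (fun n => ev (y_ n) (b n)) = (fun n => ev (x_ n) (b n)) by apply/funext.
  rewrite E1 in cy.
  exact: (@cvg_unique E (@norm_hausdorff _ E) _ _ _ _ cy cx).
have [v_ vP] := choice (fun n => let: And3 _ _ H := cn n in H).
have dv n : density (y_ n) (v_ n) by have [] := vP n.
have hv n : hull_valued (v_ n) by have [] := vP n.
have [v [yv hv' vl]] := density_closure T0 vk af om1 omT bX hX dv hv yy.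
exists v; split => //.
have vb := ae_nat (fun n => let: And3 _ _ H := vP n in H).
move: vb vl; apply: ae_mono2 => s vb vl sT sa.
apply/eqP; rewrite -subr_eq0 -normr_le0; apply/ler_addgt0Pr => r r0; rewrite add0r.
have sa' : 0 < s - a by rewrite subr_gt0.
have /cvgrPdist_lt/(_ _ sa')[M1 _ M1P] := aa.
have /cvgrPdist_lt/(_ _ r0)[M2 _ M2P] := @blend_cvg _ _ s Xy yy.
apply: (vl sT (maxn M1 M2) [set z | `|z - blend y s| <= r]).
- apply: (@closed_comp _ _ (fun z : E => `|z - blend y s|) [set z | z <= r]); last exact: closed_le.
  by move=> z _; apply: cvg_norm; apply: cvgB; [exact: cvg_id|exact: cvg_cst].
- move=> l z1 z2 l0 l1 /= H1 H2; have l1' : 0 <= 1 - l by rewrite subr_ge0.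
  have -> : l *: z1 + (1 - l) *: z2 - blend y s =
      l *: (z1 - blend y s) + (1 - l) *: (z2 - blend y s).
    by rewrite !scalerBr addrACA -opprD -scalerDl subrKC scale1r.
  apply: le_trans (ler_normD _ _) _; rewrite !normrZ !ger0_norm//.
  have -> : r = l * r + (1 - l) * r by rewrite -mulrDl subrKC mul1r.
  by rewrite lerD// ler_wpM2l.
- move=> m Mm /=; rewrite vb//.
    by rewrite distrC; apply/ltW/M2P => /=; apply: leq_trans Mm; exact: leq_maxr.
  have := M1P m (leq_trans (leq_maxl _ _) Mm); rewrite /= distrC => H.
  by have := le_lt_trans (ler_norm _) H; rewrite ltrD2r.
Qed.

(** Some curve with a hull-valued density is needed as a start, and the blend along [h] provides
    one; its continuation from time 0 is an approximate solution. *)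
Lemma approx_solution_nonempty : approx_solution e !=set0.
Proof.
have hb : hull_valued (blend h).
  split; first exact: blend_nice.
  by move: blend_hull; apply: ae_mono => s bh sT; exact: near_hull_sub (bh sT h Xh).
have [x xb] := curve_exists T0 vk af om1 omT bX hb.
have T0' : 0 <= (0 : R) <= T by rewrite lexx ltW.
have [y cy] := continuation_exists T0' xb hb.
by exists y; exact: continuation0_approx cy.
Qed.

(** For [tau = 0] the whole curve is kept. For [tau = 1] only its initial value is, and this is the
    initial value of [h] for every curve, so that uniqueness of continuations makes the final map
    constant. *)
Lemma approx_solution_contractible : contractible R (approx_solution e).
Proof.
pose al (tau : R) := (1 - tau) * T.
have alT tau : 0 <= tau <= 1 -> 0 <= al tau <= T.
  move=> /andP[tau0 tau1]; have T0' := ltW T0; apply/andP; split.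
    by rewrite mulr_ge0 ?subr_ge0.
  by rewrite ler_piMl// lerBlDr lerDl.
have H (z : R * contItv T E) : exists y, 0 <= z.1 <= 1 -> approx_solution e z.2 ->
    continuation (al z.1) z.2 y.
  have [[z1 [w [xw [nw wx]]]]|nz] := pselect (0 <= z.1 <= 1 /\ approx_solution e z.2).
    have [y cy] := continuation_exists (alT _ z1) xw (near_hull_valued nw wx).
    by exists y.
  by exists z.2 => z1 z2; exfalso; apply: nz.
have [G GP] := choice H; have [x0 Kx0] := approx_solution_nonempty.
have GK t y : 0 <= t <= 1 -> approx_solution e y -> approx_solution e (G (t, y)).
  by move=> t1 Ky; apply: continuation_approx (GP (t, y) t1 Ky) => //; exact: alT.
have i0 : 0 <= (0 : R) <= 1 by rewrite lexx ler01.
have i1 : 0 <= (1 : R) <= 1 by rewrite lexx ler01.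
exists (G (1, x0)), G; split.
- exact: GK.
- apply: (closed_graph_continuous (K := approx_solution e)).
  + exact: (approx_solution_compact T0 vk af om1 omT cX bX sX hX).
  + by move=> [t y] [/= + Ky]; rewrite in_itv/= => t1; exact: GK.
  + move=> z_ z y Az_ [/= + Kz] zz Gy; rewrite in_itv/= => z1.
    have z_1 n : 0 <= (z_ n).1 <= 1 by have [/= + _] := Az_ n; rewrite in_itv.
    have c1 : (z_ n).1 @[n --> \oo] --> z.1 by apply: cvg_comp zz _; exact: cvg_fst.
    have c2 : (z_ n).2 @[n --> \oo] --> z.2 by apply: cvg_comp zz _; exact: cvg_snd.
    apply: (continuation_unique (alT _ z1) (x := z.2) (x' := z.2)) => //.
      apply: (continuation_closed (a_ := fun n => al (z_ n).1) (x_ := fun n => (z_ n).2) _ _ _ c2 Gy).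
      * by move=> n; exact: alT.
      * by move=> n; apply: GP => //; have [] := Az_ n.
      * by apply: cvgM; [apply: cvgB => //; exact: cvg_cst|exact: cvg_cst].
    exact: GP.
- by move=> t y; rewrite /= in_itv/=; exact: GK.
- move=> y Ky; have [_ yE _] := GP (0, y) i0 Ky.
  by apply: ev_inj => t tT; apply: yE => //; rewrite /al subr0 mul1r; case/andP: tT.
- move=> y Ky; have al1 : al 1 = 0 by rewrite /al subrr mul0r.
  have cy := GP (1, y) i1 Ky; have cx0 := GP (1, x0) i1 Kx0.
  apply: (continuation_unique (alT 1 i1) _ cy cx0) => t tT; rewrite al1 => t0.
  have -> : t = 0 by apply/eqP; rewrite eq_le t0; case/andP: tT.
  have [w [yw [nw wy]]] := Ky; have [w0 [xw0 [nw0 wx0]]] := Kx0.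
  rewrite /= (density0 T0 vk af om1 omT bX yw (near_hull_valued nw wy)).
  by rewrite (density0 T0 vk af om1 omT bX xw0 (near_hull_valued nw0 wx0)).
Qed.

End contraction.

(** * The set of solutions *)

Section curves_metric.
Context {R : realType} {T : R} {E : normedModType R}.
Implicit Types x y : contItv T E.

Let dist x y : R := `|x - y|.

Let dist_ge0 x y : 0 <= dist x y. Proof. exact: normr_ge0. Qed.

Let dist_positivity x y : dist x y = 0 -> x = y.
Proof. by move/eqP; rewrite normr_eq0 subr_eq0 => /eqP. Qed.

Let ballE x r : ball x r = [set y | dist x y < r]. Proof. by []. Qed.

(** The ambient space in [Rdelta_set] is a metric space; here it is the space of curves itself, with
    both embeddings equal to the identity. *)
HB.instance Definition _ :=
  @PseudoMetric_isMetric.Build R (contItv T E) dist dist_ge0 dist_positivity ballE.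

End curves_metric.

Lemma bigcap_compact_nonempty {R : realType} {V : normedModType R} (K : nat -> set V) :
  (forall n, compact (K n)) -> (forall n, K n !=set0) -> (forall n, K n.+1 `<=` K n) ->
  \bigcap_n K n !=set0.
Proof.
move=> cK K0 KS; have KM n m : (n <= m)%N -> K m `<=` K n.
  elim: m => [|m IH]; first by rewrite leqn0 => /eqP ->.
  by rewrite leq_eqVlt ltnS => /predU1P[->//|nm] x /KS; exact: IH.
have [y yP] := choice K0.
have [x [_ [u nu ux]]] := compact_subseq (cK 0%N) (fun n => KM 0%N n (leq0n n) _ (yP n)).
exists x => n _; have clK : closed (K n) by apply: compact_closed (cK n); exact: norm_hausdorff.
apply: (closed_cvg (K n) clK (F := \oo) (u_ := fun m => y (u m))) => //.
by exists n => // m /= nm; apply: KM (yP _); exact: leq_trans (nu m).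
Qed.

Section solution_structure.
Context {R : realType} {E : completeNormedModType R} (T : R).
Variables (ker : R -> R -> boundedOp E E) (kappa : R -> R) (C : R).
Hypotheses (T0 : 0 < T) (vk : volterra_kernel T ker kappa C).
Hypothesis ik : intg `[0, T] kappa.
Variables (F : R -> E -> set E) (c eta : R -> R).
Hypothesis af : admissible_field T kappa F c eta.
Variable h : contItv T E.
Let mI : measurable (`[0, T]%classic : set R) := measurable_itv _.

(** The centres are moved into [X], where the blends need them, which doubles the radius; a ball
    that misses [X] receives the centre [h]. *)
Lemma net_exists (X : set (contItv T E)) r : compact X -> X h -> 0 < r ->
  exists (N : nat) (xs : nat -> contItv T E), (forall i, X (xs i)) /\
    forall y, X y -> exists2 i, (i < N)%N & `|y - xs i| < r.
Proof.
move=> cX Xh r0; have r2 : 0 < r / 2 by rewrite divr_gt0.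
have [l lP] := compact_cov cX r2.
have H i : exists z, X z /\ ((exists2 y, X y & `|y - l`_i| < r / 2) -> `|z - l`_i| < r / 2).
  have [[y Xy yl]|ny] := pselect (exists2 y, X y & `|y - l`_i| < r / 2); first by exists y.
  by exists h.
have [xs xsP] := choice H; exists (size l), xs; split => [i|y Xy]; first exact: (xsP i).1.
have [z zl yz] := lP y Xy; exists (index z l); first by rewrite index_mem.
have := (xsP (index z l)).2; rewrite nth_index// => /(_ (ex_intro2 _ _ y Xy yz)) xz.
rewrite -(subrKA z) (splitr r); apply: le_lt_trans (ler_normD _ _) _.
by rewrite distrC in xz; apply: ltrD.
Qed.

Lemma inclusion_solution_Rdelta : Rdelta_set R (inclusion_solution ker F h).
Proof.
have mk := vk_meas vk; have k0 := vk_ge0 vk.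
have mc := af_c_meas af; have c0 := af_c_ge0 af.
have me := af_eta_meas af; have eta0 := af_eta_ge0 af.
(* One weight serves both estimates: with the integral of [g om] at most [om t / 2], the part with
   [c] is at most [om t / 2] and the part with [eta] at most [om t / 8]. *)
pose g s := kappa s * c s + 4 * (kappa s * eta s).
have mg : measurable_fun setT g.
  by apply: measurable_funD; do ?[apply: measurable_funM => //].
have g0 s : 0 <= g s by rewrite addr_ge0 ?mulr_ge0.
have ig : intg `[0, T] g.
  by apply: intgD => //; [exact: (af_kc_intg af)|apply: intgZ => //; exact: (af_keta_intg af)].
have [om [com om1 omT omP]] := weight_exists mg g0 ig.
have mom : measurable_fun setT om by exact: continuous_measurable_fun.
have om0 t : 0 <= t -> 0 <= om t by move=> /om1; apply: le_trans.
have kc0 s := mulr_ge0 (k0 s) (c0 s); have ke0 s := mulr_ge0 (k0 s) (eta0 s).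
have omc t : 0 <= t <= T -> intg `[0, t] (fun s => kappa s * c s * om s) /\
     \int[leb]_(s in `[0, t]) (kappa s * c s * om s) <= om t / 2.
  move=> tT; have [io lo] := omP t tT.
  have mt : measurable (`[0, t]%classic : set R) := measurable_itv _.
  have le s : `[0, t]%classic s -> kappa s * c s * om s <= g s * om s.
    rewrite /= in_itv/= => /andP[s0 _].
    by rewrite ler_wpM2r ?om0// /g lerDl mulr_ge0.
  have io' : intg `[0, t] (fun s => kappa s * c s * om s).
    apply: (intg_le mt) (io) _.
      by apply: (measurable_funS measurableT) => //; do ?[apply: measurable_funM => //].
    move=> s st; rewrite ger0_norm ?le//.
    by move: st; rewrite /= in_itv/= => /andP[s0 _]; rewrite mulr_ge0// om0.
  by split => //; apply: le_trans (le_rint mt io' io le) lo.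
have ome t : 0 <= t <= T -> intg `[0, t] (fun s => kappa s * eta s * om s) /\
     \int[leb]_(s in `[0, t]) (kappa s * eta s * om s) <= om t / 8.
  move=> tT; have [io lo] := omP t tT.
  have mt : measurable (`[0, t]%classic : set R) := measurable_itv _.
  have le s : `[0, t]%classic s -> kappa s * eta s * om s <= 4^-1 * (g s * om s).
    rewrite /= in_itv/= => /andP[s0 _]; rewrite mulrA ler_wpM2r ?om0// /g.
    by rewrite ler_pdivlMl// lerDr.
  have io4 := intgZ mt 4^-1 io.
  have io' : intg `[0, t] (fun s => kappa s * eta s * om s).
    apply: (intg_le mt) (io4) _.
      by apply: (measurable_funS measurableT) => //; do ?[apply: measurable_funM => //].
    move=> s st; rewrite ger0_norm ?le//.
    by move: st; rewrite /= in_itv/= => /andP[s0 _]; rewrite mulr_ge0// om0.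
  split => //; apply: le_trans (le_rint mt io' io4 le) _.
  rewrite rintZ//; apply: le_trans (ler_wpM2l _ lo) _; first by rewrite invr_ge0.
  by move: (om t) => z; lra.
pose X := minimal_set ker kappa F c om h.
have [_ _ bX sX [solX Xh]] := invariant_minimal T0 vk af om1 omT omc h.
have cX : compact X := minimal_set_compact T0 vk af om1 omT omc ome (h := h).
have hX := minimal_hull_cov T0 vk af om1 omT omc ome h.
pose K n := approx_solution ker F h X n.+1%:R^-1.
have capK : \bigcap_n K n = inclusion_solution ker F h.
  exact: (approx_solution_cap T0 vk ik af om1 omT bX solX).
have cK n : compact (K n) by exact: (approx_solution_compact T0 vk af om1 omT cX bX sX hX).
have KS n : K n.+1 `<=` K n.
  by apply: approx_solution_mono; rewrite lef_pV2 ?posrE// ler_nat.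
have ctr n : contractible R (K n) /\ K n !=set0.
  have e0 : 0 < n.+1%:R^-1 :> R by rewrite invr_gt0.
  have e4 : 0 < n.+1%:R^-1 / 4 :> R by rewrite divr_gt0.
  have e2 : 0 < n.+1%:R^-1 / 2 :> R by rewrite divr_gt0.
  have [d d0 Hd] := barrier_equicontinuous T0 af om h e4.
  have d2 : 0 < d / 2 by rewrite divr_gt0.
  have eqX x s t : X x -> 0 <= s <= T -> 0 <= t <= T -> `|s - t| <= d / 2 ->
      `|ev x s - ev x t| < n.+1%:R^-1 / 4.
    move=> Xx sT tT st; apply: Hd => //; first exact: bX.
    by apply: le_lt_trans st _; rewrite ltr_pdivrMr// mulr_natr mulr2n ltrDl.
  have [N [xs [xsX net]]] := net_exists cX Xh e2.
  have [ws wsP] := choice (fun i => selection_exists T0 vk af (xs i)).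
  have nws i : nice (ws i) by have [] := wsP i.
  have wsF i := let: And3 _ _ H := wsP i in H.
  split.
    exact: (approx_solution_contractible T0 vk ik af om1 omT cX bX sX Xh hX d2 eqX xsX net nws wsF).
  exact: (approx_solution_nonempty T0 vk af om1 omT bX sX Xh d2 eqX xsX net nws wsF).
have clS : closed (inclusion_solution ker F h).
  rewrite -capK; apply: closed_bigI => n _.
  by apply: compact_closed (cK n); exact: norm_hausdorff.
split.
- by rewrite -capK; apply: bigcap_compact_nonempty => // n; have [] := ctr n.
- exact: (subclosed_compact clS cX solX).
exists (contItv T E), id, id, K; split; first by split => //; apply: continuous_subspaceT => x; exact: cvg_id.
rewrite image_id; split => //.
by move=> n; split => //; have [] := ctr n.
Qed.

End solution_structure.

(** * From the hypotheses of the theorem to the normalized data *)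

Section mnc_cov.
Context {R : realType} {E : normedModType R}.
Implicit Types A : set E.

Lemma hausdorff_mnc_ge0 A : (0 <= hausdorff_mnc A)%E.
Proof. by apply: le_ereal_inf_tmp => _ [r [r0 _] <-]; rewrite lee_fin ltW. Qed.

Lemma hausdorff_mnc_le A r : 0 < r -> cov A r -> (hausdorff_mnc A <= r%:E)%E.
Proof.
move=> r0 [l lP]; apply: ereal_inf_lbound; exists r => //; split => //.
exists [set` l]; first exact: finite_seq.
by move=> y /lP[z zl yz]; exists z => //; rewrite -ball_normE/= distrC.
Qed.

Lemma hausdorff_mnc_lt A r : (hausdorff_mnc A < r%:E)%E -> cov A r.
Proof.
move=> /ereal_inf_lt[_ [r' [r'0 [B fB AB]] <-]]; rewrite lte_fin => r'r.
have [l lB] := (finite_seqP B).1 fB; exists l => y /AB[z Bz].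
rewrite -ball_normE/= distrC => yz; exists z; last exact: lt_trans yz r'r.
by move: Bz; rewrite lB.
Qed.

End mnc_cov.

Lemma convex_set_cvx {R : realType} {E : normedModType R} (A : set E) :
  convex_set (A : set (convex_lmodType E)) -> cvx A.
Proof.
move=> cA a x y a0 a1 Ax Ay.
exact: set_mem (cA x y (Itv01 a0 a1) (mem_set Ax) (mem_set Ay)).
Qed.

Lemma admissible_field_exists {R : realType} (T : R) (E : completeNormedModType R) (p : R)
    (F : R -> E -> set E) (kappa : R -> R) : 1 <= p ->
  (forall t x, `[0, T]%classic t ->
      [/\ F t x !=set0, closed (F t x) &
          convex_set (F t x : set (convex_lmodType E))]) ->
  (forall x, exists f : R -> E,
      strongly_measurable `[0, T] f /\
      forall t, `[0, T]%classic t -> F t x (f t)) ->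
  {ae @lebesgue_measure R, forall t, `[0, T]%classic t ->
      upper_hemicontinuous (F t)} ->
  (exists c : R -> R^o, in_Lp `[0, T] p%:E c /\
      {ae @lebesgue_measure R, forall t, `[0, T]%classic t -> forall x,
        (ereal_sup [set `|y|%:E | y in F t x] <= (c t * (1 + `|x|))%:E)%E}) ->
  (exists eta : R -> R^o, in_Lp `[0, T] p%:E eta /\
      forall Omega : set E, bounded_set Omega ->
        {ae @lebesgue_measure R, forall t, `[0, T]%classic t ->
          (hausdorff_mnc (\bigcup_(x in Omega) F t x)
             <= (eta t)%:E * hausdorff_mnc Omega)%E}) ->
  (forall c : R -> R, measurable_fun setT c -> (forall t, 0 <= c t) ->
     intg `[0, T] (fun t => c t `^ p) -> intg `[0, T] (fun t => kappa t * c t)) ->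
  exists c eta : R -> R, admissible_field T kappa F c eta /\
    intg `[0, T] (fun t => c t `^ p).
Proof.
move=> p1 F1 F2 F3 [c [cp cF]] [eta [ep eF]] kp.
have mI : measurable (`[0, T]%classic : set R) := measurable_itv _.
have fI := leb_itv_lty 0 T.
have p0 : 0 < p by rewrite (lt_le_trans _ p1).
have IE s : `[0, T]%classic s = (0 <= s <= T) :> Prop by rewrite /= in_itv.
have [c' [nc ic] cc] := in_Lp_real mI p0 cp.
have [e' [ne ie] ee] := in_Lp_real mI p0 ep.
have mc : measurable_fun setT (fun s => `|c' s|) by exact: nice_norm_measurable.
have me : measurable_fun setT (fun s => `|e' s|) by exact: nice_norm_measurable.
exists (fun s => `|c' s|), (fun s => `|e' s|); split => //; split => //.
- exact: (Lp_intg mI fI p1 mc).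
- exact: kp.
- exact: kp.
- by move=> s x; rewrite -IE => /(F1 s x)[].
- by move=> s x; rewrite -IE => /(F1 s x)[].
- by move=> s x; rewrite -IE => /(F1 s x)[_ _]; exact: convex_set_cvx.
- move=> x; have [f [mf fF]] := F2 x; have [g ng gf] := strongly_measurable_nice mI mf.
  exists g; split => //; move: gf; apply: ae_mono => s gf; rewrite -IE => sT.
  by rewrite gf//; exact: fF.
- move: cc cF; apply: ae_mono2 => s cs Fs; rewrite -IE => sT x y Fy.
  rewrite -lee_fin; apply: le_trans (_ : _ <= (c s * (1 + `|x|))%:E)%E _.
    by apply: le_trans (Fs sT x); apply: ereal_sup_ubound; exists y.
  rewrite lee_fin ler_wpM2r ?addr_ge0//.
  by rewrite -(cs sT); exact: ler_norm.
- move=> Om M OmM; have bOm : bounded_set Om.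
    by exists M; split; [exact: num_real|move=> r Mr x /OmM xM; exact: le_trans xM (ltW Mr)].
  move: ee (eF Om bOm); apply: ae_mono2 => s es Fs; rewrite -IE => sT r r' r0 cr rr'.
  apply: hausdorff_mnc_lt; apply: le_lt_trans (Fs sT) _.
  apply: (@le_lt_trans _ _ (`|e' s| * r)%:E); last by rewrite lte_fin.
  rewrite EFinM -(es sT); apply: (@le_trans _ _ ((`|e' s|)%:E * hausdorff_mnc Om)%E).
    by apply: lee_wpmul2r; [exact: hausdorff_mnc_ge0|rewrite lee_fin ler_norm].
  by apply: lee_wpmul2l; [rewrite lee_fin|exact: hausdorff_mnc_le].
Qed.

(** The kernels agree off [N], and a density may be exchanged for a nice representative, so that the
    integrands coincide a.e. Membership of the density in L^p is recovered from the growth bound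
    [|w s| <= (1 + |x|) c s]. *)
Lemma solution_setE {R : realType} (T : R) (T0 : 0 < T) (E : completeNormedModType R) (p C : R)
    (F : R -> E -> set E) (k ker : R -> R -> boundedOp E E) (kappa c eta : R -> R) (N : set R)
    (h : contItv T E) : 1 <= p ->
  measurable N -> leb N = 0%E ->
  (forall t s, 0 <= s <= t -> t <= T -> ~ N s -> ker t s = k t s) ->
  volterra_kernel T ker kappa C -> admissible_field T kappa F c eta ->
  intg `[0, T] (fun t => c t `^ p) ->
  solution_set p F k h = inclusion_solution ker F h.
Proof.
move=> p1 mN N0 kk vk af ic.
have mI : measurable (`[0, T]%classic : set R) := measurable_itv _.
have fI := leb_itv_lty 0 T.
have p0 : 0 < p by rewrite (lt_le_trans _ p1).
have aeN : {ae @lebesgue_measure R, forall s, ~ N s}.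
  by exists N; split => // s /= /contrapT.
have bound (x : contItv T E) w : {ae @lebesgue_measure R, forall s, 0 <= s <= T -> F s (ev x s) (w s)} ->
    {ae @lebesgue_measure R, forall s, `[0, T]%classic s -> `|w s| <= (1 + `|x|) * c s}.
  move=> wF; move: (af_bound af) wF; apply: ae_mono2 => s sb wF; rewrite /= in_itv/= => sT.
  apply: le_trans (sb sT _ _ (wF sT)) _.
  rewrite (mulrC _ (c s)); apply: ler_wpM2l; first exact: (af_c_ge0 af).
  by rewrite lerD2l (ev_le T0).
have adm (x : contItv T E) w : nice w -> {ae @lebesgue_measure R, forall s, 0 <= s <= T -> F s (ev x s) (w s)} ->
    admissible T kappa w.
  move=> nw /bound wb; split => //.
  have [_ _ ikb] := bound_intg af (1 + `|x|).
  apply: (intg_ae mI (kappa_norm_measurable vk nw) ikb).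
  move: wb; apply: ae_mono => s wb sI; rewrite ger0_norm ?mulr_ge0 ?(vk_ge0 vk)//.
  by rewrite ler_wpM2l ?(vk_ge0 vk)// mulrC wb.
have bochner (x : E) w w' t : nice w -> admissible T kappa w -> 0 <= t <= T ->
    {ae @lebesgue_measure R, forall s, `[0, T]%classic s -> w s = w' s} ->
    has_bochner_integral `[0, t] (fun s => k t s (w' s)) (x - ev h t) <->
    x = ev h t + volterra T ker w t.
  move=> nw aw tT ww; have /andP[t0 tT'] := tT.
  have nk := kernel_app_nice vk tT nw; have ikw := kernel_app_intg vk tT aw.
  have mt : measurable (`[0, t]%classic : set R) := measurable_itv _.
  have ft := leb_itv_lty 0 t; have sub := subset_itv0 tT'.
  have ikt := intg_sub mt mI sub ikw.
  have keq : {ae @lebesgue_measure R, forall s, `[0, t]%classic s -> ker t s (w s) = k t s (w' s)}.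
    move: aeN ww; apply: ae_mono2 => s Ns ww st; rewrite ww//; last exact: sub.
    by rewrite kk//; move: st; rewrite /= in_itv.
  rewrite (has_bochnerE mt ft _ nk ikt keq) (bint_sub mt mI ft fI sub nk ikw).
    by rewrite -/(volterra T ker w t); split => [/eqP|->]; [rewrite subr_eq addrC => /eqP|rewrite addrC addKr].
  move=> s Is sn; apply: (kernel_app_out vk) => -[st _]; apply: sn.
  by rewrite /= in_itv.
apply/seteqP; split => x [w].
- move=> [wp wF wh]; have [w' [nw _] ww] := in_Lp_real mI p0 wp.
  have wF' : {ae @lebesgue_measure R, forall s, 0 <= s <= T -> F s (ev x s) (w' s)}.
    move: wF ww; apply: ae_mono2 => s wF ww sT.
    have sI : s \in `[0, T]%classic by apply: mem_set; rewrite /= in_itv.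
    rewrite ww; last exact: set_mem.
    by have := wF sI; rewrite -ev_val.
  exists w'; split => //; split => // t tT.
  have tI : t \in `[0, T]%classic by apply: mem_set; rewrite /= in_itv.
  have := wh (exist _ t tI); rewrite -!ev_val => /(bochner _ w')-> //.
  exact: adm nw wF'.
- move=> [[nw xw] wF]; exists w; split.
  + apply: (Lp_in_Lp mI p0 nw (af_c_meas af) (af_c_ge0 af) _ ic (bound x w wF)).
    exact: addr_ge0.
  + move: wF; apply: ae_mono => s wF sI; rewrite -ev_val; apply: wF.
    by have := set_mem sI; rewrite /= in_itv.
  + move=> t; have tT : 0 <= val t <= T by have := set_valP t; rewrite /= in_itv.
    rewrite -!ev_val; apply/(bochner _ w) => //; first exact: adm nw wF.
      exact: aeW.
    exact: xw.
Qed.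
Theorem theorem2 (R : realType) (T : R) (T_gt0 : 0 < T)
    (E : completeNormedModType R)
    (p : R) (q : \bar R) (p_ge1 : 1 <= p) (q_gt1 : (1 < q)%E)
    (pq : ((p%:E)^-1 + q^-1 = 1)%E)
    (E_reflexive : 1 < p -> reflexive_space E)
    (F : R -> E -> set E)
    (F1 : forall t x, `[0, T]%classic t ->
      [/\ F t x !=set0, closed (F t x) &
          convex_set (F t x : set (convex_lmodType E))])
    (F2 : forall x, exists f : R -> E,
      strongly_measurable `[0, T] f /\
      forall t, `[0, T]%classic t -> F t x (f t))
    (F3 : {ae @lebesgue_measure R, forall t, `[0, T]%classic t ->
      upper_hemicontinuous (F t)})
    (F4 : exists c : R -> R^o, in_Lp `[0, T] p%:E c /\
      {ae @lebesgue_measure R, forall t, `[0, T]%classic t -> forall x,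
        (ereal_sup [set `|y|%:E | y in F t x] <= (c t * (1 + `|x|))%:E)%E})
    (F5 : exists eta : R -> R^o, in_Lp `[0, T] p%:E eta /\
      forall Omega : set E, bounded_set Omega ->
        {ae @lebesgue_measure R, forall t, `[0, T]%classic t ->
          (hausdorff_mnc (\bigcup_(x in Omega) F t x)
             <= (eta t)%:E * hausdorff_mnc Omega)%E})
    (k dk : R -> R -> boundedOp E E)
    (k1 : forall s t, 0 <= s <= t -> t <= T ->
      has_derivative_within `[s, T] (k^~ s) t (dk t s))
    (k2 : forall t, `[0, T]%classic t -> {within `[0, t], continuous (k t)})
    (k3 : {within `[0, T], continuous (fun t => k t t)} /\
      forall t, `[0, T]%classic t -> invertible_op (k t t))
    (k4 : exists mu : R -> R^o, in_Lp `[0, T] q mu /\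
      forall s t, 0 <= s <= t -> t <= T -> `|dk t s| <= mu s)
    (h : contItv T E) :
  Rdelta_set R (solution_set p F k h).
Proof.
have [mu [muq muk]] := k4.
have muk' s t : 0 <= s <= t -> t <= T -> `|dk t s| <= mu s := muk s t.
have [N [ker [kappa [C [[mN N0] vk kk kp]]]]] :=
  kernel_exists T_gt0 p_ge1 q_gt1 pq k1 k2 k3 muq muk'.
have [c [eta [af ic]]] := admissible_field_exists p_ge1 F1 F2 F3 F4 F5 kp.
have ik : intg `[0, T] kappa.
  have -> : kappa = fun t => kappa t * 1 by apply/funext => t; rewrite mulr1.
  apply: kp => //; apply: intg_cst; first exact: measurable_itv.
  exact: leb_itv_lty.
rewrite (solution_setE T_gt0 h p_ge1 mN N0 kk vk af ic).
exact: (inclusion_solution_Rdelta T_gt0 vk ik af).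
Qed.
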